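(* Let $f(z)=z+\sum_{n=2}^\infty a_nz^n\in CV(R_1,R_2)$, let $\delta=d(f(0),\partial f(\mathbb{D}))$, and suppose $R_2\geq 2\delta$. Then $\mathcal{M}_f(r)\leq\delta$ for all $r=|z|\leq r_c:=R_2/(3R_2-2\delta)$. This radius is sharp for the function $k_a(z)=z/(1-az)$, $z\in\mathbb{D}$, where $a\in[1/2,1)$; that is, for each such $a$ there are $R_1,R_2$ with $k_a\in CV(R_1,R_2)$ and $R_2\ge 2\delta$ (with $\delta$ computed for $f=k_a$) such that $\mathcal{M}_{k_a}(r)\leq\delta$ fails for every $r\in(r_c,1)$.
   Context: $\mathbb{D}$ denotes the open unit disk in $\mathbb{C}$. For a complex valued analytic function $F(z)=\sum_{n=0}^\infty A_nz^n$ in $\mathbb{D}$, its majorant series is $\mathcal{M}_F(r):=\sum_{n=0}^\infty |A_n|r^n$ for $0\le r<1$. $d(f(0),\partial f(\mathbb{D}))$ denotes the Euclidean distance between $f(0)$ and the boundary of the domain $f(\mathbb{D})$. For an analytic locally univalent function $f$ in $\mathbb{D}$, the curvature of $f(\{z:|z|=r\})$ at the point $f(z)$ is $$\kappa_f(z)=\frac{1}{|zf'(z)|}\,\mathrm{Re}\left(1+z\frac{f''(z)}{f'(z)}\right),\qquad 0<|z|=r<1.$$ A convex analytic univalent function $f$ defined in $\mathbb{D}$ (i.e. $f$ is univalent and $f(\mathbb{D})$ is convex) is said to be in $CV(R_1,R_2)$ (convex functions of bounded type) if $f(0)=f'(0)-1=0$ and $$0<R_1\leq \liminf_{|z|\to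 1-}\frac{1}{\kappa_f(z)}\leq \limsup_{|z|\to 1-}\frac{1}{\kappa_f(z)}\leq R_2<\infty.$$ *)

(* Defs.v *)
(* Stdlib reals with Coquelicot; complex numbers are Coquelicot's C. *)
From Stdlib Require Import Reals.
From Coquelicot Require Import Coquelicot.
Open Scope R_scope.

Definition unit_disk (z : C) : Prop := Cmod z < 1.

Definition power_series_on_disk (A : nat -> C) (F : C -> C) : Prop :=
  forall z : C, unit_disk z ->
    is_pseries (K := C_AbsRing) (V := C_NormedModule) A z (F z).

Definition analytic_on_disk (F : C -> C) : Prop :=
  exists A : nat -> C, power_series_on_disk A F.

(* If A satisfies power_series_on_disk, the series converges absolutely for
   0 <= r < 1, so the default value of PSeries at a divergent series is not
   met there. *)
Definition majorant_series (A : nat -> C) (r : R) : R :=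
  PSeries (fun n => Cmod (A n)) r.

Definition image (f : C -> C) (D : C -> Prop) (w : C) : Prop :=
  exists z : C, D z /\ w = f z.

Definition univalent_on (D : C -> Prop) (f : C -> C) : Prop :=
  forall z w : C, D z -> D w -> f z = f w -> z = w.

Definition convex (E : C -> Prop) : Prop :=
  forall (u v : C) (t : R), E u -> E v -> 0 <= t <= 1 ->
    E ((1 - t)%R * u + t * v)%C.

Definition boundary (E : C -> Prop) (w : C) : Prop :=
  forall eps : R, 0 < eps ->
    (exists u : C, E u /\ Cmod (u - w) < eps) /\
    (exists v : C, ~ E v /\ Cmod (v - w) < eps).

(* The infimum is finite exactly when E has a boundary point; this is so for
   E = f(D) with f analytic and univalent on D, as f(D) is not all of C. *)
Definition dist_to_boundary (p : C) (E : C -> Prop) : R :=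
  real (Glb_Rbar (fun d => exists w : C, boundary E w /\ d = Cmod (p - w))).

(* C_derive is the complex derivative (C_derive_correct).  Division by 0 does
   not occur for f analytic, univalent and convex: then f' <> 0 on D, and
   Re (1 + z f''/f') > 0 so that 1 / curvature is also meaningful. *)
Definition curvature (f : C -> C) (z : C) : R :=
  let f' := C_derive f in
  let f'' := C_derive f' in
  1 / Cmod (z * f' z) * Re (1 + z * (f'' z / f' z))%C.

(* The filter |z| -> 1-. *)
Definition to_unit_circle (P : C -> Prop) : Prop :=
  at_left 1 (fun r => forall z : C, Cmod z = r -> P z).

Definition filter_limsup {T : Type} (F : (T -> Prop) -> Prop) (g : T -> R)
    : Rbar :=
  Rbar_glb (fun s => exists P : T -> Prop, F P /\
    s = Lub_Rbar (fun y => exists x : T, P x /\ y = g x)).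

Definition filter_liminf {T : Type} (F : (T -> Prop) -> Prop) (g : T -> R)
    : Rbar :=
  Rbar_lub (fun s => exists P : T -> Prop, F P /\
    s = Glb_Rbar (fun y => exists x : T, P x /\ y = g x)).

Definition CV (R1 R2 : R) (f : C -> C) : Prop :=
  analytic_on_disk f /\
  univalent_on unit_disk f /\
  convex (image f unit_disk) /\
  f 0%C = 0%C /\ C_derive f 0%C = 1%C /\
  0 < R1 /\
  Rbar_le R1 (filter_liminf to_unit_circle (fun z => 1 / curvature f z)) /\
  Rbar_le (filter_liminf to_unit_circle (fun z => 1 / curvature f z))
          (filter_limsup to_unit_circle (fun z => 1 / curvature f z)) /\
  Rbar_le (filter_limsup to_unit_circle (fun z => 1 / curvature f z)) R2.

Definition delta (f : C -> C) : R :=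
  dist_to_boundary (f 0%C) (image f unit_disk).

Definition critical_radius (R2 : R) (f : C -> C) : R :=
  R2 / (3 * R2 - 2 * delta f).

Definition k_fun (a : R) (z : C) : C := (z / (1 - a * z))%C.

(* Main.v *)
Require Import Defs.
From Stdlib Require Import Reals Lra Lia Classical ClassicalEpsilon.
From Coquelicot Require Import Coquelicot.
Open Scope R_scope.

(** The bound combines a rolling theorem with Bohr's inequality for functions
    bounded by one.

    Geometry.  Let [w0] be a boundary point of [f(D)] nearest to the origin, so
    that [|w0| = delta].  Blaschke's rolling theorem says that a convex domain
    whose boundary has radius of curvature at most [R2] lies in the disk of
    radius [R2] that is internally tangent at [w0]; here the centre of that
    disk is [c = (delta - R2) w0 / delta].  The curvature is only controlled on the
    level curves [f(|z| = r)] with [r] near 1, and no regularity of the boundary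
    is known, so the proof is a comparison with circles.  A circular disk that
    touches a level curve from inside has radius at most about [R2]
    ([internal_tangency], a second derivative test).  Given [a] and [q] in [f(D)],
    sweep with the circular arcs from [a] to [q], starting with the chord, which
    belongs to [f(D)] by convexity: an arc cannot leave the image as long as its
    circle has radius greater than [R2], because at the first contact with a level
    curve it would touch that curve from inside ([circular_segment_in_image]).  Now let
    [a] tend to [w0].  If [q] were outside the tangent disk, some of
    the admissible arcs would cross the tangent line at [w0], which supports [f(D)]
    ([image_in_tangent_disk]).  The topology needed here, namely that the
    boundary of [f(|z| <= r)] lies on the level curve, follows from the minimum
    principle for [|f - w|] ([minimum_modulus], [disk_image_boundary]).  The same contact
    argument with disks about the origin shows that [f(D)] is not the whole
    plane ([image_not_plane]), so that [delta] is a genuine distance.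

    Coefficients.  The function [(f - c) / R2 = b0 + b1 z + ...] is bounded by one,
    with [|b0| = a = 1 - delta / R2], and [R2 >= 2 delta] means [a >= 1/2].  Such
    coefficients satisfy
    [|bN|^2 <= (1 - a^2) (1 - |b0|^2 - ... - |b(N-1)|^2)]
    ([schur_coefficient_bound], from Parseval's identity and one test function).
    It follows that the sums [|b1|^2 + ... + |bN|^2] are at most those of the Moebius
    map with coefficients [(1 - a^2) a^(n-1)], and for [r <= a] the comparison
    passes to [|b1| r + |b2| r^2 + ... <= (1 - a^2) r / (1 - a r)].  The right side is at
    most [1 - a = delta / R2] exactly if [r <= 1 / (1 + 2 a)], and [1 / (1 + 2 a)]
    is the critical radius ([bohr_sum]).

    Sharpness.  The function [z / (1 - a z)] maps [D] onto a disk of radius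
    [1 / (1 - a^2)], with [delta = 1 / (1 + a)], and circles about the origin onto
    circles, so the curvature is explicit; its value [r / (1 - a r)] at [r] is a lower
    bound of the majorant series and exceeds [delta] beyond the critical
    radius. *)

(** * Moduli, finite sums and limits of complex numbers *)

Lemma Ceq (z w : C) : Re z = Re w -> Im z = Im w -> z = w.
Proof. intros H1 H2. apply injective_projections; assumption. Qed.

Lemma Re_plus (z w : C) : Re (z + w)%C = Re z + Re w.
Proof. reflexivity. Qed.

Lemma Re_minus (z w : C) : Re (z - w)%C = Re z - Re w.
Proof. reflexivity. Qed.

Lemma Re_mult (z w : C) : Re (z * w)%C = Re z * Re w - Im z * Im w.
Proof. reflexivity. Qed.

Lemma Im_plus (z w : C) : Im (z + w)%C = Im z + Im w.
Proof. reflexivity. Qed.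

Lemma Im_minus (z w : C) : Im (z - w)%C = Im z - Im w.
Proof. reflexivity. Qed.

Lemma Im_mult (z w : C) : Im (z * w)%C = Re z * Im w + Im z * Re w.
Proof. reflexivity. Qed.

Lemma Cmod_le_sqr (z : C) (r : R) : 0 <= r -> Cmod z ^ 2 <= r ^ 2 -> Cmod z <= r.
Proof. intros Hr H. pose proof (Cmod_ge_0 z). nra. Qed.

Lemma Cmod_lt_sqr (z : C) (r : R) : 0 <= r -> Cmod z ^ 2 < r ^ 2 -> Cmod z < r.
Proof. intros Hr H. pose proof (Cmod_ge_0 z). nra. Qed.

Lemma im_le_Cmod (z : C) : Rabs (Im z) <= Cmod z.
Proof.
  pose proof (Rmax_Cmod z) as H. unfold Im.
  pose proof (Rmax_r (Rabs (fst z)) (Rabs (snd z))). lra.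
Qed.

Lemma Cmod_minus_sym (z w : C) : Cmod (z - w) = Cmod (w - z).
Proof. rewrite <- (Cmod_opp (w - z)). f_equal. ring. Qed.

Lemma Cmod_minus_triangle (z w v : C) : Cmod (z - w) <= Cmod (z - v) + Cmod (v - w).
Proof. replace (z - w)%C with ((z - v) + (v - w))%C by ring. apply Cmod_triangle. Qed.

Lemma Cmod_plus_ge (z w : C) : Cmod z - Cmod w <= Cmod (z + w).
Proof.
  pose proof (Cmod_triangle (z + w) (- w)) as H. rewrite Cmod_opp in H.
  replace (z + w + - w)%C with z in H by ring. lra.
Qed.

Lemma Cmod_minus_ge (z w : C) : Cmod z - Cmod w <= Cmod (z - w).
Proof. pose proof (Cmod_plus_ge z (- w)) as H. rewrite Cmod_opp in H. exact H. Qed.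

Lemma Cmod_scal (t : R) (z : C) : 0 <= t -> Cmod (t * z) = t * Cmod z.
Proof. intros Ht. rewrite Cmod_mult, Cmod_R, Rabs_pos_eq; auto. Qed.

Lemma Cmod_sum_sqr_conj (z w : C) :
  Cmod (z + w) ^ 2 = Cmod z ^ 2 + Cmod w ^ 2 + 2 * Re (Cconj w * z)%C.
Proof. rewrite !Cmod2_alt. destruct z, w; simpl; ring. Qed.

(** Sums over the indices [0, ..., n - 1]: the exclusive bound makes the shifts
    of index below free of special cases. *)
Fixpoint csum (a : nat -> C) (n : nat) : C :=
  match n with O => 0%C | S m => (csum a m + a m)%C end.

Fixpoint rsum (a : nat -> R) (n : nat) : R :=
  match n with O => 0 | S m => rsum a m + a m end.

Lemma csum_ext (a b : nat -> C) (n : nat) :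
  (forall k, (k < n)%nat -> a k = b k) -> csum a n = csum b n.
Proof.
  induction n as [|n IH]; intros H; simpl; [reflexivity|].
  rewrite IH, (H n) by auto with arith. reflexivity.
Qed.

Lemma csum_plus (a b : nat -> C) (n : nat) :
  csum (fun k => a k + b k)%C n = (csum a n + csum b n)%C.
Proof. induction n as [|n IH]; simpl; [|rewrite IH]; ring. Qed.

Lemma csum_scal (c : C) (a : nat -> C) (n : nat) :
  csum (fun k => c * a k)%C n = (c * csum a n)%C.
Proof. induction n as [|n IH]; simpl; [|rewrite IH]; ring. Qed.

Lemma csum_shift (a : nat -> C) (n : nat) :
  csum a (S n) = (a O + csum (fun k => a (S k)) n)%C.
Proof. induction n as [|n IH]; [simpl; ring|]. simpl in *. rewrite IH. ring. Qed.

Lemma csum_zero (a : nat -> C) (n : nat) :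
  (forall k, (k < n)%nat -> a k = 0%C) -> csum a n = 0%C.
Proof.
  induction n as [|n IH]; intros H; simpl; [reflexivity|].
  rewrite IH, (H n) by auto with arith. ring.
Qed.

Lemma csum_split (a : nat -> C) (n m : nat) :
  csum a (n + m) = (csum a n + csum (fun k => a (n + k)%nat) m)%C.
Proof.
  induction m as [|m IH]; [rewrite Nat.add_0_r; simpl; ring|].
  rewrite Nat.add_succ_r. simpl. rewrite IH. ring.
Qed.

Lemma Cmod_csum_le (a : nat -> C) (b : nat -> R) (n : nat) :
  (forall k, (k < n)%nat -> Cmod (a k) <= b k) -> Cmod (csum a n) <= rsum b n.
Proof.
  induction n as [|n IH]; intros H; simpl; [rewrite Cmod_0; lra|].
  pose proof (Cmod_triangle (csum a n) (a n)).
  pose proof (H n ltac:(lia)). pose proof (IH (fun k hk => H k ltac:(lia))). lra.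
Qed.

Lemma rsum_ext (a b : nat -> R) (n : nat) :
  (forall k, (k < n)%nat -> a k = b k) -> rsum a n = rsum b n.
Proof.
  induction n as [|n IH]; intros H; simpl; [reflexivity|].
  rewrite IH, (H n) by auto with arith. reflexivity.
Qed.

Lemma rsum_le (a b : nat -> R) (n : nat) :
  (forall k, (k < n)%nat -> a k <= b k) -> rsum a n <= rsum b n.
Proof.
  induction n as [|n IH]; intros H; simpl; [lra|].
  pose proof (H n ltac:(lia)). pose proof (IH (fun k hk => H k ltac:(lia))). lra.
Qed.

Lemma rsum_plus (a b : nat -> R) (n : nat) :
  rsum (fun k => a k + b k) n = rsum a n + rsum b n.
Proof. induction n as [|n IH]; simpl; [|rewrite IH]; ring. Qed.

Lemma rsum_scal (c : R) (a : nat -> R) (n : nat) :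
  rsum (fun k => c * a k) n = c * rsum a n.
Proof. induction n as [|n IH]; simpl; [|rewrite IH]; ring. Qed.

Lemma rsum_shift (a : nat -> R) (n : nat) :
  rsum a (S n) = a O + rsum (fun k => a (S k)) n.
Proof. induction n as [|n IH]; [simpl; ring|]. simpl in *. rewrite IH. ring. Qed.

Lemma rsum_mono (a : nat -> R) (n m : nat) :
  (forall k, 0 <= a k) -> (n <= m)%nat -> rsum a n <= rsum a m.
Proof.
  intros H. induction 1 as [|m Hm IH]; simpl; [lra|]. pose proof (H m). lra.
Qed.

Lemma rsum_nonneg (a : nat -> R) (n : nat) : (forall k, 0 <= a k) -> 0 <= rsum a n.
Proof. intros H. apply (rsum_mono a 0 n); auto with arith. Qed.

Lemma rsum_sum_n (a : nat -> R) (n : nat) : sum_n a n = rsum a (S n).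
Proof.
  induction n as [|n IH]; [rewrite sum_O; simpl; ring|].
  rewrite sum_Sn, IH. reflexivity.
Qed.

Lemma is_series_rsum (a : nat -> R) (l : R) : is_series a l -> is_lim_seq (rsum a) l.
Proof.
  intros H. apply is_lim_seq_incr_1.
  apply (is_lim_seq_ext (sum_n a)); [intros n; apply rsum_sum_n|exact H].
Qed.

Lemma rsum_le_Series (a : nat -> R) (n : nat) :
  (forall k, 0 <= a k) -> ex_series a -> rsum a n <= Series a.
Proof.
  intros Hpos Hex. apply Series_correct, is_series_rsum in Hex.
  apply (is_lim_seq_incr_compare _ _ Hex).
  intros k. simpl. pose proof (Hpos k). lra.
Qed.

Lemma ex_series_rsum_bounded (a : nat -> R) (B : R) :
  (forall k, 0 <= a k) -> (forall n, rsum a n <= B) -> ex_series a.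
Proof.
  intros Hpos HB.
  destruct (ex_finite_lim_seq_incr (rsum a) B) as [l Hl].
  - intros n. simpl. pose proof (Hpos n). lra.
  - exact HB.
  - exists l. apply is_lim_seq_incr_1 in Hl. change (is_lim_seq (sum_n a) l).
    apply (is_lim_seq_ext (fun n => rsum a (S n))); [|exact Hl].
    intros n. symmetry. apply rsum_sum_n.
Qed.

Lemma Series_le_bound (a : nat -> R) (B : R) :
  (forall k, 0 <= a k) -> (forall n, rsum a n <= B) -> Series a <= B.
Proof.
  intros Hpos HB. pose proof (ex_series_rsum_bounded a B Hpos HB) as Hex.
  apply Series_correct, is_series_rsum in Hex.
  exact (is_lim_seq_le _ (fun _ => B) _ _ HB Hex (is_lim_seq_const B)).
Qed.

Definition cvg (u : nat -> C) (l : C) : Prop := is_lim_seq (fun n => Cmod (u n - l)) 0.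

Lemma cvg_dominated (u : nat -> C) (l : C) (v : nat -> R) :
  (forall n, Cmod (u n - l) <= v n) -> is_lim_seq v 0 -> cvg u l.
Proof.
  intros H Hv. apply (is_lim_seq_le_le (fun _ => 0) _ v); auto.
  - intros n. split; [apply Cmod_ge_0|apply H].
  - apply is_lim_seq_const.
Qed.

Lemma cvg_ext (u v : nat -> C) (l : C) : (forall n, u n = v n) -> cvg u l -> cvg v l.
Proof. intros H. apply is_lim_seq_ext. intros n. rewrite H. reflexivity. Qed.

Lemma cvg_plus (u v : nat -> C) (l m : C) :
  cvg u l -> cvg v m -> cvg (fun n => u n + v n)%C (l + m)%C.
Proof.
  intros Hu Hv.
  apply (cvg_dominated _ _ (fun n => Cmod (u n - l) + Cmod (v n - m))).
  - intros n. replace (u n + v n - (l + m))%C with ((u n - l) + (v n - m))%C by ring.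
    apply Cmod_triangle.
  - replace (Finite 0) with (Finite (0 + 0)) by (f_equal; ring).
    apply is_lim_seq_plus'; assumption.
Qed.

Lemma cvg_scal (c : C) (u : nat -> C) (l : C) : cvg u l -> cvg (fun n => c * u n)%C (c * l)%C.
Proof.
  intros Hu. apply (cvg_dominated _ _ (fun n => Cmod c * Cmod (u n - l))).
  - intros n. replace (c * u n - c * l)%C with (c * (u n - l))%C by ring.
    rewrite Cmod_mult. lra.
  - replace (Finite 0) with (Finite (Cmod c * 0)) by (f_equal; ring).
    apply (is_lim_seq_scal_l _ (Cmod c) 0 Hu).
Qed.

Lemma cvg_shift (u : nat -> C) (l : C) : cvg u l -> cvg (fun n => u (S n)) l.
Proof. intros H. exact (proj1 (is_lim_seq_incr_1 _ _) H). Qed.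

Lemma cvg_Cmod_le (u : nat -> C) (l : C) (v : nat -> R) (B : R) :
  cvg u l -> (forall n, Cmod (u n) <= v n) -> is_lim_seq v B -> Cmod l <= B.
Proof.
  intros Hu Hb Hv.
  apply (is_lim_seq_le (fun _ => Cmod l) (fun n => v n + Cmod (u n - l)) (Cmod l) B).
  - intros n. pose proof (Cmod_triangle (u n) (l - u n)) as H.
    replace (u n + (l - u n))%C with l in H by ring.
    rewrite (Cmod_minus_sym l) in H. pose proof (Hb n). lra.
  - apply is_lim_seq_const.
  - replace (Finite B) with (Finite (B + 0)) by (f_equal; ring).
    apply is_lim_seq_plus'; assumption.
Qed.

Lemma cvg_unique (u : nat -> C) (l m : C) : cvg u l -> cvg u m -> l = m.
Proof.
  intros Hl Hm.
  assert (H : cvg (fun n => u n + (-1) * u n)%C (l + (-1) * m)%C)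
    by (apply cvg_plus; [|apply cvg_scal]; assumption).
  assert (H' : Cmod (l + (-1) * m) <= 0).
  { apply (cvg_Cmod_le _ _ (fun _ => 0) 0 H); [|apply is_lim_seq_const].
    intros n. replace (u n + (-1) * u n)%C with (RtoC 0) by ring.
    rewrite Cmod_0. lra. }
  pose proof (Cmod_ge_0 (l + (-1) * m)).
  assert (E : (l + (-1) * m = 0)%C) by (apply Cmod_eq_0; lra).
  replace l with (l + (-1) * m + m)%C by ring. rewrite E. ring.
Qed.

(** * Complex power series on the unit disk *)

Definition pssum (A : nat -> C) (z : C) (n : nat) : C := csum (fun k => A k * z ^ k)%C n.

Lemma sum_n_pssum (A : nat -> C) (z : C) (m : nat) :
  sum_n (G := NormedModule.AbelianMonoid C_AbsRing C_NormedModule)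
    (fun k => scal (pow_n (z : C_AbsRing) k) (A k : C_NormedModule)) m = pssum A z (S m).
Proof.
  assert (P : forall k, pow_n (z : C_AbsRing) k = (z ^ k)%C).
  { induction k as [|k IHk]; [reflexivity|]. exact (f_equal (Cmult z) IHk). }
  assert (T : forall k, scal (pow_n (z : C_AbsRing) k) (A k : C_NormedModule) = (A k * z ^ k)%C).
  { intros k. rewrite P. apply Cmult_comm. }
  unfold pssum. induction m as [|m IH].
  - rewrite sum_O, T. simpl. ring.
  - rewrite sum_Sn, IH, T. reflexivity.
Qed.

Lemma is_pseries_cvg (A : nat -> C) (z l : C) :
  is_pseries (K := C_AbsRing) (V := C_NormedModule) A z l <-> cvg (pssum A z) l.
Proof.
  assert (Hball : forall n (eps : posreal),
    ball_norm (l : C_NormedModule) eps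
      (sum_n (G := NormedModule.AbelianMonoid C_AbsRing C_NormedModule)
         (fun k => scal (pow_n (z : C_AbsRing) k) (A k : C_NormedModule)) n) <->
    Rabs (Cmod (pssum A z (S n) - l) - 0) < eps).
  { intros n eps. rewrite sum_n_pssum, Rminus_0_r, Rabs_pos_eq by apply Cmod_ge_0. reflexivity. }
  split; intros H.
  - apply is_lim_seq_incr_1, is_lim_seq_spec. intros eps.
    destruct (proj1 (filterlim_locally_ball_norm (K := C_AbsRing) _ _) H eps) as [N HN].
    exists N. intros n Hn. apply Hball, HN, Hn.
  - apply (proj2 (filterlim_locally_ball_norm (K := C_AbsRing) _ (l : C_NormedModule))). intros eps.
    apply is_lim_seq_incr_1, is_lim_seq_spec in H. destruct (H eps) as [N HN].
    exists N. intros n Hn. apply Hball, HN, Hn.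
Qed.

(** Stated for the real series of moduli, so that the theory of real power series
    yields absolute convergence and the radius of the derived series. *)
Definition radius_ge_1 (A : nat -> C) : Prop :=
  Rbar_le 1 (CV_radius (fun n => Cmod (A n))).

(** Convergence at a point [rho < 1] bounds the terms [A n * rho ^ n], which is
    all that the radius of convergence asks for. *)
Lemma power_series_radius (A : nat -> C) (f : C -> C) :
  power_series_on_disk A f -> radius_ge_1 A.
Proof.
  intros H. unfold radius_ge_1.
  assert (HB : forall rho, 0 < rho < 1 -> Rbar_le rho (CV_radius (fun n => Cmod (A n)))).
  { intros rho Hrho.
    apply (proj1 (CV_radius_bounded (fun n => Cmod (A n)))).
    assert (Hz : unit_disk rho) by (unfold unit_disk; rewrite Cmod_R, Rabs_pos_eq; lra).
    pose proof (proj1 (is_pseries_cvg _ _ _) (H rho Hz)) as Hc.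
    destruct (filterlim_bounded (K := R_AbsRing) (V := R_NormedModule) (fun n => Cmod (pssum A rho n - f rho))) as [M HM].
    { exists 0. exact Hc. }
    exists (M + M). intros n.
    assert (E : (A n * rho ^ n)%C = ((pssum A rho (S n) - f rho) - (pssum A rho n - f rho))%C)
      by (unfold pssum; simpl; ring).
    rewrite Rabs_pos_eq by (apply Rmult_le_pos; [apply Cmod_ge_0|apply pow_le; lra]).
    replace (Cmod (A n) * rho ^ n) with (Cmod (A n * rho ^ n)).
    2:{ rewrite Cmod_mult, Cmod_pow, Cmod_R, Rabs_pos_eq; lra. }
    rewrite E.
    pose proof (Cmod_triangle (pssum A rho (S n) - f rho) (- (pssum A rho n - f rho))) as T.
    rewrite Cmod_opp in T.
    pose proof (HM (S n)) as H1. pose proof (HM n) as H2.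
    change (Rabs (Cmod (pssum A rho (S n) - f rho)) <= M) in H1.
    change (Rabs (Cmod (pssum A rho n - f rho)) <= M) in H2.
    rewrite Rabs_pos_eq in H1, H2 by apply Cmod_ge_0.
    unfold Cminus in *. lra. }
  destruct (CV_radius (fun n => Cmod (A n))) as [x| |] eqn:Ex; simpl in *; auto.
  - destruct (Rle_lt_dec 1 x) as [|Hx]; auto. exfalso.
    pose proof (HB (1 / 2) ltac:(lra)). pose proof (HB ((1 + x) / 2) ltac:(lra)). lra.
  - apply (HB (1 / 2)). lra.
Qed.

Lemma radius_ge_1_lt (A : nat -> C) (rho : R) :
  radius_ge_1 A -> 0 <= rho < 1 -> Rbar_lt (Rabs rho) (CV_radius (fun n => Cmod (A n))).
Proof.
  intros HA Hrho. rewrite Rabs_pos_eq by lra.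
  apply (Rbar_lt_le_trans _ 1); [exact (proj2 Hrho)|exact HA].
Qed.

Lemma radius_ge_1_ex_series (A : nat -> C) (rho : R) :
  radius_ge_1 A -> 0 <= rho < 1 -> ex_series (fun n => Cmod (A n) * rho ^ n).
Proof.
  intros HA Hrho. pose proof (CV_disk_inside _ _ (radius_ge_1_lt A rho HA Hrho)) as H.
  apply (ex_series_ext (K := R_AbsRing) (fun n => Rabs (Cmod (A n) * rho ^ n))); [|exact H].
  intros n. apply Rabs_pos_eq, Rmult_le_pos; [apply Cmod_ge_0|apply pow_le; lra].
Qed.

Definition ps_deriv (A : nat -> C) (n : nat) : C := (INR (S n) * A (S n))%C.

Lemma Cmod_ps_deriv (A : nat -> C) (n : nat) :
  Cmod (ps_deriv A n) = PS_derive (fun k => Cmod (A k)) n.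
Proof. apply Cmod_scal, pos_INR. Qed.

Lemma ps_deriv_radius (A : nat -> C) : radius_ge_1 A -> radius_ge_1 (ps_deriv A).
Proof.
  unfold radius_ge_1. intros H.
  rewrite (CV_radius_ext _ _ (Cmod_ps_deriv A)), CV_radius_derive. exact H.
Qed.

Definition ps_fun (A : nat -> C) (z : C) : C :=
  (Series (fun n => Re (A n * z ^ n)%C), Series (fun n => Im (A n * z ^ n)%C)).

Lemma ps_fun_cvg (A : nat -> C) (z : C) :
  radius_ge_1 A -> Cmod z < 1 -> cvg (pssum A z) (ps_fun A z).
Proof.
  intros HA Hz.
  pose proof (radius_ge_1_ex_series A (Cmod z) HA (conj (Cmod_ge_0 z) Hz)) as Hex.
  assert (ET : forall n, Cmod (A n * z ^ n) = Cmod (A n) * Cmod z ^ n)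
    by (intros n; rewrite Cmod_mult, Cmod_pow; reflexivity).
  assert (HR : ex_series (fun n => Re (A n * z ^ n)%C)).
  { apply (ex_series_le (K := R_AbsRing) (V := R_CompleteNormedModule) _ _) with (2 := Hex).
    intros n. rewrite <- ET. apply re_le_Cmod. }
  assert (HI : ex_series (fun n => Im (A n * z ^ n)%C)).
  { apply (ex_series_le (K := R_AbsRing) (V := R_CompleteNormedModule) _ _) with (2 := Hex).
    intros n. rewrite <- ET. apply im_le_Cmod. }
  apply Series_correct, is_series_rsum in HR.
  apply Series_correct, is_series_rsum in HI.
  assert (ER : forall n, Re (pssum A z n) = rsum (fun n => Re (A n * z ^ n)%C) n)
    by (induction n as [|n IH]; [reflexivity|exact (f_equal2 Rplus IH eq_refl)]).
  assert (EI : forall n, Im (pssum A z n) = rsum (fun n => Im (A n * z ^ n)%C) n)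
    by (induction n as [|n IH]; [reflexivity|exact (f_equal2 Rplus IH eq_refl)]).
  apply (cvg_dominated _ _ (fun n => Rabs (Re (pssum A z n) - Re (ps_fun A z)) +
                                     Rabs (Im (pssum A z n) - Im (ps_fun A z)))).
  - intros n. set (w := (pssum A z n - ps_fun A z)%C).
    change (Cmod w <= Rabs (Re w) + Rabs (Im w)).
    pose proof (Rabs_pos (Re w)). pose proof (Rabs_pos (Im w)).
    apply Cmod_le_sqr; [lra|]. rewrite Cmod2_alt, <- (pow2_abs (Re w)), <- (pow2_abs (Im w)). nra.
  - replace (Finite 0) with (Finite (0 + 0)) by (f_equal; ring).
    apply is_lim_seq_plus'.
    + apply (is_lim_seq_ext (fun n => Rabs (rsum (fun n => Re (A n * z ^ n)%C) n - Re (ps_fun A z)))).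
      { intros n. rewrite <- ER. reflexivity. }
      apply (proj1 (is_lim_seq_abs_0 _)).
      replace (Finite 0) with (Finite (Re (ps_fun A z) - Re (ps_fun A z))) by (f_equal; ring).
      apply is_lim_seq_minus'; [exact HR|apply is_lim_seq_const].
    + apply (is_lim_seq_ext (fun n => Rabs (rsum (fun n => Im (A n * z ^ n)%C) n - Im (ps_fun A z)))).
      { intros n. rewrite <- EI. reflexivity. }
      apply (proj1 (is_lim_seq_abs_0 _)).
      replace (Finite 0) with (Finite (Im (ps_fun A z) - Im (ps_fun A z))) by (f_equal; ring).
      apply is_lim_seq_minus'; [exact HI|apply is_lim_seq_const].
Qed.

Lemma power_series_ps_fun (A : nat -> C) (f : C -> C) (z : C) :
  power_series_on_disk A f -> Cmod z < 1 -> f z = ps_fun A z.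
Proof.
  intros H Hz. apply (cvg_unique (pssum A z)).
  - apply is_pseries_cvg, H, Hz.
  - apply ps_fun_cvg; [|exact Hz]. exact (power_series_radius A f H).
Qed.

(** The complex derivative as a first-order expansion, the form in which it is
    obtained from remainder estimates and composed with curves. *)
Definition cdiff (f : C -> C) (z l : C) : Prop :=
  forall eps, 0 < eps -> exists eta, 0 < eta /\
    forall h, Cmod h < eta -> Cmod (f (z + h)%C - f z - l * h) <= eps * Cmod h.

Lemma cdiff_C_derive (f : C -> C) (z l : C) : cdiff f z l -> C_derive f z = l.
Proof.
  intros H. apply is_C_derive_unique. split.
  - apply (@is_linear_scal_l C_AbsRing C_NormedModule l).
  - intros x Hx.
    apply (is_filter_lim_locally_unique (V := AbsRing_NormedModule C_AbsRing) z x) in Hx.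
    rewrite <- Hx. clear x Hx.
    intros eps. destruct (H eps (cond_pos eps)) as [eta [Heta He]].
    apply (locally_le_locally_norm (V := AbsRing_NormedModule C_AbsRing)).
    exists (mkposreal eta Heta). intros y Hy.
    change (Cmod (y - z) < eta) in Hy. specialize (He _ Hy).
    assert (E : forall a b : C, (a + (b - a))%C = b) by (intros a b; ring).
    rewrite E in He.
    change (Cmod (f y - f z - (y - z) * l) <= eps * Cmod (y - z)).
    rewrite (Cmult_comm (y - z) l). exact He.
Qed.

Lemma cdiff_ext (f g : C -> C) (z l : C) (eta : R) :
  0 < eta -> (forall h, Cmod h < eta -> f (z + h)%C = g (z + h)%C) ->
  cdiff f z l -> cdiff g z l.
Proof.
  intros Heta Heq H eps Heps. destruct (H eps Heps) as [e1 [He1 H1]].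
  exists (Rmin eta e1). split; [apply Rmin_pos; assumption|].
  intros h Hh. pose proof (Rmin_l eta e1). pose proof (Rmin_r eta e1).
  rewrite <- Heq by lra.
  replace (g z) with (f z).
  2:{ replace z with (z + 0)%C by ring. apply Heq. rewrite Cmod_0. exact Heta. }
  apply H1. lra.
Qed.

Lemma cdiff_continuous (f : C -> C) (z l : C) :
  cdiff f z l -> forall eps, 0 < eps -> exists eta, 0 < eta /\
    forall w, Cmod (w - z) < eta -> Cmod (f w - f z) < eps.
Proof.
  intros H eps Heps. destruct (H 1 Rlt_0_1) as [e1 [He1 H1]].
  pose proof (Cmod_ge_0 l) as Hl.
  exists (Rmin e1 (eps / (Cmod l + 1))). split.
  { apply Rmin_pos; auto. apply Rdiv_lt_0_compat; lra. }
  intros w Hw. pose proof (Rmin_l e1 (eps / (Cmod l + 1))).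
  pose proof (Rmin_r e1 (eps / (Cmod l + 1))).
  specialize (H1 (w - z)%C ltac:(lra)).
  replace (z + (w - z))%C with w in H1 by ring.
  pose proof (Cmod_triangle (f w - f z - l * (w - z)) (l * (w - z))) as T.
  replace (f w - f z - l * (w - z) + l * (w - z))%C with (f w - f z)%C in T by ring.
  rewrite (Cmod_mult l) in T.
  assert (Hlt : Cmod (w - z) * (Cmod l + 1) < eps).
  { apply (Rlt_le_trans _ (eps / (Cmod l + 1) * (Cmod l + 1))).
    - apply Rmult_lt_compat_r; lra.
    - right. field. lra. }
  nra.
Qed.

Lemma pow_remainder (z h : C) (rho : R) (k : nat) :
  Cmod z <= rho -> Cmod (z + h) <= rho ->
  Cmod ((z + h) ^ S (S k) - z ^ S (S k) - INR (S (S k)) * z ^ S k * h)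
  <= INR (S (S k)) * INR (S k) * rho ^ k * Cmod h ^ 2.
Proof.
  intros Hz Hzh. pose proof (Cmod_ge_0 z) as Hz0. pose proof (Cmod_ge_0 h) as Hh0.
  pose proof (Cmod_ge_0 (z + h)) as Hzh0.
  induction k as [|k IH].
  - replace ((z + h) ^ 2 - z ^ 2 - INR 2 * z ^ 1 * h)%C with (h ^ 2)%C.
    2:{ simpl (INR 2). rewrite RtoC_plus. simpl. ring. }
    rewrite Cmod_pow. simpl. nra.
  - replace ((z + h) ^ S (S (S k)) - z ^ S (S (S k)) - INR (S (S (S k))) * z ^ S (S k) * h)%C
      with ((z + h) * ((z + h) ^ S (S k) - z ^ S (S k) - INR (S (S k)) * z ^ S k * h)
            + INR (S (S k)) * (h ^ 2 * z ^ S k))%C.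
    2:{ rewrite (S_INR (S (S k))), RtoC_plus. simpl. ring. }
    eapply Rle_trans; [apply Cmod_triangle|].
    rewrite Cmod_mult, (Cmod_scal (INR (S (S k)))) by apply pos_INR.
    rewrite (Cmod_mult (h ^ 2)), !Cmod_pow.
    assert (Hp : Cmod z ^ S k <= rho ^ S k) by (apply pow_incr; lra).
    assert (H0 : 0 <= Cmod z ^ S k) by (apply pow_le; lra).
    assert (Hr : 0 <= rho ^ S k) by (apply pow_le; lra).
    set (u := Cmod ((z + h) ^ S (S k) - z ^ S (S k) - INR (S (S k)) * z ^ S k * h)) in *.
    assert (Hu : 0 <= u) by apply Cmod_ge_0.
    assert (Hi : 0 <= INR (S (S k))) by apply pos_INR.
    assert (Hh2 : 0 <= Cmod h ^ 2) by apply pow2_ge_0.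
    apply (Rle_trans _ (rho * (INR (S (S k)) * INR (S k) * rho ^ k * Cmod h ^ 2)
                        + INR (S (S k)) * (Cmod h ^ 2 * rho ^ S k))).
    + apply Rplus_le_compat.
      * apply Rmult_le_compat; lra.
      * apply Rmult_le_compat_l; [lra|]. apply Rmult_le_compat_l; lra.
    + assert (E : rho ^ S k = rho * rho ^ k) by reflexivity.
      replace (rho * (INR (S (S k)) * INR (S k) * rho ^ k * Cmod h ^ 2)
                        + INR (S (S k)) * (Cmod h ^ 2 * rho ^ S k))
        with (INR (S (S k)) * (INR (S k) + 1) * rho ^ S k * Cmod h ^ 2) by (rewrite E; ring).
      rewrite <- S_INR, (S_INR (S (S k))).
      apply Rmult_le_compat_r; [lra|]. apply Rmult_le_compat_r; [lra|].
      apply Rmult_le_compat; lra.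
Qed.

(** Termwise, the error of the linear approximation is at most
    [|h|^2 k (k - 1) |A k| rho ^ (k - 2)], and these bounds sum to [|h|^2]
    times a second derivative of the series of moduli. *)
Lemma ps_fun_cdiff (A : nat -> C) (z : C) :
  radius_ge_1 A -> Cmod z < 1 -> cdiff (ps_fun A) z (ps_fun (ps_deriv A) z).
Proof.
  intros HA Hz.
  set (rho := (1 + Cmod z) / 2). pose proof (Cmod_ge_0 z) as Hz0.
  assert (Hrho : 0 <= rho < 1) by (unfold rho; lra).
  pose proof (ps_deriv_radius A HA) as HA1.
  pose proof (ps_deriv_radius _ HA1) as HA2.
  set (B := Series (fun n => Cmod (ps_deriv (ps_deriv A) n) * rho ^ n)).
  assert (Hpos : forall n, 0 <= Cmod (ps_deriv (ps_deriv A) n) * rho ^ n)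
    by (intros n; apply Rmult_le_pos; [apply Cmod_ge_0|apply pow_le; lra]).
  assert (HBn : forall n, rsum (fun n => Cmod (ps_deriv (ps_deriv A) n) * rho ^ n) n <= B)
    by (intros n; apply rsum_le_Series; [exact Hpos|apply radius_ge_1_ex_series; assumption]).
  assert (HB0 : 0 <= B) by (pose proof (HBn O); simpl in *; lra).
  assert (Key : forall h, Cmod h < rho - Cmod z ->
    Cmod (ps_fun A (z + h) - ps_fun A z - ps_fun (ps_deriv A) z * h) <= Cmod h ^ 2 * B).
  { intros h Hh.
    assert (Hzh : Cmod (z + h) <= rho) by (pose proof (Cmod_triangle z h); lra).
    assert (C1 := cvg_shift _ _ (cvg_shift _ _ (ps_fun_cvg A (z + h) HA ltac:(lra)))).
    assert (C2 := cvg_shift _ _ (cvg_shift _ _ (ps_fun_cvg A z HA Hz))).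
    assert (C3 := cvg_shift _ _ (ps_fun_cvg (ps_deriv A) z HA1 Hz)).
    assert (C4 := cvg_plus _ _ _ _ C1 (cvg_plus _ _ _ _ (cvg_scal (-1) _ _ C2) (cvg_scal (- h) _ _ C3))).
    replace (ps_fun A (z + h) - ps_fun A z - ps_fun (ps_deriv A) z * h)%C
      with (ps_fun A (z + h) + (-1 * ps_fun A z + - h * ps_fun (ps_deriv A) z))%C by ring.
    apply (cvg_Cmod_le _ _ (fun _ => Cmod h ^ 2 * B) _ C4); [|apply is_lim_seq_const].
    intros n. cbv beta.
    apply (Rle_trans _ (rsum (fun k => Cmod h ^ 2 * (Cmod (ps_deriv (ps_deriv A) k) * rho ^ k)) n)).
    2:{ rewrite rsum_scal. apply Rmult_le_compat_l; [apply pow2_ge_0|apply HBn]. }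
    replace (pssum A (z + h) (S (S n)) + (-1 * pssum A z (S (S n)) + - h * pssum (ps_deriv A) z (S n)))%C
      with (csum (fun k => A (S (S k)) *
          ((z + h) ^ S (S k) - z ^ S (S k) - INR (S (S k)) * z ^ S k * h))%C n).
    - apply Cmod_csum_le. intros k _. rewrite Cmod_mult.
      pose proof (pow_remainder z h rho k ltac:(unfold rho; lra) Hzh) as P.
      replace (Cmod h ^ 2 * (Cmod (ps_deriv (ps_deriv A) k) * rho ^ k))
        with (Cmod (A (S (S k))) * (INR (S (S k)) * INR (S k) * rho ^ k * Cmod h ^ 2)).
      + apply Rmult_le_compat_l; [apply Cmod_ge_0|exact P].
      + unfold ps_deriv. rewrite !Cmod_scal by apply pos_INR. ring.
    - unfold pssum. rewrite !csum_shift.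
      replace (csum (fun k => A (S (S k)) *
          ((z + h) ^ S (S k) - z ^ S (S k) - INR (S (S k)) * z ^ S k * h))%C n)
        with (csum (fun k => A (S (S k)) * (z + h) ^ S (S k) +
               (-1 * (A (S (S k)) * z ^ S (S k)) + - h * (ps_deriv A (S k) * z ^ S k)))%C n).
      2:{ apply csum_ext. intros k _. unfold ps_deriv. ring. }
      rewrite !csum_plus, !csum_scal. unfold ps_deriv. simpl (INR 1). simpl Cpow. ring. }
  intros eps Heps.
  exists (Rmin (rho - Cmod z) (eps / (B + 1))). split.
  { apply Rmin_pos; [unfold rho; lra|apply Rdiv_lt_0_compat; lra]. }
  intros h Hh.
  pose proof (Rmin_l (rho - Cmod z) (eps / (B + 1))).
  pose proof (Rmin_r (rho - Cmod z) (eps / (B + 1))).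
  apply (Rle_trans _ _ _ (Key h ltac:(lra))).
  assert (Hlt : Cmod h * (B + 1) <= eps).
  { apply (Rle_trans _ (eps / (B + 1) * (B + 1))).
    - apply Rmult_le_compat_r; lra.
    - right. field. lra. }
  pose proof (Cmod_ge_0 h). nra.
Qed.

(** * Compactness in the plane *)

Lemma Cmod_lt_components (z : C) (e : R) :
  Rabs (Re z) < e -> Rabs (Im z) < e -> Cmod z < 2 * e.
Proof.
  intros H1 H2. pose proof (Rabs_pos (Re z)). pose proof (Rabs_pos (Im z)).
  apply Cmod_lt_sqr; [lra|].
  rewrite Cmod2_alt, <- (pow2_abs (Re z)), <- (pow2_abs (Im z)). nra.
Qed.

(** If no point is a cluster point, every [l] has a disk that the sequence
    leaves for good after some rank.  The gauge handed to the covering lemma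
    encodes both the radius and (as an upper bound on its inverse) the rank, so
    that its positive lower bound yields one rank beyond which no term of the
    sequence is left. *)
Lemma bounded_sequence_cluster (u : nat -> C) (B : R) :
  (forall n, Cmod (u n) <= B) ->
  exists l : C, forall eps, 0 < eps -> forall N, exists n, (N <= n)%nat /\ Cmod (u n - l) < eps.
Proof.
  intros HB. apply NNPP. intros Hno.
  assert (Hl : forall l : C, exists d : posreal,
            forall n, / d <= INR n -> 2 * d <= Cmod (u n - l)).
  { intros l. apply NNPP. intros Hl. apply Hno. exists l. intros eps Heps N.
    apply NNPP. intros Hn. apply Hl.
    assert (Hd : 0 < Rmin (eps / 2) (/ (INR N + 1))).
    { pose proof (pos_INR N). apply Rmin_pos; [lra|]. apply Rinv_0_lt_compat. lra. }
    exists (mkposreal _ Hd). simpl. intros n Hn1.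
    apply Rnot_lt_le. intros Hlt. apply Hn. exists n. split.
    - apply INR_le. pose proof (Rmin_r (eps / 2) (/ (INR N + 1))) as Hr.
      pose proof (pos_INR N).
      apply Rinv_le_contravar in Hr; [|exact Hd]. rewrite Rinv_inv in Hr. lra.
    - pose proof (Rmin_l (eps / 2) (/ (INR N + 1))). lra. }
  pose (delta := fun x y : R => proj1_sig (constructive_indefinite_description _ (Hl (x, y)))).
  assert (Hdelta : forall x y n, / delta x y <= INR n -> 2 * delta x y <= Cmod (u n - (x, y))).
  { intros x y. unfold delta. exact (proj2_sig (constructive_indefinite_description _ (Hl (x, y)))). }
  destruct (compactness_value_2d (- B) B (- B) B delta) as [d Hd].
  destruct (archimed_cor1 d (cond_pos d)) as [N [HN1 HN2]].
  assert (HR : forall x : R, Rabs x <= B -> - B <= x <= B)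
    by (intros x Hx; apply Rabs_le_between; exact Hx).
  apply (Hd (Re (u N)) (Im (u N))).
  - apply HR. pose proof (re_le_Cmod (u N)). pose proof (HB N). lra.
  - apply HR. pose proof (im_le_Cmod (u N)). pose proof (HB N). lra.
  - intros [x [y [_ [_ [H1 [H2 H3]]]]]].
    assert (Hinv : / delta x y <= INR N).
    { pose proof (cond_pos d). pose proof (cond_pos (delta x y)).
      apply (Rle_trans _ (/ d)); [apply Rinv_le_contravar; lra|].
      rewrite <- (Rinv_inv (INR N)). apply Rinv_le_contravar; [|lra].
      apply Rinv_0_lt_compat, lt_0_INR, HN2. }
    pose proof (Hdelta x y N Hinv) as H4.
    pose proof (Cmod_lt_components (u N - (x, y)) (delta x y) H1 H2). lra.
Qed.

Definition Cclosed_set (S : C -> Prop) : Prop :=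
  forall z, (forall eps, 0 < eps -> exists w, S w /\ Cmod (w - z) < eps) -> S z.

Definition Cbounded_set (S : C -> Prop) : Prop := exists B, forall z, S z -> Cmod z <= B.

Definition Rcontinuous_on (S : C -> Prop) (g : C -> R) : Prop :=
  forall z, S z -> forall eps, 0 < eps -> exists eta, 0 < eta /\
    forall w, S w -> Cmod (w - z) < eta -> Rabs (g w - g z) < eps.

Definition Ccontinuous_on (S : C -> Prop) (f : C -> C) : Prop :=
  forall z, S z -> forall eps, 0 < eps -> exists eta, 0 < eta /\
    forall w, S w -> Cmod (w - z) < eta -> Cmod (f w - f z) < eps.

(** A maximizing sequence clusters at a maximum.  Before the supremum is known
    to be finite, the sequence is asked to exceed either [sup - 1/(n+1)] or
    [n], according to the case. *)
Lemma maximum_attained (S : C -> Prop) (g : C -> R) :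
  Cclosed_set S -> Cbounded_set S -> Rcontinuous_on S g -> (exists z, S z) ->
  exists z0, S z0 /\ forall z, S z -> g z <= g z0.
Proof.
  intros Hcl [B HB] Hg [z1 Hz1].
  set (E := fun y => exists z, S z /\ y = g z).
  assert (Hseq : exists v : nat -> R,
     (forall n, exists z, S z /\ v n <= g z) /\
     (forall l, S l -> (forall eps, 0 < eps -> forall N, exists n, (N <= n)%nat /\ v n < g l + eps) ->
        forall z, S z -> g z <= g l)).
  { destruct (Lub_Rbar_correct E) as [Hub Hleast].
    destruct (Lub_Rbar E) as [m| |] eqn:Em.
    - exists (fun n => m - / (INR n + 1)). split.
      + intros n. apply NNPP. intros Hno.
        assert (Hn : 0 < / (INR n + 1)) by (apply Rinv_0_lt_compat; pose proof (pos_INR n); lra).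
        specialize (Hleast (m - / (INR n + 1))). simpl in Hleast.
        assert (m <= m - / (INR n + 1)); [|lra]. apply Hleast.
        intros y [z [Hz ->]]. simpl. apply Rnot_lt_le. intros Hlt. apply Hno. exists z. split; [auto|lra].
      + intros l Hl Hlim z Hz.
        assert (Hzm : g z <= m) by (apply (Hub (g z)); exists z; auto).
        assert (Hml : m <= g l); [|lra].
        apply Rnot_lt_le. intros Hlt.
        destruct (archimed_cor1 ((m - g l) / 2) ltac:(lra)) as [N [HN1 HN2]].
        destruct (Hlim ((m - g l) / 2) ltac:(lra) N) as [n [Hn1 Hn2]].
        assert (/ (INR n + 1) <= / INR N); [|lra].
        apply Rinv_le_contravar; [apply lt_0_INR, HN2|]. apply le_INR in Hn1. lra.
    - exists INR. split.
      + intros n. apply NNPP. intros Hno. apply (Hleast (INR n)).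
        intros y [z [Hz ->]]. simpl. apply Rnot_lt_le. intros Hlt. apply Hno. exists z. split; [auto|lra].
      + intros l Hl Hlim z Hz. exfalso.
        destruct (INR_unbounded (g l + 1)) as [N HN].
        destruct (Hlim 1 Rlt_0_1 N) as [n [Hn1 Hn2]]. apply le_INR in Hn1. lra.
    - exfalso. apply (Hub (g z1)). exists z1. auto. }
  destruct Hseq as [v [Hv1 Hv2]].
  pose (u := fun n => proj1_sig (constructive_indefinite_description _ (Hv1 n))).
  assert (Hu : forall n, S (u n) /\ v n <= g (u n))
    by (intros n; exact (proj2_sig (constructive_indefinite_description _ (Hv1 n)))).
  destruct (bounded_sequence_cluster u B) as [l Hl].
  { intros n. apply HB, Hu. }
  assert (HlS : S l).
  { apply Hcl. intros eps Heps. destruct (Hl eps Heps O) as [n [_ Hn]].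
    exists (u n). split; [apply Hu|exact Hn]. }
  exists l. split; [exact HlS|]. apply (Hv2 l HlS).
  intros eps Heps N. destruct (Hg l HlS eps Heps) as [eta [Heta He]].
  destruct (Hl eta Heta N) as [n [Hn1 Hn2]]. exists n. split; [exact Hn1|].
  destruct (Hu n) as [Hun Hvn]. specialize (He _ Hun Hn2).
  apply Rabs_lt_between in He. lra.
Qed.

Lemma Rcontinuous_on_opp (S : C -> Prop) (g : C -> R) :
  Rcontinuous_on S g -> Rcontinuous_on S (fun z => - g z).
Proof.
  intros H z Hz eps Heps. destruct (H z Hz eps Heps) as [eta [Heta He]].
  exists eta. split; [exact Heta|]. intros w Hw Hwz.
  replace (- g w - - g z) with (- (g w - g z)) by ring. rewrite Rabs_Ropp. auto.
Qed.

Lemma minimum_attained (S : C -> Prop) (g : C -> R) :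
  Cclosed_set S -> Cbounded_set S -> Rcontinuous_on S g -> (exists z, S z) ->
  exists z0, S z0 /\ forall z, S z -> g z0 <= g z.
Proof.
  intros H1 H2 H3 H4.
  destruct (maximum_attained S (fun z => - g z) H1 H2 (Rcontinuous_on_opp S g H3) H4) as [z0 [Hz0 H]].
  exists z0. split; [exact Hz0|]. intros z Hz. specialize (H z Hz). lra.
Qed.

Lemma Rcontinuous_on_Cmod_minus (S : C -> Prop) (f : C -> C) (w : C) :
  Ccontinuous_on S f -> Rcontinuous_on S (fun z => Cmod (f z - w)).
Proof.
  intros H z Hz eps Heps. destruct (H z Hz eps Heps) as [eta [Heta He]].
  exists eta. split; [exact Heta|]. intros v Hv Hvz. specialize (He v Hv Hvz).
  pose proof (Cmod_minus_triangle (f v) w (f z)).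
  pose proof (Cmod_minus_triangle (f z) w (f v)) as H2. rewrite (Cmod_minus_sym (f z) (f v)) in H2.
  apply Rabs_lt_between. lra.
Qed.

Lemma Ccontinuous_on_id (S : C -> Prop) : Ccontinuous_on S (fun z => z).
Proof. intros z _ eps Heps. exists eps. auto. Qed.

Lemma closed_disk_closed (r : R) : Cclosed_set (fun z => Cmod z <= r).
Proof.
  intros z H. apply Rnot_lt_le. intros Hlt.
  destruct (H (Cmod z - r) ltac:(lra)) as [w [Hw1 Hw2]].
  rewrite Cmod_minus_sym in Hw2. pose proof (Cmod_minus_ge z w). lra.
Qed.

Lemma circle_closed (r : R) : Cclosed_set (fun z => Cmod z = r).
Proof.
  intros z H. apply NNPP. intros Hne.
  destruct (H (Rabs (Cmod z - r))) as [w [Hw1 Hw2]].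
  { apply Rabs_pos_lt. lra. }
  pose proof (Cmod_minus_ge z w) as H1. rewrite Cmod_minus_sym in H1.
  pose proof (Cmod_minus_ge w z). revert Hw2. unfold Rabs. destruct (Rcase_abs _); lra.
Qed.

Lemma bounded_disk (r : R) : Cbounded_set (fun z => Cmod z <= r).
Proof. exists r. auto. Qed.

Lemma bounded_circle (r : R) : Cbounded_set (fun z => Cmod z = r).
Proof. exists r. intros z Hz. lra. Qed.

(** ** Boundaries *)

Definition seg (u v : C) (t : R) : C := (u + t * (v - u))%C.

Lemma seg_dist (u v : C) (s t : R) : Cmod (seg u v s - seg u v t) = Rabs (s - t) * Cmod (v - u).
Proof.
  replace (seg u v s - seg u v t)%C with (RtoC (s - t) * (v - u))%C
    by (unfold seg; rewrite RtoC_minus; ring).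
  rewrite Cmod_mult, Cmod_R. reflexivity.
Qed.

(** The last parameter up to which the segment meets [E] gives a boundary
    point. *)
Lemma segment_meets_boundary (E : C -> Prop) (u v : C) :
  E u -> ~ E v -> exists t, 0 <= t <= 1 /\ boundary E (seg u v t).
Proof.
  intros Hu Hv.
  set (T := fun t => 0 <= t <= 1 /\ E (seg u v t)).
  destruct (completeness T) as [t [Hub Hleast]].
  - exists 1. intros t [Ht _]. lra.
  - exists 0. split; [lra|]. replace (seg u v 0) with u by (unfold seg; ring). exact Hu.
  - assert (Ht : 0 <= t <= 1).
    { split.
      - apply Hub. split; [lra|]. replace (seg u v 0) with u by (unfold seg; ring). exact Hu.
      - apply Hleast. intros s [Hs _]. lra. }
    exists t. split; [exact Ht|]. intros eps Heps.
    set (d := Cmod (v - u)). assert (Hd : 0 <= d) by apply Cmod_ge_0.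
    set (k := eps / (d + 1)).
    assert (Hk : 0 < k) by (apply Rdiv_lt_0_compat; lra).
    assert (Hkd : forall x, Rabs x <= k -> Rabs x * d < eps).
    { intros x Hx. assert (k * (d + 1) = eps) by (unfold k; field; lra).
      pose proof (Rabs_pos x). nra. }
    split.
    + apply NNPP. intros Hno.
      assert (Hb : is_upper_bound T (t - k)).
      { intros s Hs. apply Rnot_lt_le. intros Hlt. apply Hno. exists (seg u v s).
        split; [apply Hs|]. rewrite seg_dist. apply Hkd.
        pose proof (Hub s Hs). apply Rabs_le_between. lra. }
      pose proof (Hleast _ Hb). lra.
    + destruct (Rlt_le_dec t 1) as [Ht1|Ht1].
      * set (s := Rmin 1 (t + k)).
        assert (Hs : t < s <= 1) by (unfold s; split; [apply Rmin_glb_lt; lra|apply Rmin_l]).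
        assert (Hs2 : s <= t + k) by apply Rmin_r.
        exists (seg u v s). split.
        -- intros HE. assert (s <= t) by (apply Hub; split; [lra|exact HE]). lra.
        -- rewrite seg_dist. apply Hkd. apply Rabs_le_between. lra.
      * replace (seg u v t) with v.
        2:{ replace t with 1 by lra. unfold seg. ring. }
        exists v. split; [exact Hv|]. replace (v - v)%C with (RtoC 0) by ring. rewrite Cmod_0. exact Heps.
Qed.

Lemma boundary_closed (E : C -> Prop) : Cclosed_set (boundary E).
Proof.
  intros z H eps Heps. destruct (H (eps / 2) ltac:(lra)) as [w [Hw Hwz]].
  destruct (Hw (eps / 2) ltac:(lra)) as [[u [Hu Huw]] [v [Hv Hvw]]].
  split; [exists u|exists v]; (split; [assumption|]).
  - pose proof (Cmod_minus_triangle u z w). lra.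
  - pose proof (Cmod_minus_triangle v z w). lra.
Qed.

Lemma nearest_boundary_point (E : C -> Prop) :
  (exists w, boundary E w) ->
  exists w0, boundary E w0 /\ forall w, boundary E w -> Cmod w0 <= Cmod w.
Proof.
  intros [w1 Hw1].
  destruct (minimum_attained (fun w => boundary E w /\ Cmod w <= Cmod w1) (fun w => Cmod (w - 0)))
    as [w0 [[Hw0 Hle] Hmin]].
  - intros z H. split.
    + apply boundary_closed. intros eps Heps. destruct (H eps Heps) as [w [[Hw _] Hwz]]. eauto.
    + apply closed_disk_closed. intros eps Heps. destruct (H eps Heps) as [w [[_ Hw] Hwz]]. eauto.
  - exists (Cmod w1). tauto.
  - apply (Rcontinuous_on_Cmod_minus _ (fun z => z)), Ccontinuous_on_id.
  - exists w1. split; [exact Hw1|lra].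
  - exists w0. split; [exact Hw0|]. intros w Hw.
    destruct (Rle_lt_dec (Cmod w) (Cmod w1)) as [H|H]; [|lra].
    specialize (Hmin w (conj Hw H)).
    replace (w0 - 0)%C with w0 in Hmin by ring. replace (w - 0)%C with w in Hmin by ring. exact Hmin.
Qed.

(** * Derivatives along curves *)

Lemma is_derive_eps (f : R -> R) (x l : R) :
  is_derive f x l <->
  (forall eps, 0 < eps -> exists eta, 0 < eta /\ forall y, Rabs (y - x) < eta ->
     Rabs (f y - f x - l * (y - x)) <= eps * Rabs (y - x)).
Proof.
  split.
  - intros [_ H] eps Heps.
    destruct (H x (fun P HP => HP) (mkposreal eps Heps)) as [eta He].
    exists eta. split; [apply cond_pos|]. intros y Hy. specialize (He y Hy).
    rewrite (Rmult_comm l). exact He.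
  - intros H. split; [apply is_linear_scal_l|].
    intros z Hz. apply (is_filter_lim_locally_unique (V := R_NormedModule) x z) in Hz.
    rewrite <- Hz. intros eps. destruct (H eps (cond_pos eps)) as [eta [Heta He]].
    exists (mkposreal eta Heta). intros y Hy. specialize (He y Hy).
    rewrite (Rmult_comm l) in He. exact He.
Qed.

Definition cderiv (p : R -> C) (t : R) (v : C) : Prop :=
  is_derive (fun s => Re (p s)) t (Re v) /\ is_derive (fun s => Im (p s)) t (Im v).

Lemma cderiv_eps (p : R -> C) (t : R) (v : C) :
  cderiv p t v <->
  (forall eps, 0 < eps -> exists eta, 0 < eta /\ forall s, Rabs (s - t) < eta ->
     Cmod (p s - p t - v * (s - t)%R) <= eps * Rabs (s - t)).
Proof.
  assert (ER : forall s, Re (p s - p t - v * (s - t)%R)%C = Re (p s) - Re (p t) - Re v * (s - t))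
    by (intros s; rewrite !Re_minus, Re_mult; simpl; ring).
  assert (EI : forall s, Im (p s - p t - v * (s - t)%R)%C = Im (p s) - Im (p t) - Im v * (s - t))
    by (intros s; rewrite !Im_minus, Im_mult; simpl; ring).
  unfold cderiv. rewrite !is_derive_eps. split.
  - intros [HR HI] eps Heps.
    destruct (HR (eps / 2) ltac:(lra)) as [e1 [He1 H1]].
    destruct (HI (eps / 2) ltac:(lra)) as [e2 [He2 H2]].
    exists (Rmin e1 e2). split; [apply Rmin_pos; assumption|]. intros s Hs.
    pose proof (Rmin_l e1 e2). pose proof (Rmin_r e1 e2).
    specialize (H1 s ltac:(lra)). specialize (H2 s ltac:(lra)).
    rewrite <- ER in H1. rewrite <- EI in H2.
    set (w := (p s - p t - v * (s - t)%R)%C) in *.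
    pose proof (Rabs_pos (s - t)). pose proof (Rabs_pos (Re w)). pose proof (Rabs_pos (Im w)).
    apply Cmod_le_sqr; [nra|].
    rewrite Cmod2_alt, <- (pow2_abs (Re w)), <- (pow2_abs (Im w)). nra.
  - intros H. split; intros eps Heps; destruct (H eps Heps) as [e [He H1]];
      exists e; (split; [exact He|]); intros s Hs; specialize (H1 s Hs).
    + rewrite <- ER. pose proof (re_le_Cmod (p s - p t - v * (s - t)%R)). lra.
    + rewrite <- EI. pose proof (im_le_Cmod (p s - p t - v * (s - t)%R)). lra.
Qed.

Lemma cderiv_comp (f : C -> C) (p : R -> C) (t : R) (l v : C) :
  cdiff f (p t) l -> cderiv p t v -> cderiv (fun s => f (p s)) t (l * v)%C.
Proof.
  rewrite !cderiv_eps. intros Hf Hp eps Heps.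
  pose proof (Cmod_ge_0 l) as Hl. pose proof (Cmod_ge_0 v) as Hv.
  set (e1 := eps / (2 * (Cmod v + 1))). set (e2 := eps / (2 * (Cmod l + 1))).
  assert (He1 : 0 < e1) by (apply Rdiv_lt_0_compat; lra).
  assert (He2 : 0 < e2) by (apply Rdiv_lt_0_compat; lra).
  assert (E1 : e1 * (Cmod v + 1) = eps / 2) by (unfold e1; field; lra).
  assert (E2 : e2 * (Cmod l + 1) = eps / 2) by (unfold e2; field; lra).
  destruct (Hf e1 He1) as [d1 [Hd1 H1]].
  destruct (Hp (Rmin 1 e2) ltac:(apply Rmin_pos; lra)) as [d2 [Hd2 H2]].
  set (d := Rmin d2 (d1 / (Cmod v + 1))).
  assert (Hd : 0 < d) by (apply Rmin_pos; [exact Hd2|apply Rdiv_lt_0_compat; lra]).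
  exists d. split; [exact Hd|]. intros s Hs.
  assert (Hsd2 : Rabs (s - t) < d2) by (apply (Rlt_le_trans _ d); [exact Hs|apply Rmin_l]).
  assert (Hsd1 : Rabs (s - t) * (Cmod v + 1) < d1).
  { apply (Rlt_le_trans _ (d1 / (Cmod v + 1) * (Cmod v + 1))).
    - apply Rmult_lt_compat_r; [lra|]. apply (Rlt_le_trans _ d); [exact Hs|apply Rmin_r].
    - right. field. lra. }
  specialize (H2 s Hsd2).
  pose proof (Rmin_l 1 e2) as M1. pose proof (Rmin_r 1 e2) as M2.
  pose proof (Rabs_pos (s - t)) as Hst.
  set (h := (p s - p t)%C).
  assert (Hrem : Cmod (h - v * (s - t)%R) <= e2 * Rabs (s - t)) by (unfold h; nra).
  assert (Hh : Cmod h <= Rabs (s - t) * (Cmod v + 1)).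
  { pose proof (Cmod_triangle (h - v * (s - t)%R) (v * (s - t)%R)) as T.
    replace (h - v * (s - t)%R + v * (s - t)%R)%C with h in T by ring.
    rewrite (Cmod_mult v), Cmod_R in T.
    assert (Cmod (h - v * (s - t)%R) <= 1 * Rabs (s - t)) by (unfold h; nra). lra. }
  specialize (H1 h ltac:(lra)).
  replace (p t + h)%C with (p s) in H1 by (unfold h; ring).
  replace (f (p s) - f (p t) - l * v * (s - t)%R)%C
    with ((f (p s) - f (p t) - l * h) + l * (h - v * (s - t)%R))%C by ring.
  eapply Rle_trans; [apply Cmod_triangle|]. rewrite (Cmod_mult l).
  pose proof (Cmod_ge_0 (h - v * (s - t)%R)).
  apply (Rle_trans _ (e1 * (Rabs (s - t) * (Cmod v + 1)) + (Cmod l + 1) * (e2 * Rabs (s - t)))); [nra|].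
  right.
  transitivity (Rabs (s - t) * (e1 * (Cmod v + 1)) + Rabs (s - t) * (e2 * (Cmod l + 1))); [ring|].
  rewrite E1, E2. field.
Qed.

Lemma cderiv_mult (p q : R -> C) (t : R) (v w : C) :
  cderiv p t v -> cderiv q t w -> cderiv (fun s => p s * q s)%C t (v * q t + p t * w)%C.
Proof.
  intros [H1 H2] [H3 H4]. split.
  - apply (is_derive_ext (fun s => Re (p s) * Re (q s) - Im (p s) * Im (q s))); [reflexivity|].
    replace (Re (v * q t + p t * w)%C)
      with ((Re v * Re (q t) + Re (p t) * Re w) - (Im v * Im (q t) + Im (p t) * Im w))
      by (rewrite Re_plus, !Re_mult; ring).
    apply @is_derive_minus; apply (is_derive_mult (K := R_AbsRing)); auto using Rmult_comm.
  - apply (is_derive_ext (fun s => Re (p s) * Im (q s) + Im (p s) * Re (q s))); [reflexivity|].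
    replace (Im (v * q t + p t * w)%C)
      with ((Re v * Im (q t) + Re (p t) * Im w) + (Im v * Re (q t) + Im (p t) * Re w))
      by (rewrite Im_plus, !Im_mult; ring).
    apply @is_derive_plus; apply (is_derive_mult (K := R_AbsRing)); auto using Rmult_comm.
Qed.

Lemma cderiv_const (c : C) (t : R) : cderiv (fun _ => c) t 0%C.
Proof. split; apply (is_derive_const (K := R_AbsRing) (V := R_NormedModule)). Qed.

Lemma cderiv_minus_const (p : R -> C) (c : C) (t : R) (v : C) :
  cderiv p t v -> cderiv (fun s => p s - c)%C t v.
Proof.
  intros [H1 H2]. split.
  - apply (is_derive_ext (fun s => Re (p s) - Re c)); [reflexivity|].
    replace (Re v) with (Re v - 0) by ring.
    apply @is_derive_minus; [exact H1|apply @is_derive_const].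
  - apply (is_derive_ext (fun s => Im (p s) - Im c)); [reflexivity|].
    replace (Im v) with (Im v - 0) by ring.
    apply @is_derive_minus; [exact H2|apply @is_derive_const].
Qed.

Lemma cderiv_line (z e : C) (t : R) : cderiv (fun s => z + s * e)%C t e.
Proof.
  split.
  - apply (is_derive_ext (fun s => Re z + s * Re e)); [intros s; unfold Re, Im; simpl; ring|].
    auto_derive; [exact I|ring].
  - apply (is_derive_ext (fun s => Im z + s * Im e)); [intros s; unfold Re, Im; simpl; ring|].
    auto_derive; [exact I|ring].
Qed.

Definition cis (t : R) : C := (cos t, sin t).

Lemma cderiv_cis (t : R) : cderiv cis t (Ci * cis t)%C.
Proof.
  split.
  - replace (Re (Ci * cis t)%C) with (- sin t) by (simpl; ring). apply is_derive_cos.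
  - replace (Im (Ci * cis t)%C) with (cos t) by (simpl; ring). apply is_derive_sin.
Qed.

Lemma Cmod_cis (t : R) : Cmod (cis t) = 1.
Proof.
  unfold Cmod, cis; simpl. replace (_ + _) with 1; [apply sqrt_1|].
  pose proof (sin2_cos2 t) as H. unfold Rsqr in H. lra.
Qed.

Lemma cis_0 : cis 0 = 1%C.
Proof. unfold cis. rewrite cos_0, sin_0. reflexivity. Qed.

Definition cdot (z w : C) : R := Re z * Re w + Im z * Im w.

Lemma cdot_self (z : C) : cdot z z = Cmod z ^ 2.
Proof. rewrite Cmod2_alt. unfold cdot. ring. Qed.

Lemma is_derive_cdot (p q : R -> C) (t : R) (v w : C) :
  cderiv p t v -> cderiv q t w ->
  is_derive (fun s => cdot (p s) (q s)) t (cdot v (q t) + cdot (p t) w).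
Proof.
  intros [H1 H2] [H3 H4]. unfold cdot.
  replace (Re v * Re (q t) + Im v * Im (q t) + (Re (p t) * Re w + Im (p t) * Im w))
    with ((Re v * Re (q t) + Re (p t) * Re w) + (Im v * Im (q t) + Im (p t) * Im w)) by ring.
  apply @is_derive_plus; apply (is_derive_mult (K := R_AbsRing)); auto using Rmult_comm.
Qed.

Lemma right_minimum_derivative (phi : R -> R) (x l eta : R) :
  0 < eta -> is_derive phi x l -> (forall y, x <= y < x + eta -> phi x <= phi y) -> 0 <= l.
Proof.
  intros Heta Hd Hmin. apply Rnot_lt_le. intros Hl.
  destruct (proj1 (is_derive_eps _ _ _) Hd (- l / 2) ltac:(lra)) as [e [He H]].
  set (h := Rmin eta e / 2).
  assert (Hh : 0 < h /\ h < eta /\ h < e).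
  { pose proof (Rmin_pos eta e Heta He). pose proof (Rmin_l eta e). pose proof (Rmin_r eta e).
    unfold h. lra. }
  specialize (H (x + h)). replace (x + h - x) with h in H by ring.
  rewrite (Rabs_pos_eq h) in H by lra. specialize (H ltac:(lra)).
  apply Rabs_le_between in H. pose proof (Hmin (x + h) ltac:(lra)). nra.
Qed.

Lemma second_derivative_test (phi phi1 : R -> R) (l eta : R) :
  0 < eta -> (forall t, Rabs t < eta -> is_derive phi t (phi1 t)) -> is_derive phi1 0 l ->
  (forall t, Rabs t < eta -> phi 0 <= phi t) -> phi1 0 = 0 /\ 0 <= l.
Proof.
  intros Heta Hd Hd1 Hmin.
  assert (H0 : phi1 0 = 0).
  { apply Rle_antisym.
    - assert (0 <= - phi1 0); [|lra].
      apply (right_minimum_derivative (fun t => phi (- t)) 0 _ eta Heta).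
      + apply is_derive_eps. intros eps Heps.
        destruct (proj1 (is_derive_eps _ _ _) (Hd 0 ltac:(rewrite Rabs_R0; exact Heta)) eps Heps)
          as [e [He H]].
        exists e. split; [exact He|]. intros y Hy. specialize (H (- y)).
        replace (- y - 0) with (- (y - 0)) in H by ring. rewrite Rabs_Ropp in H.
        specialize (H Hy). rewrite Ropp_0.
        replace (- phi1 0 * (y - 0)) with (phi1 0 * - (y - 0)) by ring. exact H.
      + intros y Hy. rewrite Ropp_0. apply Hmin. rewrite Rabs_Ropp, Rabs_pos_eq; lra.
    - apply (right_minimum_derivative phi 0 _ eta Heta).
      + apply Hd. rewrite Rabs_R0. exact Heta.
      + intros y Hy. apply Hmin. rewrite Rabs_pos_eq; lra. }
  split; [exact H0|]. apply Rnot_lt_le. intros Hl.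
  destruct (proj1 (is_derive_eps _ _ _) Hd1 (- l / 2) ltac:(lra)) as [e [He H]].
  set (h := Rmin eta e / 2).
  assert (Hh : 0 < h /\ h < eta /\ h < e).
  { pose proof (Rmin_pos eta e Heta He). pose proof (Rmin_l eta e). pose proof (Rmin_r eta e).
    unfold h. lra. }
  destruct (MVT_cor2 phi phi1 0 h ltac:(lra)) as [c [Hc1 Hc2]].
  { intros c Hc. apply is_derive_Reals, Hd. rewrite Rabs_pos_eq; lra. }
  specialize (H c). rewrite H0, !Rminus_0_r, (Rabs_pos_eq c) in H by lra.
  specialize (H ltac:(lra)). apply Rabs_le_between in H.
  pose proof (Hmin h ltac:(rewrite Rabs_pos_eq; lra)).
  assert (phi1 c < 0) by nra. nra.
Qed.

(** * The minimum principle and the open mapping property *)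

Lemma Rcontinuous_on_comp (S : C -> Prop) (g : C -> R) (phi : R -> R) :
  Rcontinuous_on S g -> (forall z, S z -> continuous phi (g z)) ->
  Rcontinuous_on S (fun z => phi (g z)).
Proof.
  intros Hg Hphi z Hz eps Heps.
  destruct (proj1 (filterlim_locally _ _) (Hphi z Hz) (mkposreal eps Heps)) as [d Hd].
  destruct (Hg z Hz d (cond_pos d)) as [eta [Heta He]].
  exists eta. split; [exact Heta|]. intros w Hw Hwz. exact (Hd (g w) (He w Hw Hwz)).
Qed.

Lemma Rcontinuous_on_plus (S : C -> Prop) (g h : C -> R) :
  Rcontinuous_on S g -> Rcontinuous_on S h -> Rcontinuous_on S (fun z => g z + h z).
Proof.
  intros Hg Hh z Hz eps Heps.
  destruct (Hg z Hz (eps / 2) ltac:(lra)) as [e1 [He1 H1]].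
  destruct (Hh z Hz (eps / 2) ltac:(lra)) as [e2 [He2 H2]].
  exists (Rmin e1 e2). split; [apply Rmin_pos; assumption|].
  intros w Hw Hwz. pose proof (Rmin_l e1 e2). pose proof (Rmin_r e1 e2).
  specialize (H1 w Hw ltac:(lra)). specialize (H2 w Hw ltac:(lra)).
  apply Rabs_lt_between in H1. apply Rabs_lt_between in H2. apply Rabs_lt_between. lra.
Qed.

Lemma second_derivative_along_line (f f1 : C -> C) (l z e : C) (eta eps : R) :
  0 < eta -> Cmod e = 1 ->
  (forall w, Cmod (w - z) < eta -> cdiff f w (f1 w) /\ f w <> 0%C) -> cdiff f1 z l ->
  (forall w, Cmod (w - z) < eta ->
     / Cmod (f w) ^ 2 + eps * Cmod w ^ 2 <= / Cmod (f z) ^ 2 + eps * Cmod z ^ 2) ->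
  let N := Cmod (f z) ^ 2 in
  let N1 := 2 * cdot (f1 z * e) (f z) in
  let N2 := 2 * (cdot (l * e * e) (f z) + cdot (f1 z * e) (f1 z * e)) in
  0 <= N2 / N ^ 2 - 2 * N1 ^ 2 / N ^ 3 - 2 * eps.
Proof.
  intros Heta He Hf Hf1 Hmax N N1 N2.
  set (p := fun s : R => (z + s * e)%C).
  assert (Hp0 : p 0 = z) by (unfold p; ring).
  assert (Hp : forall s, Cmod (p s - z) = Rabs s).
  { intros s. replace (p s - z)%C with (s * e)%C by (unfold p; ring).
    rewrite Cmod_mult, Cmod_R, He. ring. }
  assert (D0 : forall s, cderiv p s e) by (intros s; apply cderiv_line).
  assert (D1 : forall s, Rabs s < eta -> cderiv (fun s => f (p s)) s (f1 (p s) * e)%C).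
  { intros s Hs. apply cderiv_comp; [apply Hf; rewrite Hp; exact Hs|apply D0]. }
  assert (D2 : cderiv (fun s => f1 (p s) * e)%C 0 (l * e * e)%C).
  { replace (l * e * e)%C with (l * e * e + f1 (p 0%R) * 0)%C by ring.
    apply (cderiv_mult (fun s => f1 (p s)) (fun _ => e)).
    - apply cderiv_comp; [rewrite Hp0; exact Hf1|apply D0].
    - apply cderiv_const. }
  assert (Hpos : forall s, Rabs s < eta -> cdot (f (p s)) (f (p s)) <> 0).
  { intros s Hs. rewrite cdot_self. apply pow_nonzero. apply Rgt_not_eq, Cmod_gt_0.
    apply Hf. rewrite Hp. exact Hs. }
  set (M := fun s => cdot (f (p s)) (f (p s))) in *.
  set (M1 := fun s => 2 * cdot (f1 (p s) * e) (f (p s))).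
  assert (DM : forall s, Rabs s < eta -> is_derive M s (M1 s)).
  { intros s Hs. evar_last; [apply is_derive_cdot; apply D1, Hs|]. unfold M1, cdot. ring. }
  assert (DM1 : is_derive M1 0 N2).
  { evar_last.
    - unfold M1. apply is_derive_scal, is_derive_cdot; [exact D2|]. apply D1. rewrite Rabs_R0. exact Heta.
    - unfold N2. rewrite Hp0. reflexivity. }
  set (Q := fun s => cdot (p s) (p s)).
  assert (DQ : forall s, is_derive Q s (2 * cdot e (p s))).
  { intros s. evar_last; [apply is_derive_cdot; apply D0|]. unfold cdot. ring. }
  assert (DQ1 : is_derive (fun s => 2 * cdot e (p s)) 0 2).
  { evar_last.
    - apply is_derive_scal, is_derive_cdot; [apply cderiv_const|apply D0].
    - rewrite cdot_self, He. unfold cdot. simpl. ring. }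
  destruct (second_derivative_test (fun s => - (/ M s + eps * Q s))
              (fun s => M1 s / M s ^ 2 - eps * (2 * cdot e (p s)))
              (N2 / N ^ 2 - 2 * N1 ^ 2 / N ^ 3 - 2 * eps) eta Heta) as [_ H].
  - intros s Hs. evar_last.
    + apply @is_derive_opp, @is_derive_plus.
      * apply is_derive_inv; [apply DM, Hs|apply Hpos, Hs].
      * apply is_derive_scal, DQ.
    + unfold opp, plus; simpl. field. apply Hpos, Hs.
  - assert (HM0 : M 0 <> 0) by (apply Hpos; rewrite Rabs_R0; exact Heta).
    assert (EN : M 0 = N) by (unfold M; rewrite Hp0; apply cdot_self).
    assert (EN1 : M1 0 = N1) by (unfold M1; rewrite Hp0; reflexivity).
    evar_last.
    + apply @is_derive_minus.
      * apply is_derive_div; [exact DM1| |].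
        -- apply is_derive_pow, DM. rewrite Rabs_R0. exact Heta.
        -- apply pow_nonzero, HM0.
      * apply is_derive_scal, DQ1.
    + unfold minus, plus, opp; simpl. rewrite ?EN, ?EN1. rewrite EN in HM0. field. exact HM0.
  - intros s Hs. unfold M, Q. rewrite !cdot_self, Hp0.
    apply Ropp_le_contravar, Hmax. rewrite Hp. exact Hs.
  - exact H.
Qed.

(** [1/|f|^2 + eps |z|^2] has a positive Laplacian wherever [f] is analytic and
    nonzero, so it has no interior maximum; this is tested on the horizontal
    and the vertical line through a would-be maximum. *)
Lemma minimum_modulus (f f1 f2 : C -> C) (r m : R) :
  (forall z, Cmod z < r -> cdiff f z (f1 z)) ->
  (forall z, Cmod z < r -> cdiff f1 z (f2 z)) ->
  Ccontinuous_on (fun z => Cmod z <= r) f ->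
  (forall z, Cmod z <= r -> f z <> 0%C) ->
  (forall z, Cmod z = r -> m <= Cmod (f z)) ->
  forall z, Cmod z <= r -> m <= Cmod (f z).
Proof.
  intros Hf Hf1 Hcont Hnz Hm z0 Hz0. apply Rnot_lt_le. intros Hlt.
  assert (Hr : 0 <= r) by (pose proof (Cmod_ge_0 z0); lra).
  assert (Hpos : forall z, Cmod z <= r -> 0 < Cmod (f z)) by (intros z Hz; apply Cmod_gt_0, Hnz, Hz).
  pose proof (Hpos z0 Hz0) as Hf0.
  set (gap := / Cmod (f z0) ^ 2 - / m ^ 2).
  assert (Hgap : 0 < gap).
  { unfold gap. apply Rlt_0_minus, Rinv_lt_contravar; [|nra]. apply Rmult_lt_0_compat; apply pow_lt; lra. }
  set (eps := gap / (2 * (r ^ 2 + 1))).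
  assert (Heps : 0 < eps) by (apply Rdiv_lt_0_compat; nra).
  assert (Hepsr : eps * r ^ 2 < gap).
  { assert (eps * (2 * (r ^ 2 + 1)) = gap) by (unfold eps; field; nra). nra. }
  destruct (maximum_attained (fun z => Cmod z <= r)
              (fun z => / Cmod (f z - 0) ^ 2 + eps * Cmod (z - 0) ^ 2)) as [z1 [Hz1 Hmax]].
  - apply closed_disk_closed.
  - apply bounded_disk.
  - apply Rcontinuous_on_plus.
    + apply (Rcontinuous_on_comp _ (fun z => Cmod (f z - 0)) (fun x => / x ^ 2)).
      * apply Rcontinuous_on_Cmod_minus, Hcont.
      * intros z Hz. apply (ex_derive_continuous (K := R_AbsRing) (V := R_NormedModule)).
        auto_derive. replace (f z - 0)%C with (f z) by ring. pose proof (Hpos z Hz). nra.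
    + apply (Rcontinuous_on_comp _ (fun z => Cmod (z - 0)) (fun x => eps * x ^ 2)).
      * apply (Rcontinuous_on_Cmod_minus _ (fun z => z)), Ccontinuous_on_id.
      * intros z Hz. apply (ex_derive_continuous (K := R_AbsRing) (V := R_NormedModule)).
        auto_derive. exact I.
  - exists z0. exact Hz0.
  - assert (Hmax' : forall z, Cmod z <= r ->
       / Cmod (f z) ^ 2 + eps * Cmod z ^ 2 <= / Cmod (f z1) ^ 2 + eps * Cmod z1 ^ 2).
    { intros z Hz. specialize (Hmax z Hz). cbv beta in Hmax.
      replace (f z - 0)%C with (f z) in Hmax by ring. replace (f z1 - 0)%C with (f z1) in Hmax by ring.
      replace (z - 0)%C with z in Hmax by ring. replace (z1 - 0)%C with z1 in Hmax by ring. exact Hmax. }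
    clear Hmax.
    destruct (Rle_lt_or_eq_dec _ _ Hz1) as [Hin|Hbd].
    + assert (T : forall e, Cmod e = 1 -> _) by
        (intros e He; apply (second_derivative_along_line f f1 (f2 z1) z1 e (r - Cmod z1) eps);
         [lra|exact He| |apply Hf1, Hin|];
         intros w Hw; assert (Cmod w < r) by (pose proof (Cmod_minus_ge w z1); lra);
         [split; [apply Hf; assumption|apply Hnz; lra]|apply Hmax'; lra]).
      pose proof (T 1%C Cmod_1) as T1. pose proof (T Ci Cmod_Ci) as Ti. clear T.
      cbv zeta in T1, Ti.
      pose proof (Hpos z1 Hz1) as Hp1.
      assert (HN : 0 < Cmod (f z1) ^ 2) by (apply pow_lt, Hp1).
      pose proof (Cmod2_alt (f z1)) as EN.
      set (N := Cmod (f z1) ^ 2) in *.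
      set (S := 4 * Cmod (f1 z1) ^ 2 / N ^ 2).
      assert (HS : 0 <= S).
      { apply Rmult_le_pos; [pose proof (pow2_ge_0 (Cmod (f1 z1))); lra|].
        left. apply Rinv_0_lt_compat, pow_lt, HN. }
      assert (E : S + 4 * eps = - ((2 * (cdot (f2 z1 * 1 * 1) (f z1) + cdot (f1 z1 * 1) (f1 z1 * 1)) / N ^ 2 -
         2 * (2 * cdot (f1 z1 * 1) (f z1)) ^ 2 / N ^ 3 - 2 * eps) +
         (2 * (cdot (f2 z1 * Ci * Ci) (f z1) + cdot (f1 z1 * Ci) (f1 z1 * Ci)) / N ^ 2 -
         2 * (2 * cdot (f1 z1 * Ci) (f z1)) ^ 2 / N ^ 3 - 2 * eps))).
      { unfold S. rewrite (Cmod2_alt (f1 z1)).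
        replace (4 * (Re (f1 z1) ^ 2 + Im (f1 z1) ^ 2) / N ^ 2)
          with (8 * (Re (f z1) ^ 2 + Im (f z1) ^ 2) * (Re (f1 z1) ^ 2 + Im (f1 z1) ^ 2) / N ^ 3
                - 4 * (Re (f1 z1) ^ 2 + Im (f1 z1) ^ 2) / N ^ 2).
        2:{ rewrite <- EN. field. lra. }
        unfold cdot, Ci, Cmult, Re, Im; simpl. field. lra. }
      lra.
    + pose proof (Hmax' z0 Hz0) as H0. specialize (Hm z1 Hbd). rewrite Hbd in H0.
      assert (/ Cmod (f z1) ^ 2 <= / m ^ 2).
      { apply Rinv_le_contravar; [apply pow_lt; lra|]. apply pow_incr; lra. }
      pose proof (pow2_ge_0 (Cmod z0)). unfold gap in *. nra.
Qed.

(** The two derivatives are explicit functions, since [cdiff] at every point of the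
    disk is what a power series provides. *)
Record smooth_univalent (f f1 f2 : C -> C) : Prop := {
  su_deriv : forall z, Cmod z < 1 -> cdiff f z (f1 z);
  su_deriv2 : forall z, Cmod z < 1 -> cdiff f1 z (f2 z);
  su_inj : univalent_on unit_disk f }.

Definition disk_image (f : C -> C) (r : R) : C -> Prop := image f (fun z => Cmod z <= r).

Lemma smooth_univalent_continuous (f f1 f2 : C -> C) (S : C -> Prop) :
  smooth_univalent f f1 f2 -> (forall z, S z -> Cmod z < 1) -> Ccontinuous_on S f.
Proof.
  intros Hf HS z Hz eps Heps.
  destruct (cdiff_continuous f z _ (su_deriv _ _ _ Hf z (HS z Hz)) eps Heps) as [eta [Heta He]].
  exists eta. split; auto.
Qed.

Lemma circle_inhabited (r : R) : 0 <= r -> exists z : C, Cmod z = r.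
Proof. intros Hr. exists (RtoC r). rewrite Cmod_R. apply Rabs_pos_eq, Hr. Qed.

Lemma cdiff_minus_const (f : C -> C) (z l w : C) : cdiff f z l -> cdiff (fun v => f v - w)%C z l.
Proof.
  intros H eps Heps. destruct (H eps Heps) as [eta [Heta He]]. exists eta. split; [exact Heta|].
  intros h Hh. replace (f (z + h)%C - w - (f z - w) - l * h)%C
    with (f (z + h)%C - f z - l * h)%C by ring. auto.
Qed.

(** Where [f] omits the value [w] on the disk, [f - w] obeys the minimum
    principle: its modulus at [z] is at least its minimum over the circle.
    Injectivity keeps [f] away from [f z] on the circle, so this fails once [w]
    is close to [f z]. *)
Lemma disk_image_open (f f1 f2 : C -> C) (z : C) (r : R) :
  smooth_univalent f f1 f2 -> Cmod z < r < 1 ->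
  exists mu, 0 < mu /\ forall w, Cmod (w - f z) < mu -> disk_image f r w.
Proof.
  intros Hf [Hzr Hr1]. pose proof (Cmod_ge_0 z) as Hz0.
  destruct (minimum_attained (fun v => Cmod v = r) (fun v => Cmod (f v - f z))) as [v [Hv Hmin]].
  - apply circle_closed.
  - apply bounded_circle.
  - apply Rcontinuous_on_Cmod_minus, (smooth_univalent_continuous f f1 f2 _ Hf).
    intros v Hv. lra.
  - apply circle_inhabited. lra.
  - assert (Hmu : 0 < Cmod (f v - f z)).
    { apply Cmod_gt_0. intros E.
      assert (v = z); [|subst v; lra].
      apply (su_inj _ _ _ Hf); unfold unit_disk; try lra.
      replace (f v) with (f v - f z + f z)%C by ring. rewrite E. ring. }
    set (mu := Cmod (f v - f z)) in *.
    exists (mu / 2). split; [lra|]. intros w Hw. apply NNPP. intros Hno.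
    assert (Hlow : mu / 2 <= Cmod (f z - w)).
    { apply (minimum_modulus (fun v => f v - w)%C f1 f2 r); [| | | | |lra].
      - intros u Hu. apply cdiff_minus_const, (su_deriv _ _ _ Hf). lra.
      - intros u Hu. apply (su_deriv2 _ _ _ Hf). lra.
      - intros u Hu eps Heps.
        destruct (smooth_univalent_continuous f f1 f2 (fun z => Cmod z <= r) Hf) with (z := u) (eps := eps)
          as [eta [Heta He]]; auto.
        { intros x Hx. lra. }
        exists eta. split; [exact Heta|]. intros x Hx Hxu.
        replace (f x - w - (f u - w))%C with (f x - f u)%C by ring. auto.
      - intros u Hu E. apply Hno. exists u. split; [exact Hu|].
        replace (f u) with (f u - w + w)%C by ring. rewrite E. ring.
      - intros u Hu. specialize (Hmin u Hu).
        pose proof (Cmod_minus_triangle (f u) (f z) w). lra. }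
    rewrite Cmod_minus_sym in Hlow. lra.
Qed.

(** The image is closed by compactness, and a boundary point cannot come from the
    interior of the disk because [f] is open there. *)
Lemma disk_image_boundary (f f1 f2 : C -> C) (r : R) (p : C) :
  smooth_univalent f f1 f2 -> 0 < r < 1 -> boundary (disk_image f r) p ->
  exists z, Cmod z = r /\ f z = p.
Proof.
  intros Hf Hr Hp.
  destruct (minimum_attained (fun v => Cmod v <= r) (fun v => Cmod (f v - p))) as [z [Hz Hmin]].
  - apply closed_disk_closed.
  - apply bounded_disk.
  - apply Rcontinuous_on_Cmod_minus, (smooth_univalent_continuous f f1 f2 _ Hf).
    intros v Hv. lra.
  - exists 0%C. rewrite Cmod_0. lra.
  - assert (E : f z = p).
    { apply NNPP. intros Hne.
      assert (Hpos : 0 < Cmod (f z - p)).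
      { apply Cmod_gt_0. intros E. apply Hne.
        replace (f z) with (f z - p + p)%C by ring. rewrite E. ring. }
      destruct (Hp _ Hpos) as [[u [[x [Hx ->]] Hu]] _]. specialize (Hmin x Hx). lra. }
    exists z. split; [|exact E].
    destruct (Rle_lt_or_eq_dec _ _ Hz) as [Hlt|]; [|assumption]. exfalso.
    destruct (disk_image_open f f1 f2 z r Hf ltac:(lra)) as [mu [Hmu Hop]].
    destruct (Hp mu Hmu) as [_ [v [Hv1 Hv2]]]. apply Hv1, Hop. rewrite E. exact Hv2.
Qed.

Lemma segment_crosses_level_curve (f f1 f2 : C -> C) (r : R) (u v : C) :
  smooth_univalent f f1 f2 -> 0 < r < 1 -> disk_image f r u -> ~ disk_image f r v ->
  exists t z, 0 <= t <= 1 /\ Cmod z = r /\ f z = seg u v t.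
Proof.
  intros Hf Hr Hu Hv. destruct (segment_meets_boundary _ u v Hu Hv) as [t [Ht Hb]].
  destruct (disk_image_boundary f f1 f2 r _ Hf Hr Hb) as [z [Hz E]]. exists t, z. auto.
Qed.

Lemma disk_image_mono (f : C -> C) (r s : R) (w : C) :
  r <= s -> disk_image f r w -> disk_image f s w.
Proof. intros Hrs [z [Hz ->]]. exists z. split; [lra|reflexivity]. Qed.

Lemma not_in_disk_image (f f1 f2 : C -> C) (r : R) (z : C) :
  smooth_univalent f f1 f2 -> r < Cmod z < 1 -> ~ disk_image f r (f z).
Proof.
  intros Hf Hz [u [Hu E]].
  assert (z = u); [|subst u; lra].
  apply (su_inj _ _ _ Hf); [unfold unit_disk; lra|unfold unit_disk; lra|exact E].
Qed.

(** Points of the set that escape from the images of larger and larger disks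
    would cluster at a value [f z], but the image of a single disk already contains
    a neighbourhood of [f z]. *)
Lemma compact_subset_disk_image (f f1 f2 : C -> C) (S : C -> Prop) :
  smooth_univalent f f1 f2 -> Cclosed_set S -> Cbounded_set S ->
  (forall w, S w -> image f unit_disk w) ->
  exists r, 0 < r < 1 /\ forall w, S w -> disk_image f r w.
Proof.
  intros Hf Hcl [B HB] Him. apply NNPP. intros Hno.
  set (rn := fun n => 1 - / (INR n + 2)).
  assert (Hrn : forall n, 0 < rn n < 1).
  { intros n. unfold rn. pose proof (pos_INR n).
    assert (0 < / (INR n + 2)) by (apply Rinv_0_lt_compat; lra).
    assert (/ (INR n + 2) <= / 2) by (apply Rinv_le_contravar; lra). lra. }
  assert (Hw : forall n, exists w, S w /\ ~ disk_image f (rn n) w).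
  { intros n. apply NNPP. intros H. apply Hno. exists (rn n). split; [apply Hrn|].
    intros w HSw. apply NNPP. intros Hw. apply H. exists w. auto. }
  pose (u := fun n => proj1_sig (constructive_indefinite_description _ (Hw n))).
  assert (Hu : forall n, S (u n) /\ ~ disk_image f (rn n) (u n))
    by (intros n; exact (proj2_sig (constructive_indefinite_description _ (Hw n)))).
  destruct (bounded_sequence_cluster u B) as [l Hl].
  { intros n. apply HB, Hu. }
  assert (HSl : S l).
  { apply Hcl. intros eps Heps. destruct (Hl eps Heps O) as [n [_ Hn]].
    exists (u n). split; [apply Hu|exact Hn]. }
  destruct (Him l HSl) as [z [Hz ->]]. unfold unit_disk in Hz.
  destruct (disk_image_open f f1 f2 z ((1 + Cmod z) / 2) Hf ltac:(lra)) as [mu [Hmu Hop]].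
  destruct (archimed_cor1 ((1 - Cmod z) / 2) ltac:(lra)) as [N [HN1 HN2]].
  destruct (Hl mu Hmu N) as [n [Hn1 Hn2]].
  destruct (Hu n) as [_ Hn3]. apply Hn3. apply (disk_image_mono f ((1 + Cmod z) / 2)); [|apply Hop, Hn2].
  unfold rn. apply le_INR in Hn1. apply lt_0_INR in HN2.
  assert (/ (INR n + 2) <= / INR N) by (apply Rinv_le_contravar; lra). lra.
Qed.

(** * Level curves of curvature at least [1 / R'] *)

(** Suppose that the curve [t |-> f (z e^(i t))] stays outside an open disk of
    radius [rho] that it touches at [t = 0], and that [f] leaves that disk
    along the ray through [z].  Then [f z - c] is a positive multiple of the
    outer normal [z f'(z)], and the second derivative test for the squared
    distance to the centre reads [kappa <= 1 / rho]. *)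
Lemma internal_tangency (f f1 f2 : C -> C) (z c : C) (rho R' eta : R) :
  (forall w, Cmod w < 1 -> cdiff f w (f1 w)) ->
  (forall w, Cmod w < 1 -> cdiff f1 w (f2 w)) ->
  0 < Cmod z < 1 -> f1 z <> 0%C -> 0 < R' -> 0 < eta ->
  Cmod (z * f1 z) <= R' * Re (1 + z * (f2 z / f1 z))%C ->
  Cmod (f z - c) = rho ->
  (forall t, Rabs t < eta -> rho <= Cmod (f (z * cis t)%C - c)) ->
  (forall s, 1 <= s < 1 + eta -> rho <= Cmod (f (s * z)%C - c)) ->
  rho <= R'.
Proof.
  intros Hf Hf1 Hz Hnz HR' Heta Hcurv Hrho Hang Hrad.
  assert (Hzc : forall t, Cmod (z * cis t) < 1)
    by (intros t; rewrite Cmod_mult, Cmod_cis; lra).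
  assert (Dp : forall t, cderiv (fun t => z * cis t)%C t (z * (Ci * cis t))%C).
  { intros t. replace (z * (Ci * cis t))%C with (0 * cis t + z * (Ci * cis t))%C by ring.
    apply (cderiv_mult (fun _ => z) cis); [apply cderiv_const|apply cderiv_cis]. }
  set (W := fun t => (f (z * cis t) - c)%C).
  set (V := fun t => (f1 (z * cis t)%C * (z * (Ci * cis t)))%C).
  assert (DW : forall t, cderiv W t (V t)).
  { intros t. apply cderiv_minus_const. apply cderiv_comp; [apply Hf, Hzc|apply Dp]. }
  assert (E0 : (z * cis 0)%C = z) by (rewrite cis_0; ring).
  assert (DV : cderiv V 0 (- (z * f1 z + z * z * f2 z))%C).
  { replace (- (z * f1 z + z * z * f2 z))%C
      with (f2 z * (z * (Ci * cis 0)) * (z * (Ci * cis 0))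
            + f1 (z * cis 0)%C * (0 * (Ci * cis 0) + z * (0 * cis 0 + Ci * (Ci * cis 0))))%C.
    2:{ rewrite E0, cis_0. apply Ceq; unfold Re, Im, Ci; simpl; ring. }
    apply (cderiv_mult (fun t => f1 (z * cis t)%C) (fun t => z * (Ci * cis t))%C).
    - apply cderiv_comp; [rewrite E0; apply Hf1; lra|apply Dp].
    - apply (cderiv_mult (fun _ => z) (fun t => Ci * cis t)%C); [apply cderiv_const|].
      apply (cderiv_mult (fun _ => Ci) cis); [apply cderiv_const|apply cderiv_cis]. }
  assert (EW : W 0 = (f z - c)%C) by (unfold W; rewrite E0; reflexivity).
  assert (EV : V 0 = (Ci * (z * f1 z))%C) by (unfold V; rewrite E0, cis_0; ring).
  destruct (second_derivative_test (fun t => cdot (W t) (W t)) (fun t => 2 * cdot (V t) (W t))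
     (2 * (cdot (- (z * f1 z + z * z * f2 z))%C (W 0) + cdot (V 0) (V 0))) eta Heta) as [T1 T2].
  { intros t Ht. evar_last; [apply is_derive_cdot; apply DW|]. unfold cdot. ring. }
  { apply is_derive_scal, is_derive_cdot; [exact DV|apply DW]. }
  { intros t Ht. rewrite !cdot_self, EW, Hrho. apply pow_incr. split; [|apply Hang, Ht].
    rewrite <- Hrho. apply Cmod_ge_0. }
  assert (T3 : 0 <= 2 * cdot (f1 z * z) (f z - c)).
  { apply (right_minimum_derivative (fun s => cdot (f (0 + s * z)%C - c) (f (0 + s * z)%C - c)) 1 _ eta Heta).
    - assert (E1 : (0 + 1%R * z)%C = z) by ring.
      assert (D : cderiv (fun s : R => f (0 + s * z)%C - c)%C 1 (f1 z * z)%C).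
      { apply cderiv_minus_const, cderiv_comp; [rewrite E1; apply Hf; lra|apply cderiv_line]. }
      evar_last; [apply is_derive_cdot; apply D|]. cbv beta. rewrite E1. unfold cdot. ring.
    - intros s Hs. cbv beta. rewrite !cdot_self.
      replace (0 + 1%R * z)%C with z by ring. rewrite Hrho.
      replace (0 + s * z)%C with (s * z)%C by ring.
      apply pow_incr. split; [rewrite <- Hrho; apply Cmod_ge_0|apply Hrad, Hs]. }
  rewrite EW, EV in *. set (w := (f z - c)%C) in *. set (U := (z * f1 z)%C) in *.
  set (E := (1 + z * (f2 z / f1 z))%C) in *.
  assert (EA : (- (U + z * z * f2 z))%C = (- (U * E))%C) by (unfold U, E; field; exact Hnz).
  rewrite EA in T2. replace (f1 z * z)%C with U in T3 by (unfold U; ring).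
  set (m := Cmod U) in *.
  assert (Hm : 0 < m).
  { unfold m, U. rewrite Cmod_mult. apply Rmult_lt_0_compat; [lra|]. apply Cmod_gt_0, Hnz. }
  assert (Hm2 : m ^ 2 = Re U ^ 2 + Im U ^ 2) by apply Cmod2_alt.
  assert (Hr2 : rho ^ 2 = Re w ^ 2 + Im w ^ 2) by (rewrite <- Hrho; apply Cmod2_alt).
  assert (Hr0 : 0 <= rho) by (rewrite <- Hrho; apply Cmod_ge_0).
  assert (Hperp : Re U * Im w - Im U * Re w = 0) by (unfold cdot, Ci, Cmult, Re, Im in *; simpl in *; lra).
  assert (Hdot : cdot U w = m * rho).
  { assert (Hsq : cdot U w ^ 2 = (m * rho) ^ 2).
    { rewrite Rpow_mult_distr, Hm2, Hr2.
      replace (cdot U w ^ 2) with (cdot U w ^ 2 + (Re U * Im w - Im U * Re w) ^ 2)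
        by (rewrite Hperp; ring).
      unfold cdot. ring. }
    assert (0 <= m * rho) by nra. nra. }
  assert (HE : cdot (- (U * E))%C w = - (Re E * (m * rho))).
  { rewrite <- Hdot. unfold cdot.
    replace (Re (- (U * E))%C) with (- (Re U * Re E - Im U * Im E)) by reflexivity.
    replace (Im (- (U * E))%C) with (- (Re U * Im E + Im U * Re E)) by reflexivity.
    transitivity (- (Re E * (Re U * Re w + Im U * Im w)) - Im E * (Re U * Im w - Im U * Re w)); [ring|].
    rewrite Hperp. ring. }
  assert (HV : cdot (Ci * U)%C (Ci * U)%C = m ^ 2).
  { rewrite cdot_self, Cmod_mult, Cmod_Ci. unfold m. ring. }
  rewrite HE, HV in T2.
  assert (HmE : rho * Re E <= m) by nra.
  assert (0 < Re E) by nra. nra.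
Qed.

Lemma Rcontinuous_on_mult (S : C -> Prop) (g h : C -> R) :
  Rcontinuous_on S g -> Rcontinuous_on S h -> Rcontinuous_on S (fun z => g z * h z).
Proof.
  intros Hg Hh.
  assert (Hsq : forall u, Rcontinuous_on S u -> forall c, Rcontinuous_on S (fun z => c * u z ^ 2)).
  { intros u Hu c. apply (Rcontinuous_on_comp S u (fun x => c * x ^ 2) Hu).
    intros z _. apply (ex_derive_continuous (K := R_AbsRing) (V := R_NormedModule)).
    auto_derive. exact I. }
  assert (H : Rcontinuous_on S (fun z => / 4 * (g z + h z) ^ 2 + - / 4 * (g z + - h z) ^ 2)).
  { apply Rcontinuous_on_plus; apply Hsq, Rcontinuous_on_plus; auto using Rcontinuous_on_opp. }
  intros z Hz eps Heps. destruct (H z Hz eps Heps) as [eta [Heta He]].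
  exists eta. split; [exact Heta|]. intros w Hw Hwz. specialize (He w Hw Hwz).
  replace (g w * h w - g z * h z)
    with (/ 4 * (g w + h w) ^ 2 + - / 4 * (g w + - h w) ^ 2 -
          (/ 4 * (g z + h z) ^ 2 + - / 4 * (g z + - h z) ^ 2)) by field.
  exact He.
Qed.

Lemma Rcontinuous_on_ext (S : C -> Prop) (g h : C -> R) :
  (forall z, S z -> g z = h z) -> Rcontinuous_on S g -> Rcontinuous_on S h.
Proof.
  intros E H z Hz eps Heps. destruct (H z Hz eps Heps) as [eta [Heta He]].
  exists eta. split; [exact Heta|]. intros w Hw Hwz. rewrite <- !E; auto.
Qed.

Lemma Rcontinuous_on_const (S : C -> Prop) (c : R) : Rcontinuous_on S (fun _ => c).
Proof.
  intros z _ eps Heps. exists 1. split; [lra|]. intros w _ _.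
  rewrite Rminus_diag, Rabs_R0. exact Heps.
Qed.

Lemma Cclosed_sublevel (S : C -> Prop) (g : C -> R) (c : R) :
  Cclosed_set S -> Rcontinuous_on S g -> Cclosed_set (fun z => S z /\ g z <= c).
Proof.
  intros Hcl Hg z H.
  assert (HS : S z).
  { apply Hcl. intros eps Heps. destruct (H eps Heps) as [w [[Hw _] Hwz]]. eauto. }
  split; [exact HS|]. apply Rnot_lt_le. intros Hlt.
  destruct (Hg z HS (g z - c) ltac:(lra)) as [eta [Heta He]].
  destruct (H eta Heta) as [w [[Hw Hwc] Hwz]]. specialize (He w Hw Hwz).
  apply Rabs_lt_between in He. lra.
Qed.

(** * Circular segments over a chord *)

(** [chord_side] is positive on one side of the line through [a] and [q], the
    side being selected by the sign [sg]; [chord_power] is the power of a point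
    with respect to the circle with diameter [a, q].  The pencil of circles
    through [a] and [q] consists of the curves
    [chord_power + k * chord_side = 0], and as [k] decreases from infinity their
    arcs on the positive side sweep that side, beginning with the chord. *)
Definition chord_side (sg : R) (a q w : C) : R := sg * cdot (Ci * (q - a))%C (w - a)%C.

Definition chord_power (a q w : C) : R := cdot (w - a)%C (w - q)%C.

Definition pencil_centre (sg : R) (a q : C) (k : R) : C := (a + (q - a) * ((/ 2)%R, (- sg * k / 2)%R))%C.

Lemma pencil_circle (sg : R) (a q : C) (k : R) (w : C) : sg ^ 2 = 1 ->
  Cmod (w - pencil_centre sg a q k) ^ 2 =
  chord_power a q w + k * chord_side sg a q w + Cmod (q - a) ^ 2 * (1 + k ^ 2) / 4.
Proof.
  intros Hs. rewrite !Cmod2_alt. unfold pencil_centre, chord_side, chord_power, cdot, Ci, Re, Im.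
  destruct a as [a1 a2], q as [q1 q2], w as [w1 w2]. simpl in *.
  replace (k * (k * 1)) with (sg * (sg * 1) * (k * k)) by (rewrite Hs; ring). field.
Qed.

Lemma Rcontinuous_on_chord_power (S : C -> Prop) (f : C -> C) (a q : C) :
  Ccontinuous_on S f -> Rcontinuous_on S (fun z => chord_power a q (f z)).
Proof.
  intros Hf. set (c := pencil_centre 1 a q 0).
  apply (Rcontinuous_on_ext S (fun z => Cmod (f z - c) ^ 2 - Cmod (q - a) ^ 2 / 4)).
  - intros z _. unfold c. rewrite pencil_circle by ring. field.
  - apply (Rcontinuous_on_comp S (fun z => Cmod (f z - c)) (fun x => x ^ 2 - Cmod (q - a) ^ 2 / 4)).
    + apply Rcontinuous_on_Cmod_minus, Hf.
    + intros z _. apply (ex_derive_continuous (K := R_AbsRing) (V := R_NormedModule)).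
      auto_derive. exact I.
Qed.

Lemma Rcontinuous_on_chord_side (S : C -> Prop) (f : C -> C) (sg : R) (a q : C) :
  Ccontinuous_on S f -> Rcontinuous_on S (fun z => chord_side sg a q (f z)).
Proof.
  intros Hf. set (c := pencil_centre 1 a q 1).
  apply (Rcontinuous_on_ext S (fun z => sg * ((Cmod (f z - c) ^ 2 - Cmod (q - a) ^ 2 / 2)
                                              + - chord_power a q (f z)))).
  - intros z _. unfold c. rewrite pencil_circle by ring. unfold chord_side. field.
  - apply Rcontinuous_on_mult; [apply Rcontinuous_on_const|].
    apply Rcontinuous_on_plus; [|apply Rcontinuous_on_opp, Rcontinuous_on_chord_power, Hf].
    apply (Rcontinuous_on_comp S (fun z => Cmod (f z - c)) (fun x => x ^ 2 - Cmod (q - a) ^ 2 / 2)).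
    + apply Rcontinuous_on_Cmod_minus, Hf.
    + intros z _. apply (ex_derive_continuous (K := R_AbsRing) (V := R_NormedModule)).
      auto_derive. exact I.
Qed.

Lemma chord_side_seg (sg : R) (a q w : C) (t : R) :
  chord_side sg a q (seg a w t) = t * chord_side sg a q w.
Proof. unfold chord_side, seg, cdot, Ci, Re, Im; simpl; ring. Qed.

Lemma chord_power_seg (a q w : C) (t : R) :
  chord_power a q (seg a w t) = t * chord_power a q w - t * (1 - t) * Cmod (w - a) ^ 2.
Proof. rewrite Cmod2_alt. unfold chord_power, seg, cdot, Re, Im; simpl; ring. Qed.

Lemma circular_segment_star (sg : R) (a q w : C) (k t : R) :
  0 < t <= 1 -> 0 < chord_side sg a q w ->
  chord_power a q w + k * chord_side sg a q w < 0 ->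
  0 < chord_side sg a q (seg a w t) /\
  chord_power a q (seg a w t) + k * chord_side sg a q (seg a w t) < 0.
Proof.
  intros Ht HM HN. rewrite chord_side_seg, chord_power_seg. split; [nra|].
  pose proof (pow2_ge_0 (Cmod (w - a))) as H2.
  assert (0 <= t * (1 - t) * Cmod (w - a) ^ 2) by (apply Rmult_le_pos; [nra|lra]).
  nra.
Qed.

Definition chord (a q w : C) : Prop := chord_side 1 a q w = 0 /\ chord_power a q w <= 0.

Lemma chord_closed (a q : C) : Cclosed_set (chord a q).
Proof.
  assert (H : Cclosed_set (fun w => (((True /\ chord_side 1 a q w <= 0) /\
                - chord_side 1 a q w <= 0)) /\ chord_power a q w <= 0)).
  { apply (Cclosed_sublevel _ (fun w => chord_power a q w)).
    - apply (Cclosed_sublevel _ (fun w => - chord_side 1 a q w)).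
      + apply (Cclosed_sublevel _ (fun w => chord_side 1 a q w)); [intros z _; exact I|].
        apply (Rcontinuous_on_chord_side _ (fun z => z)), Ccontinuous_on_id.
      + apply Rcontinuous_on_opp, (Rcontinuous_on_chord_side _ (fun z => z)), Ccontinuous_on_id.
    - apply (Rcontinuous_on_chord_power _ (fun z => z)), Ccontinuous_on_id. }
  intros z Hz. unfold chord.
  destruct (H z) as [[[_ H1] H2] H3]; [|split; lra].
  intros eps Heps. destruct (Hz eps Heps) as [w [[Hw1 Hw2] Hwz]].
  exists w. split; [|exact Hwz]. repeat split; lra.
Qed.

Lemma chord_bounded (a q : C) : Cbounded_set (chord a q).
Proof.
  set (c := pencil_centre 1 a q 0).
  exists (Cmod c + Cmod (q - a)). intros w [_ Hw].
  assert (H : Cmod (w - c) <= Cmod (q - a)).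
  { apply Cmod_le_sqr; [apply Cmod_ge_0|]. unfold c. rewrite pencil_circle by ring.
    pose proof (pow2_ge_0 (Cmod (q - a))). lra. }
  pose proof (Cmod_triangle c (w - c)) as T. replace (c + (w - c))%C with w in T by ring. lra.
Qed.

Lemma chord_is_segment (a q w : C) : a <> q -> chord a q w ->
  exists t, 0 <= t <= 1 /\ w = seg a q t.
Proof.
  intros Hne [Hside Hpow].
  assert (Hd : 0 < Cmod (q - a) ^ 2).
  { apply pow_lt, Cmod_gt_0. intros E. apply Hne.
    replace q with (q - a + a)%C by ring. rewrite E. ring. }
  set (t := cdot (w - a) (q - a) / Cmod (q - a) ^ 2).
  assert (E : w = seg a q t).
  { rewrite Cmod2_alt in Hd. unfold t. rewrite Cmod2_alt.
    unfold chord_side, cdot, seg, Ci, Re, Im in *.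
    destruct a as [a1 a2], q as [q1 q2], w as [w1 w2]. simpl in *.
    set (D := (q1 + - a1) * ((q1 + - a1) * 1) + (q2 + - a2) * ((q2 + - a2) * 1)) in *.
    set (X := (w1 + - a1) * (q1 + - a1) + (w2 + - a2) * (q2 + - a2)).
    assert (H1 : (w1 - a1) * D = X * (q1 - a1) - (q2 - a2) * 0)
      by (rewrite <- Hside; unfold X, D; ring).
    assert (H2 : (w2 - a2) * D = X * (q2 - a2) + (q1 - a1) * 0)
      by (rewrite <- Hside; unfold X, D; ring).
    apply Ceq; simpl.
    - replace w1 with ((w1 - a1) * D / D + a1) by (field; lra). rewrite H1. field. lra.
    - replace w2 with ((w2 - a2) * D / D + a2) by (field; lra). rewrite H2. field. lra. }
  exists t. split; [|exact E].
  rewrite E in Hpow. rewrite chord_power_seg in Hpow.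
  replace (chord_power a q q) with 0 in Hpow by (unfold chord_power, cdot, Re, Im; simpl; ring).
  assert (0 <= t * (1 - t)) by nra. nra.
Qed.

(** The analytic content of a lower curvature bound near the unit circle; it
    includes that [f'] does not vanish there. *)
Definition curvature_bound (f1 f2 : C -> C) (R' r0 : R) : Prop :=
  forall z, r0 < Cmod z < 1 ->
    f1 z <> 0%C /\ Cmod (z * f1 z) <= R' * Re (1 + z * (f2 z / f1 z))%C.

Lemma Cmod_cis_minus_1 : exists eta, 0 < eta /\ forall t, Rabs t < eta -> Cmod (cis t - 1) <= 2 * Rabs t.
Proof.
  destruct (proj1 (cderiv_eps _ _ _) (cderiv_cis 0) 1 Rlt_0_1) as [eta [Heta H]].
  exists eta. split; [exact Heta|]. intros t Ht. specialize (H t).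
  rewrite Rminus_0_r, cis_0 in H. specialize (H Ht).
  pose proof (Cmod_triangle (cis t - 1 - Ci * 1 * t) (Ci * 1 * t)) as T.
  replace (cis t - 1 - Ci * 1 * t + Ci * 1 * t)%C with (cis t - 1)%C in T by ring.
  rewrite !Cmod_mult, Cmod_Ci, Cmod_1, Cmod_R in T. lra.
Qed.

(** If [w] were not in the image, the level curve [|z| = r] with [r] near 1 would
    separate [w] from the chord and hence enter the circular segment.  The first
    circle of the pencil that meets the level curve in the sweep from the
    chord then has a parameter [k >= k0], so its radius exceeds [R'].  The level
    curve lies outside the region swept before, so it is touched from
    inside, and [internal_tangency] bounds the radius by [R']. *)
Lemma circular_segment_in_image (f f1 f2 : C -> C) (R' r0 sg k0 : R) (a q w : C) :
  smooth_univalent f f1 f2 -> convex (image f unit_disk) ->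
  curvature_bound f1 f2 R' r0 -> r0 < 1 -> 0 < R' -> sg ^ 2 = 1 ->
  image f unit_disk a -> image f unit_disk q ->
  (forall k, k0 <= k -> 4 * R' ^ 2 < Cmod (q - a) ^ 2 * (1 + k ^ 2)) ->
  0 < chord_side sg a q w -> chord_power a q w + k0 * chord_side sg a q w < 0 ->
  image f unit_disk w.
Proof.
  intros Hf Hconv Hcurv Hr0 HR' Hsg Ha Hq Hk Hside Hpow. apply NNPP. intros Hw.
  assert (Hne : a <> q).
  { intros E. specialize (Hk k0 (Rle_refl _)). rewrite E in Hk.
    replace (q - q)%C with (RtoC 0) in Hk by ring. rewrite Cmod_0 in Hk. nra. }
  destruct (compact_subset_disk_image f f1 f2 (chord a q) Hf (chord_closed a q) (chord_bounded a q))
    as [r1 [Hr1 Hchord]].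
  { intros v Hv. destruct (chord_is_segment a q v Hne Hv) as [t [Ht ->]].
    replace (seg a q t) with ((1 - t)%R * a + t * q)%C by (unfold seg; rewrite RtoC_minus; ring).
    apply Hconv; assumption. }
  set (r := (1 + Rmax r0 r1) / 2).
  assert (Hr : r0 < r /\ r1 < r /\ r < 1).
  { pose proof (Rmax_l r0 r1). pose proof (Rmax_r r0 r1).
    assert (Rmax r0 r1 < 1) by (apply Rmax_lub_lt; lra). unfold r. lra. }
  destruct Hr as [Hrr0 [Hrr1 Hr]].
  assert (Hav : chord a q a).
  { split; [unfold chord_side|unfold chord_power]; unfold cdot, Ci, Re, Im; simpl; nra. }
  assert (Hoff : forall z, Cmod z = r -> ~ chord a q (f z)).
  { intros z Hz Hc. apply (not_in_disk_image f f1 f2 r1 z Hf ltac:(lra)), Hchord, Hc. }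
  assert (Hcross : forall v k, ~ disk_image f r v -> 0 < chord_side sg a q v ->
     chord_power a q v + k * chord_side sg a q v < 0 ->
     exists z, Cmod z = r /\ 0 < chord_side sg a q (f z) /\
       chord_power a q (f z) + k * chord_side sg a q (f z) < 0).
  { intros v k Hv HM HN.
    destruct (segment_crosses_level_curve f f1 f2 r a v Hf ltac:(lra)) as [t [z [Ht [Hz Ez]]]];
      [apply (disk_image_mono f r1); [lra|apply Hchord, Hav]|exact Hv|].
    exists z. split; [exact Hz|]. rewrite Ez. apply circular_segment_star; try assumption.
    destruct (Rle_lt_or_eq_dec 0 t) as [Hpos|Hzero]; [lra|lra|]. exfalso.
    apply (Hoff z Hz). rewrite Ez, <- Hzero.
    replace (seg a v 0) with a by (unfold seg; ring). exact Hav. }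
  assert (Hcont : forall S : C -> Prop, (forall z, S z -> Cmod z < 1) -> Ccontinuous_on S f)
    by (intros S HS; exact (smooth_univalent_continuous f f1 f2 S Hf HS)).
  (* The largest pencil parameter on the level curve is sought among the points
     of the closed circular segment; the curve avoids the chord, so
     [chord_side] does not vanish there and the parameter is continuous. *)
  set (T := fun z => (Cmod z = r /\ - chord_side sg a q (f z) <= 0) /\
                     chord_power a q (f z) + k0 * chord_side sg a q (f z) <= 0).
  assert (HT1 : forall z, T z -> Cmod z < 1) by (intros z [[Hz _] _]; lra).
  assert (HTpos : forall z, T z -> 0 < chord_side sg a q (f z)).
  { intros z [[Hz HM] HN]. destruct (Rle_lt_or_eq_dec 0 (chord_side sg a q (f z))) as [|E]; [lra|assumption|].
    exfalso. apply (Hoff z Hz). split; [|nra]. unfold chord_side in *. nra. }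
  assert (HTne : exists z, T z).
  { destruct (Hcross w k0) as [z [Hz [HM HN]]]; [|assumption|assumption|].
    - intros [v [Hv ->]]. apply Hw. exists v. split; [unfold unit_disk; lra|reflexivity].
    - exists z. unfold T. repeat split; lra. }
  destruct (maximum_attained T (fun z => - chord_power a q (f z) * / chord_side sg a q (f z)))
    as [z0 [Hz0 Hmax]].
  - assert (Hc : Ccontinuous_on (fun z => Cmod z = r) f) by (apply Hcont; intros z Hz; lra).
    assert (Hc' : Ccontinuous_on (fun z => Cmod z = r /\ - chord_side sg a q (f z) <= 0) f)
      by (apply Hcont; intros z [Hz _]; lra).
    apply (Cclosed_sublevel _ (fun z => chord_power a q (f z) + k0 * chord_side sg a q (f z))).
    + apply (Cclosed_sublevel _ (fun z => - chord_side sg a q (f z))); [apply circle_closed|].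
      apply Rcontinuous_on_opp, Rcontinuous_on_chord_side, Hc.
    + apply Rcontinuous_on_plus; [apply Rcontinuous_on_chord_power, Hc'|].
      apply Rcontinuous_on_mult; [apply Rcontinuous_on_const|].
      apply Rcontinuous_on_chord_side, Hc'.
  - exists r. intros z [[Hz _] _]. lra.
  - apply Rcontinuous_on_mult.
    + apply Rcontinuous_on_opp, Rcontinuous_on_chord_power, Hcont, HT1.
    + apply (Rcontinuous_on_comp T (fun z => chord_side sg a q (f z)) Rinv).
      * apply Rcontinuous_on_chord_side, Hcont, HT1.
      * intros z Hz. apply (ex_derive_continuous (K := R_AbsRing) (V := R_NormedModule)).
        auto_derive. pose proof (HTpos z Hz). lra.
  - exact HTne.
  - assert (HM0 := HTpos z0 Hz0).
    set (k := - chord_power a q (f z0) * / chord_side sg a q (f z0)) in *.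
    assert (Ek : chord_power a q (f z0) + k * chord_side sg a q (f z0) = 0)
      by (unfold k; field; lra).
    assert (Hk0 : k0 <= k).
    { destruct Hz0 as [_ HN]. nra. }
    destruct Hz0 as [[Hz0 _] _].
    assert (Hout : forall z, Cmod z = r -> 0 < chord_side sg a q (f z) ->
       0 <= chord_power a q (f z) + k * chord_side sg a q (f z)).
    { intros z Hz HM.
      destruct (Rle_lt_dec (chord_power a q (f z) + k0 * chord_side sg a q (f z)) 0) as [HN|HN].
      - assert (HTz : T z) by (unfold T; repeat split; lra).
        specialize (Hmax z HTz). cbv beta in Hmax.
        assert (- chord_power a q (f z) * / chord_side sg a q (f z) * chord_side sg a q (f z)
                <= k * chord_side sg a q (f z)) by (apply Rmult_le_compat_r; lra).
        rewrite Rmult_assoc, Rinv_l in H by lra. lra.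
      - nra. }
    specialize (Hk k Hk0).
    set (c := pencil_centre sg a q k).
    set (rho := Cmod (f z0 - c)).
    assert (Hrho2 : rho ^ 2 = Cmod (q - a) ^ 2 * (1 + k ^ 2) / 4).
    { unfold rho, c. rewrite pencil_circle by exact Hsg. rewrite Ek. field. }
    assert (Hrho0 : 0 <= rho) by apply Cmod_ge_0.
    assert (Hge : forall v, 0 <= chord_power a q v + k * chord_side sg a q v -> rho <= Cmod (v - c)).
    { intros v Hv. assert (rho ^ 2 <= Cmod (v - c) ^ 2).
      { unfold c. rewrite pencil_circle, Hrho2 by exact Hsg. lra. }
      pose proof (Cmod_ge_0 (v - c)). nra. }
    destruct (Rcontinuous_on_chord_side (fun z => Cmod z < 1) f sg a q (Hcont _ (fun z H => H)) z0
                ltac:(lra) _ HM0) as [mu [Hmu Hnear]].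
    assert (Hnear' : forall z, Cmod z < 1 -> Cmod (z - z0) < mu -> 0 < chord_side sg a q (f z)).
    { intros z Hz Hzz. specialize (Hnear z Hz Hzz). apply Rabs_lt_between in Hnear. lra. }
    destruct Cmod_cis_minus_1 as [e1 [He1 Hcis]].
    set (eta := Rmin e1 (Rmin (mu / 2) (1 - r))).
    assert (Heta : 0 < eta) by (unfold eta; repeat apply Rmin_pos; lra).
    assert (Heta1 : eta <= e1) by apply Rmin_l.
    assert (Heta2 : eta <= mu / 2) by (eapply Rle_trans; [apply Rmin_r|apply Rmin_l]).
    assert (Heta3 : eta <= 1 - r) by (eapply Rle_trans; [apply Rmin_r|apply Rmin_r]).
    destruct (Hcurv z0 ltac:(lra)) as [Hnz Hbound].
    assert (rho <= R'); [|nra].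
    apply (internal_tangency f f1 f2 z0 c rho R' eta (su_deriv _ _ _ Hf) (su_deriv2 _ _ _ Hf));
      try assumption; try lra.
    + reflexivity.
    + intros t Ht. apply Hge.
      assert (Hzt : Cmod (z0 * cis t) = r) by (rewrite Cmod_mult, Cmod_cis; lra).
      apply Hout; [exact Hzt|]. apply Hnear'; [lra|].
      replace (z0 * cis t - z0)%C with (z0 * (cis t - 1))%C by ring.
      rewrite Cmod_mult. specialize (Hcis t ltac:(lra)).
      pose proof (Cmod_ge_0 (cis t - 1)). nra.
    + intros s Hs. apply Hge. apply Rnot_lt_le. intros Hneg.
      assert (Hsz : Cmod (s * z0) = s * r) by (rewrite Cmod_scal, Hz0 by lra; reflexivity).
      assert (Hsr : s * r < 1) by nra.
      assert (HM : 0 < chord_side sg a q (f (s * z0)%C)).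
      { apply Hnear'; [lra|].
        replace (s * z0 - z0)%C with ((s - 1)%R * z0)%C by (rewrite RtoC_minus; ring).
        rewrite Cmod_scal by lra. nra. }
      assert (Hs1 : 1 < s).
      { destruct (Rle_lt_or_eq_dec 1 s) as [|E]; [lra|assumption|]. exfalso.
        rewrite <- E in Hneg. replace (1 * z0)%C with z0 in Hneg by ring. lra. }
      destruct (Hcross (f (s * z0)%C) k) as [z [Hz [HMz HNz]]]; try assumption.
      * apply (not_in_disk_image f f1 f2); [exact Hf|]. rewrite Hsz. nra.
      * pose proof (Hout z Hz HMz). lra.
Qed.

(** * The image lies in a disk of radius [R2] *)

(** On every level curve near the unit circle, a point nearest to the origin
    is touched from inside by a disk about the origin, so it lies within
    [R'] of the origin.  If the image were the whole plane, the closed disk of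
    radius [R'] would be covered by a smaller disk and these points would have
    nowhere to go. *)
Lemma image_not_plane (f f1 f2 : C -> C) (R' r0 : R) :
  smooth_univalent f f1 f2 -> f 0%C = 0%C ->
  curvature_bound f1 f2 R' r0 -> r0 < 1 -> 0 < R' ->
  exists w, ~ image f unit_disk w.
Proof.
  intros Hf Hf0 Hcurv Hr0 HR'. apply NNPP. intros Hno.
  destruct (compact_subset_disk_image f f1 f2 (fun w => Cmod w <= R') Hf
              (closed_disk_closed R') (bounded_disk R')) as [r1 [Hr1 Hin]].
  { intros w _. apply NNPP. intros Hw. apply Hno. exists w. exact Hw. }
  set (r := (1 + Rmax r0 r1) / 2).
  assert (Hr : r0 < r /\ r1 < r /\ r < 1).
  { pose proof (Rmax_l r0 r1). pose proof (Rmax_r r0 r1).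
    assert (Rmax r0 r1 < 1) by (apply Rmax_lub_lt; lra). unfold r. lra. }
  assert (Horig : disk_image f r 0%C).
  { exists 0%C. rewrite Cmod_0, Hf0. split; [lra|reflexivity]. }
  destruct (minimum_attained (fun z => Cmod z = r) (fun z => Cmod (f z - 0))) as [z0 [Hz0 Hmin]].
  - apply circle_closed.
  - apply bounded_circle.
  - apply Rcontinuous_on_Cmod_minus, (smooth_univalent_continuous f f1 f2 _ Hf).
    intros z Hz. lra.
  - apply circle_inhabited. lra.
  - destruct (Hcurv z0 ltac:(lra)) as [Hnz Hbound].
    assert (Hle : Cmod (f z0 - 0) <= R').
    { apply (internal_tangency f f1 f2 z0 0 _ R' (1 - r) (su_deriv _ _ _ Hf) (su_deriv2 _ _ _ Hf));
        try assumption; try lra.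
      - intros t _. apply (Hmin (z0 * cis t)%C). rewrite Cmod_mult, Cmod_cis. lra.
      - intros s Hs. apply Rnot_lt_le. intros Hneg.
        assert (Hsz : Cmod (s * z0) = s * r) by (rewrite Cmod_scal, Hz0 by lra; reflexivity).
        assert (Hs1 : 1 < s).
        { destruct (Rle_lt_or_eq_dec 1 s) as [|E]; [lra|assumption|]. exfalso.
          rewrite <- E in Hneg. replace (1 * z0)%C with z0 in Hneg by ring. lra. }
        destruct (segment_crosses_level_curve f f1 f2 r 0 (f (s * z0)%C) Hf ltac:(lra) Horig)
          as [t [z [Ht [Hz Ez]]]].
        { apply (not_in_disk_image f f1 f2 _ _ Hf). rewrite Hsz. nra. }
        specialize (Hmin z Hz). rewrite Ez in Hmin.
        replace (seg 0 (f (s * z0)%C) t - 0)%C with (t * (f (s * z0)%C - 0))%C in Hmin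
          by (unfold seg; ring).
        rewrite Cmod_scal in Hmin by lra.
        pose proof (Cmod_ge_0 (f (s * z0)%C - 0)). nra. }
    apply (not_in_disk_image f f1 f2 r1 z0 Hf ltac:(lra)), Hin.
    replace (f z0) with (f z0 - 0)%C by ring. exact Hle.
Qed.

Lemma nearest_boundary_ball (E : C -> Prop) (w0 w : C) :
  E 0%C -> (forall v, boundary E v -> Cmod w0 <= Cmod v) -> Cmod w < Cmod w0 -> E w.
Proof.
  intros H0 Hmin Hw. apply NNPP. intros Hno.
  destruct (segment_meets_boundary E 0 w H0 Hno) as [t [Ht Hb]].
  specialize (Hmin _ Hb). replace (seg 0 w t) with (t * w)%C in Hmin by (unfold seg; ring).
  rewrite Cmod_scal in Hmin by lra. pose proof (Cmod_ge_0 w). nra.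
Qed.

(** A point [q] of a convex set beyond the line would place [w0] in the interior
    of the convex hull of [q] and the ball about the origin. *)
Lemma nearest_boundary_support (E : C -> Prop) (w0 q : C) :
  convex E -> E 0%C -> boundary E w0 -> (forall v, boundary E v -> Cmod w0 <= Cmod v) ->
  E q -> cdot q w0 <= Cmod w0 ^ 2.
Proof.
  intros Hconv H0 Hb Hmin Hq. apply Rnot_lt_le. intros Hlt.
  set (g := cdot q w0 - Cmod w0 ^ 2). assert (Hg : 0 < g) by (unfold g; lra).
  set (t := Rmin (/ 2) (g / (Cmod q ^ 2 + 1))).
  pose proof (pow2_ge_0 (Cmod q)) as Hq2.
  assert (Ht : 0 < t) by (apply Rmin_pos; [lra|apply Rdiv_lt_0_compat; lra]).
  assert (Ht2 : t <= / 2) by apply Rmin_l.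
  assert (Htg : t * (Cmod q ^ 2 + 1) <= g).
  { apply (Rle_trans _ (g / (Cmod q ^ 2 + 1) * (Cmod q ^ 2 + 1))).
    - apply Rmult_le_compat_r; [lra|apply Rmin_r].
    - right. field. lra. }
  assert (Hin : Cmod (w0 - t * q) < (1 - t) * Cmod w0).
  { apply Cmod_lt_sqr; [pose proof (Cmod_ge_0 w0); nra|].
    assert (E1 : Cmod (w0 - t * q) ^ 2 = Cmod w0 ^ 2 - 2 * t * cdot q w0 + t ^ 2 * Cmod q ^ 2).
    { rewrite !Cmod2_alt. unfold cdot, Re, Im. simpl. ring. }
    rewrite E1. replace (cdot q w0) with (g + Cmod w0 ^ 2) by (unfold g; ring).
    pose proof (pow2_ge_0 (Cmod w0)).
    assert (t ^ 2 * Cmod q ^ 2 < 2 * t * g) by nra.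
    replace (((1 - t) * Cmod w0) ^ 2) with (Cmod w0 ^ 2 - 2 * t * Cmod w0 ^ 2 + t ^ 2 * Cmod w0 ^ 2) by ring.
    nra. }
  set (eps := (1 - t) * Cmod w0 - Cmod (w0 - t * q)).
  destruct (Hb eps ltac:(unfold eps; lra)) as [_ [v [Hv1 Hv2]]]. apply Hv1.
  set (u := ((v - t * q) * (/ (1 - t))%R)%C).
  assert (Hu : E u).
  { apply (nearest_boundary_ball E w0 u H0 Hmin).
    unfold u. rewrite Cmod_mult, Cmod_R, Rabs_pos_eq by (left; apply Rinv_0_lt_compat; lra).
    assert (Hlt2 : Cmod (v - t * q) < (1 - t) * Cmod w0).
    { pose proof (Cmod_minus_triangle v (t * q) w0). unfold eps in Hv2. lra. }
    apply (Rmult_lt_reg_r (1 - t)); [lra|]. rewrite Rmult_assoc, Rinv_l by lra. lra. }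
  replace v with ((1 - t)%R * u + t * q)%C; [apply Hconv; [exact Hu|exact Hq|lra]|].
  unfold u. rewrite Cmult_comm, <- Cmult_assoc, <- RtoC_mult, Rinv_l by lra. ring.
Qed.

Lemma positive_nearby (g : R -> R) :
  ex_derive g 0 -> 0 < g 0 -> exists eta, 0 < eta /\ forall t, 0 < t < eta -> 0 < g t.
Proof.
  intros Hd Hpos. apply ex_derive_continuous in Hd.
  destruct (proj1 (filterlim_locally _ _) Hd (mkposreal _ Hpos)) as [d H].
  exists d. split; [apply cond_pos|]. intros t Ht.
  assert (Hb : Rabs (g t - g 0) < g 0).
  { apply (H t). change (Rabs (t - 0) < d). rewrite Rminus_0_r, Rabs_pos_eq; lra. }
  apply Rabs_lt_between in Hb. lra.
Qed.

(** [circular_segment_in_image] for an endpoint [w0] that is only a limit of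
    points [(1 - t) w0] of the image: its strict inequalities persist when that
    endpoint is moved slightly. *)
Lemma circular_segment_boundary_endpoint
  (f f1 f2 : C -> C) (R' r0 sg k0 m : R) (w0 q w : C) :
  smooth_univalent f f1 f2 -> convex (image f unit_disk) ->
  curvature_bound f1 f2 R' r0 -> r0 < 1 -> 0 < R' -> sg ^ 2 = 1 ->
  (forall v, Cmod v < Cmod w0 -> image f unit_disk v) -> w0 <> 0%C -> image f unit_disk q ->
  (forall k, k0 <= k -> m <= 1 + k ^ 2) -> 4 * R' ^ 2 < Cmod (q - w0) ^ 2 * m ->
  0 < chord_side sg w0 q w -> chord_power w0 q w + k0 * chord_side sg w0 q w < 0 ->
  image f unit_disk w.
Proof.
  intros Hf Hconv Hcurv Hr0 HR' Hsg Hball Hw0 Hq Hm Hrad Hside Hpow.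
  set (a := fun t : R => ((1 - t)%R * w0)%C).
  assert (Ha0 : a 0 = w0) by (unfold a; rewrite Rminus_0_r; ring).
  destruct (positive_nearby (fun t => cdot (q - a t) (q - a t) * m - 4 * R' ^ 2)) as [e1 [He1 H1]].
  { unfold a, cdot, Re, Im; simpl. auto_derive. exact I. }
  { rewrite cdot_self, Ha0. lra. }
  destruct (positive_nearby (fun t => chord_side sg (a t) q w)) as [e2 [He2 H2]].
  { unfold a, chord_side, cdot, Ci, Re, Im; simpl. auto_derive. exact I. }
  { rewrite Ha0. exact Hside. }
  destruct (positive_nearby (fun t => - (chord_power (a t) q w + k0 * chord_side sg (a t) q w)))
    as [e3 [He3 H3]].
  { unfold a, chord_side, chord_power, cdot, Ci, Re, Im; simpl. auto_derive. exact I. }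
  { rewrite Ha0. lra. }
  set (t := Rmin 1 (Rmin e1 (Rmin e2 e3)) / 2).
  assert (Ht : 0 < t /\ t < 1 /\ t < e1 /\ t < e2 /\ t < e3).
  { assert (0 < Rmin 1 (Rmin e1 (Rmin e2 e3))) by (repeat apply Rmin_pos; lra).
    pose proof (Rmin_l 1 (Rmin e1 (Rmin e2 e3))). pose proof (Rmin_r 1 (Rmin e1 (Rmin e2 e3))).
    pose proof (Rmin_l e1 (Rmin e2 e3)). pose proof (Rmin_r e1 (Rmin e2 e3)).
    pose proof (Rmin_l e2 e3). pose proof (Rmin_r e2 e3). unfold t. lra. }
  specialize (H1 t ltac:(lra)). specialize (H2 t ltac:(lra)). specialize (H3 t ltac:(lra)).
  cbv beta in *. rewrite cdot_self in H1.
  apply (circular_segment_in_image f f1 f2 R' r0 sg k0 (a t) q w Hf Hconv Hcurv Hr0 HR' Hsg);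
    try assumption; try lra.
  - apply Hball. unfold a. rewrite Cmod_scal by lra. apply Cmod_gt_0 in Hw0. nra.
  - intros k Hk. specialize (Hm k Hk). pose proof (pow2_ge_0 (Cmod (q - a t))). nra.
Qed.

(** Blaschke's rolling theorem at [w0 = d n].  Write [q = w0 + n (- s + i y)]; if
    [q] is outside the disk, the circle tangent at [w0] through [q] has radius
    [(s^2 + y^2) / (2 s) > R2].  It is the member with parameter [|y| / s] of
    the pencil of [w0] and [q], so a slightly smaller parameter gives a circular
    segment that crosses the tangent line at [w0]; it would belong to the
    image, which lies on one side of that line. *)
Lemma image_in_tangent_disk (f f1 f2 : C -> C) (R2 d : R) (n q : C) :
  smooth_univalent f f1 f2 -> convex (image f unit_disk) -> f 0%C = 0%C -> 0 < R2 ->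
  (forall R', R2 < R' -> exists r0, r0 < 1 /\ curvature_bound f1 f2 R' r0) ->
  0 < d -> Cmod n = 1 -> boundary (image f unit_disk) (d * n)%C ->
  (forall v, boundary (image f unit_disk) v -> d <= Cmod v) ->
  image f unit_disk q -> Cmod (q - (d - R2)%R * n) <= R2.
Proof.
  intros Hf Hconv Hf0 HR2 Hcurv Hd Hn Hb Hmin Hq.
  set (w0 := (d * n)%C) in *.
  assert (Hw0 : Cmod w0 = d) by (unfold w0; rewrite Cmod_scal by lra; rewrite Hn; ring).
  assert (Horig : image f unit_disk 0%C).
  { exists 0%C. unfold unit_disk. rewrite Cmod_0, Hf0. split; [lra|reflexivity]. }
  rewrite <- Hw0 in Hmin.
  assert (Hn2 : Re n ^ 2 + Im n ^ 2 = 1) by (rewrite <- Cmod2_alt, Hn; ring).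
  assert (Hhalf : forall v, image f unit_disk v -> cdot (v - w0) n <= 0).
  { intros v Hv. pose proof (nearest_boundary_support _ w0 v Hconv Horig Hb Hmin Hv) as H.
    rewrite Hw0 in H.
    assert (E : cdot v w0 = d * (cdot (v - w0) n + d * (Re n ^ 2 + Im n ^ 2)))
      by (unfold w0, cdot, Re, Im; simpl; ring).
    rewrite Hn2 in E.
    rewrite E in H. nra. }
  set (u := (q - w0)%C).
  set (s := - cdot u n). set (y := cdot u (Ci * n)%C).
  assert (Eu : u = (n * ((- s)%R, y))%C).
  { unfold s, y, cdot, Ci. destruct u as [u1 u2], n as [n1 n2]. unfold Re, Im in *. simpl in *.
    apply Ceq; simpl.
    - transitivity (u1 * (n1 * (n1 * 1) + n2 * (n2 * 1))); [rewrite Hn2; ring|ring].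
    - transitivity (u2 * (n1 * (n1 * 1) + n2 * (n2 * 1))); [rewrite Hn2; ring|ring]. }
  assert (Hs : 0 < s).
  { destruct Hq as [zq [Hzq Eq]]. unfold unit_disk in Hzq.
    destruct (disk_image_open f f1 f2 zq ((1 + Cmod zq) / 2) Hf ltac:(lra)) as [mu [Hmu Hop]].
    destruct (Hop (q + (mu / 2)%R * n)%C) as [x [Hx Ex]].
    { rewrite <- Eq. replace (q + (mu / 2)%R * n - q)%C with ((mu / 2)%R * n)%C by ring.
      rewrite Cmod_scal, Hn by lra. lra. }
    assert (Him : image f unit_disk (q + (mu / 2)%R * n)%C)
      by (exists x; split; [unfold unit_disk; lra|exact Ex]).
    apply Hhalf in Him.
    assert (E : cdot (q + (mu / 2)%R * n - w0)%C n = - s + mu / 2 * (Re n ^ 2 + Im n ^ 2)).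
    { unfold s, u, cdot, Re, Im. simpl. ring. }
    rewrite E, Hn2 in Him. lra. }
  assert (HL : Cmod u ^ 2 = s ^ 2 + y ^ 2).
  { rewrite Eu, Cmod_mult, Hn, Rmult_1_l, Cmod2_alt. unfold Re, Im; simpl; ring. }
  assert (Hmain : s ^ 2 + y ^ 2 <= 2 * R2 * s).
  { apply Rnot_lt_le. intros Hlt.
    set (Y := Rabs y). assert (HY : 0 <= Y) by apply Rabs_pos.
    assert (HYy : y ^ 2 = Y ^ 2) by (unfold Y; rewrite pow2_abs; reflexivity).
    assert (Hsg : exists sg, sg ^ 2 = 1 /\ y = - sg * Y).
    { unfold Y, Rabs. destruct (Rcase_abs y); [exists 1|exists (-1)]; split; ring. }
    destruct Hsg as [sg [Hsg Ey]].
    set (L := s ^ 2 + Y ^ 2). rewrite HYy in Hlt, HL. fold L in Hlt, HL.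
    assert (HL0 : 0 < L) by (unfold L; nra).
    set (R' := (R2 + L / (2 * s)) / 2).
    assert (HLs : R2 < L / (2 * s)).
    { apply (Rmult_lt_reg_r (2 * s)); [lra|]. unfold Rdiv. rewrite Rmult_assoc, Rinv_l by lra. lra. }
    assert (HR'1 : R2 < R') by (unfold R'; lra).
    assert (HR'2 : 2 * R' * s < L).
    { assert (L / (2 * s) * (2 * s) = L) by (field; lra).
      assert (R' < L / (2 * s)) by (unfold R'; lra). nra. }
    destruct (Hcurv R' HR'1) as [r0 [Hr0 Hbound]].
    set (kt := Y / s). assert (Hkt : 0 <= kt) by (apply Rmult_le_pos; [lra|left; apply Rinv_0_lt_compat, Hs]).
    assert (Ekt : kt * s = Y) by (unfold kt; field; lra).
    set (gap := L * (1 + kt ^ 2) - 4 * R' ^ 2).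
    assert (Hgap : 0 < gap).
    { assert (E : gap * s ^ 2 = L ^ 2 - (2 * R' * s) ^ 2).
      { unfold gap. transitivity (L * (s ^ 2 + (kt * s) ^ 2) - 4 * R' ^ 2 * s ^ 2); [ring|].
        rewrite Ekt. fold L. ring. }
      assert (0 < L ^ 2 - (2 * R' * s) ^ 2) by (assert (0 < 2 * R' * s) by (apply Rmult_lt_0_compat; lra); nra).
      assert (0 < s ^ 2) by (apply pow_lt, Hs). nra. }
    assert (HktL : 0 <= 2 * kt * L) by (apply Rmult_le_pos; lra).
    set (t := Rmin (gap / (2 * kt * L + 1)) (/ (Y + 1))).
    assert (Ht : 0 < t).
    { apply Rmin_pos; [apply Rdiv_lt_0_compat; lra|apply Rinv_0_lt_compat; lra]. }
    assert (HtY : t * (Y + 1) <= 1).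
    { apply (Rle_trans _ (/ (Y + 1) * (Y + 1))); [|right; field; lra].
      apply Rmult_le_compat_r; [lra|apply Rmin_r]. }
    assert (Htg : t * (2 * kt * L + 1) <= gap).
    { apply (Rle_trans _ (gap / (2 * kt * L + 1) * (2 * kt * L + 1))); [|right; field; lra].
      apply Rmult_le_compat_r; [lra|apply Rmin_l]. }
    set (k := kt - t).
    set (X := (s + k * Y + 1) / (Y - k * s)).
    assert (HD : 0 < Y - k * s) by (unfold k; nra).
    assert (HX0 : 0 <= X).
    { apply Rmult_le_pos; [|left; apply Rinv_0_lt_compat, HD]. unfold k. nra. }
    assert (HX : s + k * Y - X * (Y - k * s) = - 1) by (unfold X; field; lra).
    set (e := / (2 * (1 + X ^ 2))).
    assert (He : 0 < e) by (apply Rinv_0_lt_compat; nra).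
    assert (HeX : e * (1 + X ^ 2) = / 2) by (unfold e; field; nra).
    (* [w0 + e n (1 - i sg X)] lies beyond the tangent line and, because of the
       choice of [X], inside the pencil circle with parameter [k]. *)
    set (w := (w0 + e * (n * (1%R, (- sg * X)%R)))%C).
    assert (Hw : image f unit_disk w).
    { apply (circular_segment_boundary_endpoint f f1 f2 R' r0 sg k (1 + kt ^ 2 - 2 * t * kt) w0 q w);
        try assumption; try lra.
      - intros v Hv. apply (nearest_boundary_ball _ w0); assumption.
      - apply Cmod_gt_0. lra.
      - intros k' Hk'. unfold k in Hk'.
        destruct (Rle_lt_dec t kt) as [Hc|Hc]; [|pose proof (pow2_ge_0 k'); nra].
        assert ((kt - t) ^ 2 <= k' ^ 2) by (apply pow_incr; lra). nra.
      - fold u. rewrite HL. unfold gap in Htg. nra.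
      - assert (E : chord_side sg w0 q w = e * (Re n ^ 2 + Im n ^ 2) * (sg ^ 2 * (Y + s * X))).
        { unfold chord_side. fold u. rewrite Eu, Ey. unfold w, cdot, Ci, Re, Im. simpl. ring. }
        rewrite E, Hn2, Hsg. assert (0 < Y + s * X) by (unfold k in *; nra). nra.
      - assert (E : chord_power w0 q w + k * chord_side sg w0 q w =
          e * (Re n ^ 2 + Im n ^ 2) * (e * (1 + sg ^ 2 * X ^ 2) + s - sg ^ 2 * (X * Y) + k * (sg ^ 2 * (Y + s * X)))).
        { unfold chord_side, chord_power. fold u.
          replace (w - q)%C with (w - w0 - u)%C by (unfold u; ring).
          rewrite Eu, Ey. unfold w, cdot, Ci, Re, Im. simpl. ring. }
        rewrite E, Hn2, Hsg.
        replace (e * (1 + 1 * X ^ 2) + s - 1 * (X * Y) + k * (1 * (Y + s * X)))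
          with (e * (1 + X ^ 2) + (s + k * Y - X * (Y - k * s))) by ring.
        rewrite HX, HeX. nra. }
    apply Hhalf in Hw.
    assert (E : cdot (w - w0) n = e * (Re n ^ 2 + Im n ^ 2))
      by (unfold w, cdot, Re, Im; simpl; ring).
    rewrite E, Hn2 in Hw. lra. }
  apply Cmod_le_sqr; [lra|].
  replace (q - (d - R2)%R * n)%C with (u + R2 * n)%C by (unfold u, w0; rewrite RtoC_minus; ring).
  rewrite Eu. replace (n * ((- s)%R, y) + R2 * n)%C with (n * ((R2 - s)%R, y))%C
    by (apply Ceq; unfold Re, Im; simpl; ring).
  rewrite Cmod_mult, Hn, Rmult_1_l, Cmod2_alt. unfold Re, Im; simpl. nra.
Qed.

(** * Coefficients of functions bounded by one *)

Lemma rsum_split (a : nat -> R) (n m : nat) :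
  rsum a (n + m) = rsum a n + rsum (fun k => a (n + k)%nat) m.
Proof.
  induction m as [|m IH]; [rewrite Nat.add_0_r; simpl; ring|].
  rewrite Nat.add_succ_r. simpl. rewrite IH. ring.
Qed.

Lemma rsum_const (c : R) (n : nat) : rsum (fun _ => c) n = INR n * c.
Proof.
  induction n as [|n IH]; [simpl; ring|]. rewrite S_INR. simpl. rewrite IH. ring.
Qed.

Lemma rsum_Re_csum (a : nat -> C) (n : nat) : rsum (fun k => Re (a k)) n = Re (csum a n).
Proof. induction n as [|n IH]; [reflexivity|]. exact (f_equal2 Rplus IH eq_refl). Qed.

Lemma cis_plus (x y : R) : cis (x + y) = (cis x * cis y)%C.
Proof. unfold cis. rewrite cos_plus, sin_plus. apply Ceq; simpl; ring. Qed.

Lemma cis_pow (x : R) (n : nat) : (cis x ^ n)%C = cis (INR n * x).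
Proof.
  induction n as [|n IH]; [simpl; rewrite Rmult_0_l, cis_0; reflexivity|].
  rewrite S_INR, Rmult_plus_distr_r, Rmult_1_l, Rplus_comm, cis_plus, <- IH. reflexivity.
Qed.

Lemma cis_neq_1 (x : R) : 0 < x < 2 * PI -> cis x <> 1%C.
Proof.
  intros Hx E. assert (Hc : cos x = 1) by (exact (f_equal fst E)).
  replace x with (2 * (x / 2)) in Hc by field. rewrite cos_2a_sin in Hc.
  assert (0 < sin (x / 2)) by (apply sin_gt_0; lra). nra.
Qed.

Definition root_of_unity (M : nat) : C := cis (2 * PI / INR M).

Lemma Cmod_root_of_unity_pow (M k : nat) : Cmod (root_of_unity M ^ k) = 1.
Proof. unfold root_of_unity. rewrite cis_pow. apply Cmod_cis. Qed.

Lemma root_of_unity_pow_order (M : nat) : (0 < M)%nat -> (root_of_unity M ^ M)%C = 1%C.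
Proof.
  intros HM. apply lt_0_INR in HM. unfold root_of_unity. rewrite cis_pow.
  replace (INR M * (2 * PI / INR M)) with (2 * PI) by (field; lra).
  unfold cis. rewrite cos_2PI, sin_2PI. reflexivity.
Qed.

Lemma root_of_unity_pow_neq_1 (M j : nat) : (0 < j < M)%nat -> (root_of_unity M ^ j)%C <> 1%C.
Proof.
  intros [Hj HM]. unfold root_of_unity. rewrite cis_pow. apply cis_neq_1.
  apply lt_0_INR in Hj. apply lt_INR in HM. pose proof PI_RGT_0.
  assert (0 < INR M) by lra. split.
  - apply Rmult_lt_0_compat; [lra|]. apply Rdiv_lt_0_compat; lra.
  - apply (Rmult_lt_reg_r (INR M)); [lra|].
    replace (INR j * (2 * PI / INR M) * INR M) with (INR j * (2 * PI)) by (field; lra). nra.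
Qed.

Lemma geometric_csum (v : C) (n : nat) : ((v - 1) * csum (fun k => v ^ k)%C n)%C = (v ^ n - 1)%C.
Proof. induction n as [|n IH]; [simpl; ring|]. simpl. rewrite Cmult_plus_distr_l, IH. ring. Qed.

Lemma Cpow_add (z : C) (n m : nat) : (z ^ (n + m))%C = (z ^ n * z ^ m)%C.
Proof. induction n as [|n IH]; [simpl; ring|]. simpl. rewrite IH. ring. Qed.

Lemma Cpow_mul (z : C) (n m : nat) : (z ^ (n * m))%C = ((z ^ n) ^ m)%C.
Proof.
  induction m as [|m IH]; [rewrite Nat.mul_0_r; reflexivity|].
  rewrite Nat.mul_succ_r, Cpow_add, IH. simpl. ring.
Qed.

Lemma Cpow_1_l (n : nat) : (1 ^ n)%C = 1%C.
Proof. induction n as [|n IH]; [reflexivity|]. simpl. rewrite IH. ring. Qed.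

Lemma Cconj_mul_self (z : C) : (Cconj z * z)%C = RtoC (Cmod z ^ 2).
Proof. rewrite Cmult_comm. symmetry. apply Cmod2_conj. Qed.

Lemma roots_of_unity_orthogonal (M j : nat) : (0 < j < M)%nat ->
  csum (fun k => Cconj (root_of_unity M ^ k) ^ j)%C M = 0%C.
Proof.
  intros Hj. set (v := Cconj (root_of_unity M ^ j)).
  assert (Hv1 : (v - 1)%C <> 0%C).
  { intros E. apply (root_of_unity_pow_neq_1 M j Hj).
    rewrite <- (Cconj_conj (root_of_unity M ^ j)). fold v.
    replace v with (v - 1 + 1)%C by ring. rewrite E. apply Ceq; simpl; ring. }
  assert (HvM : (v ^ M)%C = 1%C).
  { unfold v. rewrite <- Cpow_conj, <- Cpow_mul, Nat.mul_comm, Cpow_mul.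
    rewrite root_of_unity_pow_order by lia. rewrite Cpow_1_l. apply Ceq; simpl; ring. }
  rewrite (csum_ext _ (fun k => v ^ k)%C).
  2:{ intros k _. unfold v. rewrite <- !Cpow_conj, <- !Cpow_mul, Nat.mul_comm. reflexivity. }
  pose proof (geometric_csum v M) as G. rewrite HvM in G.
  replace (csum (fun k => v ^ k)%C M) with (/ (v - 1) * ((v - 1) * csum (fun k => v ^ k)%C M))%C
    by (field; exact Hv1).
  rewrite G. ring.
Qed.

(** Parseval's identity for a polynomial, with the mean over [M] roots of unity
    for [M] at least the number of coefficients instead of an integral. *)
Lemma discrete_parseval (p : nat -> C) (s : R) (K M : nat) : (K <= M)%nat ->
  rsum (fun k => Cmod (pssum p (s * root_of_unity M ^ k) K) ^ 2) M =
  INR M * rsum (fun n => Cmod (p n) ^ 2 * s ^ (2 * n)) K.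
Proof.
  set (z := fun k => (s * root_of_unity M ^ k)%C).
  induction K as [|K IH]; intros HK.
  - simpl. rewrite (rsum_ext _ (fun _ => 0)); [rewrite rsum_const; ring|].
    intros k _. unfold pssum. simpl. rewrite Cmod_0. ring.
  - specialize (IH ltac:(lia)).
    assert (Hz : forall k, Cmod (z k) ^ 2 = s ^ 2).
    { intros k. unfold z. rewrite Cmod_mult, Cmod_root_of_unity_pow, Cmod_R, Rmult_1_r. apply pow2_abs. }
    assert (Horth : forall L, (L <= K)%nat ->
       csum (fun k => Cconj (p K * z k ^ K) * pssum p (z k) L)%C M = 0%C).
    { induction L as [|L IHL]; intros HL.
      - apply csum_zero. intros k _. unfold pssum. simpl. ring.
      - rewrite (csum_ext _ (fun k => Cconj (p K * z k ^ K) * pssum p (z k) L +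
             (Cconj (p K) * p L * RtoC ((s ^ 2) ^ L * s ^ (K - L))%R) *
             Cconj (root_of_unity M ^ k) ^ (K - L))%C).
        + rewrite csum_plus, csum_scal, IHL by lia.
          rewrite roots_of_unity_orthogonal by lia. ring.
        + intros k _. unfold pssum. simpl csum.
          rewrite Cmult_plus_distr_l. f_equal.
          rewrite Cmult_conj, Cpow_conj.
          replace (Cconj (z k) ^ K)%C with (Cconj (z k) ^ L * Cconj (z k) ^ (K - L))%C
            by (rewrite <- Cpow_add; f_equal; lia).
          transitivity (Cconj (p K) * p L * ((Cconj (z k) ^ L * z k ^ L) * Cconj (z k) ^ (K - L)))%C;
            [ring|].
          rewrite <- Cpow_mult_l, Cconj_mul_self, Hz, <- RtoC_pow.
          unfold z. rewrite Cmult_conj, Cpow_mult_l, RtoC_mult.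
          replace (Cconj s) with (RtoC s) by (apply Ceq; simpl; ring).
          rewrite <- (RtoC_pow s). ring. }
    rewrite (rsum_ext _ (fun k => (Cmod (pssum p (z k) K) ^ 2 + Cmod (p K) ^ 2 * s ^ (2 * K)) +
       2 * Re (Cconj (p K * z k ^ K) * pssum p (z k) K)%C)).
    + rewrite !rsum_plus, (rsum_scal 2), rsum_const.
      rewrite (rsum_Re_csum (fun k => Cconj (p K * z k ^ K) * pssum p (z k) K)%C), Horth by lia.
      unfold z in IH |- *. rewrite IH.
      cbn [rsum]. change (Re 0%C) with 0. ring.
    + intros k _. fold (z k). unfold pssum. simpl csum. fold (pssum p (z k) K).
      rewrite Cmod_sum_sqr_conj. f_equal. f_equal.
      rewrite Cmod_mult, Cmod_pow, Rpow_mult_distr, <- pow_mult, Nat.mul_comm, !pow_mult, Hz. reflexivity.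
Qed.

Lemma pssum_tail (b : nat -> C) (g : C) (z : C) (K : nat) :
  radius_ge_1 b -> Cmod z < 1 -> cvg (pssum b z) g ->
  Cmod (g - pssum b z K) <=
  Series (fun n => Cmod (b n) * Cmod z ^ n) - rsum (fun n => Cmod (b n) * Cmod z ^ n) K.
Proof.
  intros Hb Hz Hc. set (w := fun n => Cmod (b n) * Cmod z ^ n).
  assert (Hpos : forall n, 0 <= w n)
    by (intros n; apply Rmult_le_pos; [apply Cmod_ge_0|apply pow_le, Cmod_ge_0]).
  assert (Hshift : cvg (fun n => pssum b z (n + K)) g).
  { exact (proj1 (is_lim_seq_incr_n (fun n => Cmod (pssum b z n - g)) K 0) Hc). }
  assert (Hdiff : cvg (fun n => csum (fun k => b (K + k)%nat * z ^ (K + k))%C n) (g - pssum b z K)%C).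
  { apply (cvg_dominated _ _ (fun n => Cmod (pssum b z (n + K) - g))); [|exact Hshift].
    intros n. right. f_equal. unfold pssum. rewrite Nat.add_comm, csum_split. ring. }
  apply (cvg_Cmod_le _ _ (fun _ => Series w - rsum w K) _ Hdiff); [|apply is_lim_seq_const].
  intros n. apply (Rle_trans _ (rsum (fun k => w (K + k)%nat) n)).
  - apply Cmod_csum_le. intros k _. rewrite Cmod_mult, Cmod_pow. apply Rle_refl.
  - pose proof (rsum_split w K n).
    pose proof (rsum_le_Series w (K + n) Hpos (radius_ge_1_ex_series b _ Hb (conj (Cmod_ge_0 z) Hz))). lra.
Qed.

(** Multiplication by a function bounded by one does not increase the mean square
    on circles.  This is applied to the test function [1 + t z^N], and only
    the coefficients up to [N] of the product are kept. *)
Lemma schur_test_inequality (b : nat -> C) (g : C -> C) (N : nat) (t : C) :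
  radius_ge_1 b -> (forall z, Cmod z < 1 -> cvg (pssum b z) (g z)) ->
  (forall z, Cmod z < 1 -> Cmod (g z) <= 1) -> (0 < N)%nat ->
  rsum (fun n => Cmod (b n) ^ 2) N + Cmod (b N + t * b O) ^ 2 <= 1 + Cmod t ^ 2.
Proof.
  intros Hb Hg Hbd HN.
  set (p := fun n => (b n + (if (n <? N)%nat then 0 else t * b (n - N)%nat))%C).
  assert (Hp : forall z K, pssum p z (N + K) = (pssum b z (N + K) + t * z ^ N * pssum b z K)%C).
  { intros z K. unfold pssum.
    rewrite (csum_ext _ (fun n => b n * z ^ n + (if (n <? N)%nat then 0 else t * b (n - N)%nat) * z ^ n)%C)
      by (intros n _; unfold p; ring).
    rewrite csum_plus. f_equal. rewrite csum_split, csum_zero.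
    - rewrite <- csum_scal, Cplus_0_l. apply csum_ext. intros k _.
      replace (N + k <? N)%nat with false by (symmetry; apply Nat.ltb_ge; lia).
      replace (N + k - N)%nat with k by lia. rewrite Cpow_add. ring.
    - intros n Hn. replace (n <? N)%nat with true by (symmetry; apply Nat.ltb_lt; lia). ring. }
  set (h := fun n => if (n =? 0)%nat then RtoC 1 else if (n =? N)%nat then t else RtoC 0).
  assert (Hh : forall z, pssum h z (S N) = (1 + t * z ^ N)%C).
  { intros z. unfold pssum. destruct N as [|N']; [lia|].
    change (csum (fun k => h k * z ^ k)%C (S N') + h (S N') * z ^ S N' = 1 + t * z ^ S N')%C.
    rewrite csum_shift, csum_zero.
    - unfold h. simpl (_ =? 0)%nat. rewrite Nat.eqb_refl. simpl. ring.
    - intros k Hk. unfold h. replace (S k =? S N')%nat with false by (symmetry; apply Nat.eqb_neq; lia).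
      simpl. ring. }
  assert (Hh2 : forall s, rsum (fun n => Cmod (h n) ^ 2 * s ^ (2 * n)) (S N) = 1 + Cmod t ^ 2 * s ^ (2 * N)).
  { intros s. destruct N as [|N']; [lia|].
    change (rsum (fun n => Cmod (h n) ^ 2 * s ^ (2 * n)) (S N') + Cmod (h (S N')) ^ 2 * s ^ (2 * S N')
            = 1 + Cmod t ^ 2 * s ^ (2 * S N')).
    rewrite rsum_shift. rewrite (rsum_ext _ (fun _ => 0)).
    - rewrite rsum_const. unfold h. simpl (_ =? 0)%nat. rewrite Nat.eqb_refl. cbv iota.
      rewrite Cmod_1. simpl (2 * 0)%nat. simpl (s ^ 0). ring.
    - intros k Hk. unfold h. replace (S k =? S N')%nat with false by (symmetry; apply Nat.eqb_neq; lia).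
      simpl (S k =? 0)%nat. cbv iota. rewrite Cmod_0. ring. }
  pose proof (Cmod_ge_0 t) as Ht.
  assert (Hcircle : forall s, 0 < s < 1 ->
    rsum (fun n => Cmod (p n) ^ 2 * s ^ (2 * n)) (S N) <= 1 + Cmod t ^ 2).
  { intros s Hs. apply le_epsilon. intros eps Heps.
    set (w := fun n => Cmod (b n) * s ^ n).
    set (e := Rmin 1 (eps / (2 * (1 + Cmod t) + 1))).
    assert (He : 0 < e) by (apply Rmin_pos; [lra|apply Rdiv_lt_0_compat; lra]).
    assert (He1 : e <= 1) by apply Rmin_l.
    assert (He2 : e * (2 * (1 + Cmod t) + 1) <= eps).
    { apply (Rle_trans _ (eps / (2 * (1 + Cmod t) + 1) * (2 * (1 + Cmod t) + 1))); [|right; field; lra].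
      apply Rmult_le_compat_r; [lra|apply Rmin_r]. }
    assert (Hex : ex_series w) by (apply radius_ge_1_ex_series; [exact Hb|lra]).
    assert (Htail : exists K0, forall K, (K0 <= K)%nat -> Series w - rsum w K <= e / (1 + Cmod t)).
    { pose proof (is_series_rsum _ _ (Series_correct _ Hex)) as Hl.
      apply is_lim_seq_spec in Hl.
      assert (He' : 0 < e / (1 + Cmod t)) by (apply Rdiv_lt_0_compat; lra).
      destruct (Hl (mkposreal _ He')) as [K0 HK0]. exists K0. intros K HK. specialize (HK0 K HK).
      apply Rabs_lt_between in HK0. simpl in HK0. lra. }
    destruct Htail as [K0 Htail]. set (K := S K0). set (M := S (N + K)).
    assert (HM : 0 < INR M) by (apply lt_0_INR; unfold M; lia).
    assert (Hsum : rsum (fun k => Cmod (pssum p (s * root_of_unity M ^ k) (N + K)) ^ 2) M <=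
                   rsum (fun k => Cmod (pssum h (s * root_of_unity M ^ k) (S N)) ^ 2 + eps) M).
    { apply rsum_le. intros k _. set (z := (s * root_of_unity M ^ k)%C).
      assert (Hz : Cmod z = s) by (unfold z; rewrite Cmod_mult, Cmod_root_of_unity_pow, Cmod_R, Rabs_pos_eq; lra).
      rewrite Hp, Hh.
      assert (T1 : Cmod (g z - pssum b z (N + K)) <= e / (1 + Cmod t)).
      { eapply Rle_trans; [apply pssum_tail; [exact Hb|lra|apply Hg; lra]|].
        rewrite Hz. apply Htail. unfold K. lia. }
      assert (T2 : Cmod (g z - pssum b z K) <= e / (1 + Cmod t)).
      { eapply Rle_trans; [apply pssum_tail; [exact Hb|lra|apply Hg; lra]|].
        rewrite Hz. apply Htail. unfold K. lia. }
      set (P := (pssum b z (N + K) + t * z ^ N * pssum b z K)%C).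
      set (H := (1 + t * z ^ N)%C).
      assert (HzN : Cmod (z ^ N) <= 1) by (rewrite Cmod_pow, Hz, <- (pow1 N); apply pow_incr; lra).
      assert (HzN0 := Cmod_ge_0 (z ^ N)).
      assert (HH : Cmod H <= 1 + Cmod t).
      { unfold H. eapply Rle_trans; [apply Cmod_triangle|]. rewrite Cmod_1, Cmod_mult. nra. }
      assert (HP : Cmod P <= Cmod H + e).
      { replace P with (H * g z - ((g z - pssum b z (N + K)) + t * z ^ N * (g z - pssum b z K)))%C
          by (unfold P, H; ring).
        unfold Cminus at 1. eapply Rle_trans; [apply Cmod_triangle|]. rewrite Cmod_opp.
        pose proof (Cmod_triangle (g z - pssum b z (N + K)) (t * z ^ N * (g z - pssum b z K))) as T3.
        rewrite !Cmod_mult in T3. rewrite Cmod_mult.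
        pose proof (Hbd z ltac:(lra)) as Hgz. pose proof (Cmod_ge_0 H). pose proof (Cmod_ge_0 (g z)).
        pose proof (Cmod_ge_0 (g z - pssum b z K)) as T4.
        assert (Cmod t * Cmod (z ^ N) * Cmod (g z - pssum b z K) <= Cmod t * 1 * (e / (1 + Cmod t))).
        { apply Rmult_le_compat; try nra. }
        assert (E : e / (1 + Cmod t) + Cmod t * 1 * (e / (1 + Cmod t)) = e) by (field; lra).
        nra. }
      pose proof (Cmod_ge_0 P). pose proof (Cmod_ge_0 H).
      assert (Cmod P ^ 2 <= (Cmod H + e) ^ 2) by (apply pow_incr; lra). nra. }
    rewrite rsum_plus, rsum_const in Hsum.
    rewrite !discrete_parseval in Hsum by (unfold M, K; lia). rewrite Hh2 in Hsum.
    rewrite <- Rmult_plus_distr_l in Hsum. apply Rmult_le_reg_l in Hsum; [|exact HM].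
    eapply Rle_trans; [apply (rsum_mono _ (S N) (N + K))|].
    - intros n. apply Rmult_le_pos; [apply pow2_ge_0|apply pow_le; lra].
    - unfold K. lia.
    - assert (s ^ (2 * N) <= 1) by (rewrite <- (pow1 (2 * N)); apply pow_incr; lra).
      pose proof (pow2_ge_0 (Cmod t)). nra. }
  assert (Hall : rsum (fun n => Cmod (p n) ^ 2) (S N) <= 1 + Cmod t ^ 2).
  { apply Rnot_lt_le. intros Hlt. set (A := rsum (fun n => Cmod (p n) ^ 2) (S N)) in *.
    destruct (positive_nearby (fun u => (1 - u) ^ (2 * N) * A - (1 + Cmod t ^ 2))) as [eta [Heta Hu]].
    { auto_derive. exact I. }
    { rewrite Rminus_0_r, pow1. lra. }
    set (u := Rmin 1 eta / 2).
    assert (Hu1 : 0 < u /\ u < 1 /\ u < eta).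
    { pose proof (Rmin_pos 1 eta Rlt_0_1 Heta). pose proof (Rmin_l 1 eta). pose proof (Rmin_r 1 eta).
      unfold u. lra. }
    specialize (Hu u ltac:(lra)). specialize (Hcircle (1 - u) ltac:(lra)).
    assert ((1 - u) ^ (2 * N) * A <= rsum (fun n => Cmod (p n) ^ 2 * (1 - u) ^ (2 * n)) (S N)); [|lra].
    unfold A. rewrite <- rsum_scal. apply rsum_le. intros n Hn.
    rewrite Rmult_comm. apply Rmult_le_compat_l; [apply pow2_ge_0|].
    replace (2 * N)%nat with (2 * n + (2 * N - 2 * n))%nat by lia. rewrite pow_add.
    rewrite <- (Rmult_1_r ((1 - u) ^ (2 * n))) at 2.
    apply Rmult_le_compat_l; [apply pow_le; lra|].
    apply (Rle_trans _ (1 ^ (2 * N - 2 * n))); [apply pow_incr; lra|rewrite pow1; lra]. }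
  simpl rsum in Hall.
  replace (p N) with (b N + t * b O)%C in Hall.
  2:{ unfold p. replace (N <? N)%nat with false by (symmetry; apply Nat.ltb_irrefl).
      rewrite Nat.sub_diag. reflexivity. }
  rewrite (rsum_ext _ (fun n => Cmod (p n) ^ 2)); [exact Hall|].
  intros n Hn. unfold p. replace (n <? N)%nat with true by (symmetry; apply Nat.ltb_lt; lia).
  rewrite Cplus_0_r. reflexivity.
Qed.

(** [t = conj (b 0) b N / (1 - |b 0|^2)] is the value for which the test inequality
    is strongest. *)
Lemma schur_coefficient_bound (b : nat -> C) (g : C -> C) (N : nat) :
  radius_ge_1 b -> (forall z, Cmod z < 1 -> cvg (pssum b z) (g z)) ->
  (forall z, Cmod z < 1 -> Cmod (g z) <= 1) -> (0 < N)%nat -> Cmod (b O) < 1 ->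
  Cmod (b N) ^ 2 <= (1 - Cmod (b O) ^ 2) * (1 - rsum (fun n => Cmod (b n) ^ 2) N).
Proof.
  intros Hb Hg Hbd HN Hb0. pose proof (Cmod_ge_0 (b O)) as Hb00.
  set (a := Cmod (b O)) in *. set (D := 1 - a ^ 2).
  assert (HD : 0 < D) by (unfold D; nra).
  pose proof (schur_test_inequality b g N (Cconj (b O) * b N * (/ D)%R)%C Hb Hg Hbd HN) as H.
  replace (b N + Cconj (b O) * b N * (/ D)%R * b O)%C with (b N * (/ D)%R)%C in H.
  2:{ transitivity (b N * (1 + (/ D)%R * (Cconj (b O) * b O)))%C; [|ring].
      rewrite Cconj_mul_self. fold a. f_equal.
      rewrite <- RtoC_mult, <- RtoC_plus. f_equal. unfold D. field. unfold D in HD. lra. }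
  rewrite !Cmod_mult, Cmod_conj, Cmod_R, (Rabs_pos_eq (/ D)) in H by (left; apply Rinv_0_lt_compat, HD).
  fold a in H. set (x := Cmod (b N)) in *. set (S := rsum (fun n => Cmod (b n) ^ 2) N) in *.
  assert (E : (x * / D) ^ 2 - (a * x * / D) ^ 2 = x ^ 2 * / D).
  { unfold D. field. unfold D in HD. lra. }
  assert (H1 : x ^ 2 * / D <= 1 - S) by lra.
  apply (Rmult_le_compat_l D) in H1; [|lra].
  replace (D * (x ^ 2 * / D)) with (x ^ 2) in H1 by (field; lra). exact H1.
Qed.

(** After summation by parts, the weights enter through their nonnegative
    decrements, each multiplied by a partial sum. *)
Lemma rsum_weighted_le (w x y : nat -> R) (N : nat) :
  (forall n, 0 <= w (S n) <= w n) -> (forall n, rsum x n <= rsum y n) ->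
  rsum (fun n => w n * x n) N <= rsum (fun n => w n * y n) N.
Proof.
  intros Hw Hxy.
  assert (H : w N * (rsum y N - rsum x N) <=
              rsum (fun n => w n * y n) N - rsum (fun n => w n * x n) N).
  { induction N as [|N IH]; [simpl; lra|].
    pose proof (Hw N). pose proof (Hxy (S N)) as HS. simpl in *.
    assert (w (S N) * (rsum y N + y N - (rsum x N + x N)) <= w N * (rsum y N + y N - (rsum x N + x N)))
      by (apply Rmult_le_compat_r; lra).
    lra. }
  assert (0 <= w N) by (pose proof (Hw N); lra).
  pose proof (Hxy N). nra.
Qed.

(** The disk automorphism that takes the same value at the origin has coefficients
    of modulus [c n = (1 - a^2) a^n], where [a = |b 0|].  By the previous bounds its
    sums of squares dominate those of [b]; for [r <= a] the weights
    [r^(n+1) / c n] decrease, so the comparison passes to the weighted sums, and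
    [|b| <= (|b|^2 / c + c) / 2] turns squares into moduli. *)
Lemma bohr_sum_small_radius (b : nat -> C) (g : C -> C) (r : R) (N : nat) :
  radius_ge_1 b -> (forall z, Cmod z < 1 -> cvg (pssum b z) (g z)) ->
  (forall z, Cmod z < 1 -> Cmod (g z) <= 1) ->
  0 < Cmod (b O) < 1 -> 0 <= r <= Cmod (b O) ->
  rsum (fun n => Cmod (b (S n)) * r ^ S n) N <=
  rsum (fun n => (1 - Cmod (b O) ^ 2) * Cmod (b O) ^ n * r ^ S n) N.
Proof.
  intros Hb Hg Hbd Ha Hr. set (a := Cmod (b O)) in *.
  set (c := fun n => (1 - a ^ 2) * a ^ n).
  assert (Hc : forall n, 0 < c n).
  { intros n. apply Rmult_lt_0_compat; [nra|apply pow_lt; lra]. }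
  assert (Hsq : forall n, rsum (fun n => Cmod (b (S n)) ^ 2) n <= rsum (fun n => c n ^ 2) n).
  { induction n as [|n IH]; [simpl; lra|].
    rewrite (rsum_shift (fun n => c n ^ 2)).
    rewrite (rsum_ext (fun k => c (S k) ^ 2) (fun k => a ^ 2 * c k ^ 2))
      by (intros k _; unfold c; simpl; ring).
    rewrite rsum_scal.
    pose proof (schur_coefficient_bound b g (S n) Hb Hg Hbd ltac:(lia) (proj2 Ha)) as H.
    rewrite rsum_shift in H. fold a in H. cbn [rsum].
    replace (c O) with (1 - a ^ 2) by (unfold c; simpl; ring).
    assert (0 <= a ^ 2 * (rsum (fun n => c n ^ 2) n - rsum (fun n => Cmod (b (S n)) ^ 2) n))
      by (apply Rmult_le_pos; [apply pow2_ge_0|lra]).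
    nra. }
  set (w := fun n => r ^ S n * / c n).
  assert (Hw : forall n, 0 <= w (S n) <= w n).
  { intros n. assert (Hrn : 0 <= r ^ S n) by (apply pow_le; lra).
    pose proof (Rinv_0_lt_compat _ (Hc n)) as Hi.
    assert (E : w (S n) = r / a * w n).
    { unfold w, c. change (a ^ S n) with (a * a ^ n). change (r ^ S (S n)) with (r * r ^ S n).
      assert (0 < 1 - a ^ 2) by nra. assert (a ^ n <> 0) by (apply pow_nonzero; lra).
      field. repeat split; lra. }
    assert (Hra : 0 <= r / a <= 1).
    { split; [apply Rmult_le_pos; [lra|left; apply Rinv_0_lt_compat; lra]|].
      apply (Rmult_le_reg_r a); [lra|]. unfold Rdiv. rewrite Rmult_assoc, Rinv_l; lra. }
    assert (0 <= w n) by (unfold w; apply Rmult_le_pos; lra).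
    rewrite E. nra. }
  pose proof (rsum_weighted_le w _ _ N Hw Hsq) as H.
  apply (Rle_trans _ (rsum (fun n => / 2 * (w n * Cmod (b (S n)) ^ 2) + / 2 * (w n * c n ^ 2)) N)).
  - apply rsum_le. intros n _.
    assert (Hrn : 0 <= r ^ S n) by (apply pow_le; lra).
    pose proof (Rinv_0_lt_compat _ (Hc n)) as Hi.
    pose proof (Hc n) as Hcn.
    assert (E : / 2 * (w n * Cmod (b (S n)) ^ 2) + / 2 * (w n * c n ^ 2) - Cmod (b (S n)) * r ^ S n
                = / 2 * w n * (Cmod (b (S n)) - c n) ^ 2).
    { unfold w. field. lra. }
    assert (0 <= / 2 * w n * (Cmod (b (S n)) - c n) ^ 2); [|lra].
    apply Rmult_le_pos; [|apply pow2_ge_0]. unfold w.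
    apply Rmult_le_pos; [lra|]. apply Rmult_le_pos; lra.
  - rewrite rsum_plus, !rsum_scal.
    assert (E : rsum (fun n => w n * c n ^ 2) N = rsum (fun n => (1 - a ^ 2) * a ^ n * r ^ S n) N).
    { apply rsum_ext. intros n _. fold (c n). unfold w. pose proof (Hc n). field. lra. }
    lra.
Qed.

Lemma geometric_rsum_le (x : R) (N : nat) : 0 <= x < 1 -> (1 - x) * rsum (fun n => x ^ n) N <= 1.
Proof.
  intros Hx.
  assert (E : (1 - x) * rsum (fun n => x ^ n) N = 1 - x ^ N).
  { induction N as [|N IH]; [simpl; ring|]. simpl. rewrite Rmult_plus_distr_l, IH. ring. }
  rewrite E. pose proof (pow_le x N (proj1 Hx)). lra.
Qed.

(** With [a = |b 0|], the sum is at most [(1 - a^2) r / (1 - a r)], which is at most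
    [1 - a] exactly when [r <= 1 / (1 + 2 a)]; the condition [1/2 <= a] ensures
    [r <= a]. *)
Lemma bohr_sum (b : nat -> C) (g : C -> C) (r : R) (N : nat) :
  radius_ge_1 b -> (forall z, Cmod z < 1 -> cvg (pssum b z) (g z)) ->
  (forall z, Cmod z < 1 -> Cmod (g z) <= 1) ->
  / 2 <= Cmod (b O) < 1 -> 0 <= r -> r * (1 + 2 * Cmod (b O)) <= 1 ->
  rsum (fun n => Cmod (b (S n)) * r ^ S n) N <= 1 - Cmod (b O).
Proof.
  intros Hb Hg Hbd Ha Hr Hra. set (a := Cmod (b O)) in *.
  assert (Hle : r <= a) by nra.
  eapply Rle_trans; [apply (bohr_sum_small_radius b g r N Hb Hg Hbd); fold a; lra|].
  fold a.
  rewrite (rsum_ext _ (fun n => (1 - a ^ 2) * r * (a * r) ^ n))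
    by (intros n _; rewrite Rpow_mult_distr; simpl; ring).
  rewrite rsum_scal.
  assert (Har : 0 <= a * r < 1) by nra.
  pose proof (geometric_rsum_le (a * r) N Har) as HG.
  set (G := rsum (fun n => (a * r) ^ n) N) in *.
  assert (HG0 : 0 <= G) by (apply rsum_nonneg; intros k; apply pow_le; lra).
  assert ((1 + a) * r <= 1 - a * r) by lra.
  assert ((1 + a) * r * G <= 1) by nra.
  nra.
Qed.

(** * Limits of the curvature at the unit circle *)

Lemma to_unit_circle_iff (P : C -> Prop) :
  to_unit_circle P <-> exists r0, r0 < 1 /\ forall z, r0 < Cmod z < 1 -> P z.
Proof.
  split.
  - intros [eps H]. exists (1 - eps). split; [pose proof (cond_pos eps); lra|].
    intros z Hz. apply (H (Cmod z)); [|lra|reflexivity].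
    change (Rabs (Cmod z - 1) < eps). apply Rabs_lt_between. lra.
  - intros [r0 [Hr0 H]]. assert (Hpos : 0 < 1 - r0) by lra.
    exists (mkposreal _ Hpos). intros r Hr Hr1 z Hz. apply H.
    change (Rabs (r - 1) < 1 - r0) in Hr. apply Rabs_lt_between in Hr. lra.
Qed.

Lemma filter_limsup_lt {T : Type} (F : (T -> Prop) -> Prop) (g : T -> R) (M : R) :
  Rbar_lt (filter_limsup F g) M -> exists P, F P /\ forall x, P x -> g x <= M.
Proof.
  intros H. apply NNPP. intros Hno. apply (Rbar_lt_not_le _ _ H).
  apply (proj2 (proj2_sig (Rbar_ex_glb _))).
  intros s [P [HP ->]]. apply Rbar_not_lt_le. intros Hlt. apply Hno. exists P. split; [exact HP|].
  intros x Hx. apply (Rbar_le_trans (g x) _ M) with (2 := Rbar_lt_le _ _ Hlt).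
  apply (proj1 (Lub_Rbar_correct _)). exists x. auto.
Qed.

Lemma filter_liminf_gt {T : Type} (F : (T -> Prop) -> Prop) (g : T -> R) (M : R) :
  Rbar_lt M (filter_liminf F g) -> exists P, F P /\ forall x, P x -> M <= g x.
Proof.
  intros H. apply NNPP. intros Hno. apply (Rbar_lt_not_le _ _ H).
  apply (proj2 (proj2_sig (Rbar_ex_lub _))).
  intros s [P [HP ->]]. apply Rbar_not_lt_le. intros Hlt. apply Hno. exists P. split; [exact HP|].
  intros x Hx. apply (Rbar_le_trans M _ (g x) (Rbar_lt_le _ _ Hlt)).
  apply (proj1 (Glb_Rbar_correct _)). exists x. auto.
Qed.

Lemma filter_limsup_le {T : Type} (F : (T -> Prop) -> Prop) (g : T -> R) (P : T -> Prop) (M : R) :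
  F P -> (forall x, P x -> g x <= M) -> Rbar_le (filter_limsup F g) M.
Proof.
  intros HP H. apply (Rbar_le_trans _ (Lub_Rbar (fun y => exists x, P x /\ y = g x))).
  - apply (proj1 (proj2_sig (Rbar_ex_glb _))). exists P. auto.
  - apply (proj2 (Lub_Rbar_correct _)). intros y [x [Hx ->]]. exact (H x Hx).
Qed.

Lemma filter_liminf_ge {T : Type} (F : (T -> Prop) -> Prop) (g : T -> R) (P : T -> Prop) (M : R) :
  F P -> (forall x, P x -> M <= g x) -> Rbar_le M (filter_liminf F g).
Proof.
  intros HP H. apply (Rbar_le_trans _ (Glb_Rbar (fun y => exists x, P x /\ y = g x))).
  - apply (proj2 (Glb_Rbar_correct _)). intros y [x [Hx ->]]. exact (H x Hx).
  - apply (proj1 (proj2_sig (Rbar_ex_lub _))). exists P. auto.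
Qed.

Lemma filter_liminf_le_limsup {T : Type} (F : (T -> Prop) -> Prop) (g : T -> R) :
  (forall P Q, F P -> F Q -> exists x, P x /\ Q x) ->
  Rbar_le (filter_liminf F g) (filter_limsup F g).
Proof.
  intros HF. apply (proj2 (proj2_sig (Rbar_ex_lub _))). intros s [P [HP ->]].
  apply (proj2 (proj2_sig (Rbar_ex_glb _))). intros s [Q [HQ ->]].
  destruct (HF P Q HP HQ) as [x [HxP HxQ]].
  apply (Rbar_le_trans _ (g x)).
  - apply (proj1 (Glb_Rbar_correct _)). exists x. auto.
  - apply (proj1 (Lub_Rbar_correct _)). exists x. auto.
Qed.

Lemma Rbar_le_approx (M : R) (l : Rbar) : (forall m, m < M -> Rbar_le m l) -> Rbar_le M l.
Proof.
  intros H. destruct l as [l| |]; simpl; [|exact I|].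
  - apply Rnot_lt_le. intros Hlt. specialize (H ((l + M) / 2) ltac:(lra)). simpl in H. lra.
  - exact (H (M - 1) ltac:(lra)).
Qed.

Lemma to_unit_circle_meet (P Q : C -> Prop) :
  to_unit_circle P -> to_unit_circle Q -> exists z, P z /\ Q z.
Proof.
  rewrite !to_unit_circle_iff. intros [r1 [H1 HP]] [r2 [H2 HQ]].
  set (r := (1 + Rmax 0 (Rmax r1 r2)) / 2).
  assert (Hr : 0 < r /\ r1 < r /\ r2 < r /\ r < 1).
  { pose proof (Rmax_l 0 (Rmax r1 r2)). pose proof (Rmax_r 0 (Rmax r1 r2)).
    pose proof (Rmax_l r1 r2). pose proof (Rmax_r r1 r2).
    assert (Rmax 0 (Rmax r1 r2) < 1) by (repeat apply Rmax_lub_lt; lra). unfold r. lra. }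
  exists (RtoC r). assert (E : Cmod r = r) by (rewrite Cmod_R; apply Rabs_pos_eq; lra).
  split; [apply HP|apply HQ]; rewrite E; lra.
Qed.

Lemma power_series_smooth (A : nat -> C) (f : C -> C) :
  power_series_on_disk A f -> univalent_on unit_disk f ->
  smooth_univalent f (ps_fun (ps_deriv A)) (ps_fun (ps_deriv (ps_deriv A))).
Proof.
  intros HA Hinj. pose proof (power_series_radius A f HA) as Hrad.
  pose proof (ps_deriv_radius A Hrad) as Hrad1.
  constructor; [|intros z Hz; apply ps_fun_cdiff; assumption|exact Hinj].
  intros z Hz. apply (cdiff_ext (ps_fun A) f z _ (1 - Cmod z)); [lra| |apply ps_fun_cdiff; assumption].
  intros h Hh. symmetry. apply power_series_ps_fun; [exact HA|].
  pose proof (Cmod_triangle z h). lra.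
Qed.

Lemma curvature_eq (f f1 f2 : C -> C) (z : C) :
  (forall w, Cmod w < 1 -> cdiff f w (f1 w)) -> (forall w, Cmod w < 1 -> cdiff f1 w (f2 w)) ->
  Cmod z < 1 -> curvature f z = 1 / Cmod (z * f1 z) * Re (1 + z * (f2 z / f1 z))%C.
Proof.
  intros H1 H2 Hz.
  assert (E1 : forall w, Cmod w < 1 -> C_derive f w = f1 w)
    by (intros w Hw; apply cdiff_C_derive, H1, Hw).
  assert (E2 : C_derive (C_derive f) z = f2 z).
  { apply cdiff_C_derive, (cdiff_ext f1 _ z _ (1 - Cmod z)); [lra| |apply H2, Hz].
    intros h Hh. symmetry. apply E1. pose proof (Cmod_triangle z h). lra. }
  unfold curvature. rewrite E1, E2 by exact Hz. reflexivity.
Qed.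

(** The limit superior alone would admit points where [f'] or the curvature
    vanishes, since [1 / 0 = 0]; and it would admit negative curvature.  All of
    these are excluded by the limit inferior, which is at least [R1 > 0]. *)
Lemma CV_curvature_bound (R1 R2 R' : R) (f f1 f2 : C -> C) :
  CV R1 R2 f -> smooth_univalent f f1 f2 -> R2 < R' ->
  exists r0, r0 < 1 /\ curvature_bound f1 f2 R' r0.
Proof.
  intros [_ [_ [_ [_ [_ [HR1 [Hinf [_ Hsup]]]]]]]] Hf HR'.
  destruct (filter_limsup_lt to_unit_circle (fun z => 1 / curvature f z) R') as [P [HP HPb]].
  { apply (Rbar_le_lt_trans _ R2); [exact Hsup|exact HR']. }
  destruct (filter_liminf_gt to_unit_circle (fun z => 1 / curvature f z) (R1 / 2)) as [Q [HQ HQb]].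
  { apply (Rbar_lt_le_trans _ R1); [simpl; lra|exact Hinf]. }
  apply to_unit_circle_iff in HP. destruct HP as [r1 [Hr1 HP]].
  apply to_unit_circle_iff in HQ. destruct HQ as [r2 [Hr2 HQ]].
  exists (Rmax r1 r2). split; [apply Rmax_lub_lt; assumption|].
  intros z Hz. pose proof (Rmax_l r1 r2). pose proof (Rmax_r r1 r2).
  specialize (HPb z (HP z ltac:(lra))). specialize (HQb z (HQ z ltac:(lra))).
  rewrite (curvature_eq f f1 f2) in HPb, HQb by (apply Hf || lra).
  set (X := Cmod (z * f1 z)) in *. set (Y := Re (1 + z * (f2 z / f1 z))%C) in *.
  assert (HX0 : 0 <= X) by apply Cmod_ge_0.
  assert (HXne : X <> 0).
  { intros E. rewrite E in HQb. unfold Rdiv in HQb. rewrite Rinv_0 in HQb.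
    rewrite Rmult_0_r, Rmult_0_l, Rinv_0 in HQb. lra. }
  assert (HYne : Y <> 0).
  { intros E. rewrite E, Rmult_0_r in HQb. unfold Rdiv in HQb. rewrite Rinv_0 in HQb. lra. }
  replace (1 / (1 / X * Y)) with (X / Y) in HPb, HQb by (field; auto).
  assert (HY : 0 < Y).
  { apply Rnot_le_lt. intros HY.
    assert (HYi : / Y < 0) by (apply Rinv_lt_0_compat; lra).
    assert (X / Y <= 0) by (unfold Rdiv; nra). lra. }
  split.
  - intros E. apply HXne. unfold X. rewrite E, Cmult_0_r. apply Cmod_0.
  - apply (Rmult_le_compat_r Y) in HPb; [|lra].
    replace (X / Y * Y) with X in HPb by (field; exact HYne). exact HPb.
Qed.

(** * The majorant series *)

Lemma dist_to_boundary_eq (E : C -> Prop) (w0 : C) :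
  boundary E w0 -> (forall w, boundary E w -> Cmod w0 <= Cmod w) ->
  dist_to_boundary 0%C E = Cmod w0.
Proof.
  intros H0 Hmin. unfold dist_to_boundary.
  assert (E0 : forall w : C, Cmod (0 - w) = Cmod w)
    by (intros w; rewrite <- (Cmod_opp w); f_equal; ring).
  rewrite (is_glb_Rbar_unique _ (Cmod w0)); [reflexivity|]. split.
  - intros x [w [Hw ->]]. simpl. rewrite E0. apply Hmin, Hw.
  - intros b Hb. apply Hb. exists w0. rewrite E0. auto.
Qed.

Lemma CV_nearest_boundary_point (R1 R2 : R) (f f1 f2 : C -> C) :
  CV R1 R2 f -> smooth_univalent f f1 f2 -> 0 < R2 ->
  exists d n, 0 < d /\ Cmod n = 1 /\ delta f = d /\ boundary (image f unit_disk) (d * n)%C /\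
    forall w, boundary (image f unit_disk) w -> d <= Cmod w.
Proof.
  intros HCV Hf HR2. pose proof HCV as [_ [_ [_ [Hf0 _]]]].
  destruct (CV_curvature_bound R1 R2 (R2 + 1) f f1 f2 HCV Hf ltac:(lra)) as [r0 [Hr0 Hb]].
  assert (Horig : image f unit_disk 0%C).
  { exists 0%C. unfold unit_disk. rewrite Cmod_0, Hf0. split; [lra|reflexivity]. }
  destruct (image_not_plane f f1 f2 (R2 + 1) r0 Hf Hf0 Hb Hr0 ltac:(lra)) as [v Hv].
  destruct (segment_meets_boundary _ _ _ Horig Hv) as [t [_ Ht]].
  destruct (nearest_boundary_point (image f unit_disk)) as [w0 [Hw0 Hmin]]; [eauto|].
  assert (Hne : w0 <> 0%C).
  { intros E. rewrite E in Hw0.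
    destruct (disk_image_open f f1 f2 0 (/ 2) Hf) as [mu [Hmu Hop]]; [rewrite Cmod_0; lra|].
    destruct (Hw0 mu Hmu) as [_ [u [Hu1 Hu2]]]. apply Hu1.
    rewrite <- Hf0 in Hu2. destruct (Hop u Hu2) as [x [Hx ->]].
    exists x. split; [unfold unit_disk; lra|reflexivity]. }
  pose proof (proj1 (Cmod_gt_0 w0) Hne) as Hd.
  assert (En : (Cmod w0 * (w0 * (/ Cmod w0)%R))%C = w0).
  { rewrite Cmult_comm, <- Cmult_assoc, <- RtoC_mult, Rinv_l by lra. ring. }
  exists (Cmod w0), (w0 * (/ Cmod w0)%R)%C. rewrite En. repeat split; try assumption.
  - rewrite Cmod_mult, Cmod_R, Rabs_pos_eq by (left; apply Rinv_0_lt_compat, Hd). field. lra.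
  - unfold delta. rewrite Hf0. apply dist_to_boundary_eq; assumption.
  - apply Hw0; assumption.
  - apply Hw0; assumption.
Qed.

Lemma power_series_at_0 (A : nat -> C) (f : C -> C) : power_series_on_disk A f -> A O = f 0%C.
Proof.
  intros H. assert (H0 : unit_disk 0%C) by (unfold unit_disk; rewrite Cmod_0; lra).
  pose proof (cvg_shift _ _ (proj1 (is_pseries_cvg _ _ _) (H 0%C H0))) as Hc.
  apply (cvg_unique _ _ _) with (2 := Hc).
  apply (cvg_dominated _ _ (fun _ => 0)); [|apply is_lim_seq_const].
  intros n. right. unfold pssum. rewrite csum_shift, csum_zero.
  - replace (A O * 0 ^ 0 + 0 - A O)%C with (RtoC 0) by (simpl; ring). apply Cmod_0.
  - intros k _. simpl. ring.
Qed.

(** With the centre [c] and the radius [R2] of the tangent disk, [(f - c) / R2] is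
    bounded by one, and [a = |c| / R2 = 1 - delta / R2]; the assumption
    [R2 >= 2 delta] is [a >= 1/2], and the critical radius is
    [1 / (1 + 2 a)]. *)
Lemma majorant_series_bound (R1 R2 : R) (f : C -> C) (A : nat -> C) (r : R) :
  CV R1 R2 f -> power_series_on_disk A f -> R2 >= 2 * delta f ->
  0 <= r -> r <= critical_radius R2 f -> majorant_series A r <= delta f.
Proof.
  intros HCV HA HR2d Hr Hrc.
  pose proof HCV as [_ [Hinj [Hconv [Hf0 [_ [HR1 [H1 [H2 H3]]]]]]]].
  assert (HR2 : 0 < R2).
  { pose proof (Rbar_le_trans _ _ _ H1 (Rbar_le_trans _ _ _ H2 H3)) as H. simpl in H. lra. }
  pose proof (power_series_smooth A f HA Hinj) as Hf.
  set (f1 := ps_fun (ps_deriv A)) in *. set (f2 := ps_fun (ps_deriv (ps_deriv A))) in *.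
  destruct (CV_nearest_boundary_point R1 R2 f f1 f2 HCV Hf HR2) as [d [n [Hd [Hn [Ed [Hb Hmin]]]]]].
  unfold critical_radius in Hrc. rewrite Ed in *.
  set (c := ((d - R2)%R * n)%C).
  assert (Hdisk : forall z, Cmod z < 1 -> Cmod (f z - c) <= R2).
  { intros z Hz. apply (image_in_tangent_disk f f1 f2 R2 d n (f z)); try assumption.
    - intros R' HR'. exact (CV_curvature_bound R1 R2 R' f f1 f2 HCV Hf HR').
    - exists z. split; [exact Hz|reflexivity]. }
  set (a := 1 - d / R2).
  set (b := fun k => ((/ R2)%R * (A k - (if (k =? 0)%nat then c else 0)))%C).
  set (g := fun z => ((/ R2)%R * (f z + - c))%C).
  assert (Hi : 0 < / R2) by (apply Rinv_0_lt_compat, HR2).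
  assert (Hg : forall z, Cmod z < 1 -> cvg (pssum b z) (g z)).
  { intros z Hz. apply (is_lim_seq_incr_1 (fun k => Cmod (pssum b z k - g z))).
    change (cvg (fun k => pssum b z (S k)) (g z)).
    apply (cvg_ext (fun k => (/ R2)%R * (pssum A z (S k) + - c))%C).
    - intros k. unfold pssum. rewrite !csum_shift.
      rewrite (csum_ext (fun j => b (S j) * z ^ S j)%C (fun j => (/ R2)%R * (A (S j) * z ^ S j))%C)
        by (intros j _; unfold b; simpl; ring).
      rewrite csum_scal. unfold b. simpl. ring.
    - apply cvg_scal, cvg_plus.
      + apply cvg_shift, is_pseries_cvg, HA, Hz.
      + apply (cvg_dominated _ _ (fun _ => 0)); [|apply is_lim_seq_const].
        intros k. right. replace (- c - - c)%C with (RtoC 0) by ring. apply Cmod_0. }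
  assert (Hb0 : Cmod (b O) = a).
  { unfold b. simpl (0 =? 0)%nat. cbv iota. rewrite (power_series_at_0 A f HA), Hf0.
    rewrite Cmod_scal by lra.
    replace (0 - c)%C with ((R2 - d)%R * n)%C by (unfold c; rewrite !RtoC_minus; ring).
    rewrite Cmod_scal, Hn by lra. unfold a. field. lra. }
  assert (Hgb : forall z, Cmod z < 1 -> Cmod (g z) <= 1).
  { intros z Hz. unfold g. rewrite Cmod_scal by lra. specialize (Hdisk z Hz).
    apply (Rmult_le_reg_l R2); [exact HR2|]. rewrite <- Rmult_assoc, Rinv_r by lra.
    rewrite Rmult_1_l, Rmult_1_r. exact Hdisk. }
  assert (Hrad : radius_ge_1 b).
  { apply (power_series_radius b g). intros z Hz. apply is_pseries_cvg, Hg, Hz. }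
  assert (HdR : d / R2 * R2 = d) by (field; lra).
  assert (Hq : 0 < d / R2) by (apply Rdiv_lt_0_compat; lra).
  assert (Hbohr : forall N, rsum (fun k => Cmod (b (S k)) * r ^ S k) N <= 1 - a).
  { intros N. rewrite <- Hb0. apply (bohr_sum b g r N Hrad Hg Hgb); rewrite ?Hb0.
    - unfold a. split; [|lra]. apply (Rmult_le_reg_r R2); [exact HR2|]. lra.
    - exact Hr.
    - replace (1 + 2 * a) with ((3 * R2 - 2 * d) / R2) by (unfold a; field; lra).
      apply (Rmult_le_compat_r ((3 * R2 - 2 * d) / R2)) in Hrc.
      + replace (R2 / (3 * R2 - 2 * d) * ((3 * R2 - 2 * d) / R2)) with 1 in Hrc by (field; lra).
        exact Hrc.
      + left. apply Rdiv_lt_0_compat; lra. }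
  unfold majorant_series, PSeries.
  apply Series_le_bound.
  - intros k. apply Rmult_le_pos; [apply Cmod_ge_0|apply pow_le, Hr].
  - intros [|N]; [simpl; lra|]. rewrite rsum_shift.
    rewrite (power_series_at_0 A f HA), Hf0, Cmod_0, Rmult_0_l, Rplus_0_l.
    rewrite (rsum_ext _ (fun k => R2 * (Cmod (b (S k)) * r ^ S k))).
    + rewrite rsum_scal. specialize (Hbohr N). unfold a in Hbohr.
      replace d with (R2 * (1 - (1 - d / R2))) by (field; lra).
      apply Rmult_le_compat_l; lra.
    + intros k _. unfold b. simpl (S k =? 0)%nat. cbv iota.
      rewrite Cmod_scal by lra. replace (A (S k) - 0)%C with (A (S k)) by ring. field. lra.
Qed.

(** * The extremal functions [z / (1 - a z)] *)

Lemma one_minus_ge (a : R) (z : C) : 0 <= a < 1 -> Cmod z < 1 -> 1 - a <= Cmod (1 - a * z).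
Proof.
  intros Ha Hz. pose proof (Cmod_minus_ge 1 (a * z)) as H. rewrite Cmod_1, Cmod_scal in H by lra.
  pose proof (Cmod_ge_0 z). nra.
Qed.

Lemma one_minus_neq_0 (a : R) (z : C) : 0 <= a < 1 -> Cmod z < 1 -> (1 - a * z)%C <> 0%C.
Proof. intros Ha Hz. apply Cmod_gt_0. pose proof (one_minus_ge a z Ha Hz). lra. Qed.

Lemma cdiff_quadratic (f : C -> C) (z l : C) (B eta : R) :
  0 < eta -> (forall h, Cmod h < eta -> Cmod (f (z + h)%C - f z - l * h) <= B * Cmod h ^ 2) ->
  cdiff f z l.
Proof.
  intros Heta H eps Heps. pose proof (Rabs_pos B) as HB0. pose proof (Rle_abs B) as HB1.
  exists (Rmin eta (eps / (Rabs B + 1))). split.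
  { apply Rmin_pos; [exact Heta|apply Rdiv_lt_0_compat; lra]. }
  intros h Hh. pose proof (Rmin_l eta (eps / (Rabs B + 1))). pose proof (Rmin_r eta (eps / (Rabs B + 1))).
  specialize (H h ltac:(lra)). pose proof (Cmod_ge_0 h) as Hh0.
  assert (Hlt : Cmod h * (Rabs B + 1) <= eps).
  { apply (Rle_trans _ (eps / (Rabs B + 1) * (Rabs B + 1))); [|right; field; lra].
    apply Rmult_le_compat_r; lra. }
  apply (Rle_trans _ _ _ H). nra.
Qed.

Lemma k_fun_cdiff (a : R) (z : C) : 0 <= a < 1 -> Cmod z < 1 ->
  cdiff (k_fun a) z (/ (1 - a * z) ^ 2)%C.
Proof.
  intros Ha Hz. apply (cdiff_quadratic _ _ _ (a / (1 - a) ^ 3) (1 - Cmod z)); [lra|].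
  intros h Hh. assert (Hzh : Cmod (z + h) < 1) by (pose proof (Cmod_triangle z h); lra).
  pose proof (one_minus_neq_0 a z Ha Hz) as N1. pose proof (one_minus_neq_0 a (z + h) Ha Hzh) as N2.
  pose proof (one_minus_ge a z Ha Hz) as G1. pose proof (one_minus_ge a (z + h) Ha Hzh) as G2.
  unfold k_fun.
  replace ((z + h) / (1 - a * (z + h)) - z / (1 - a * z) - / (1 - a * z) ^ 2 * h)%C
    with ((a * h ^ 2) / ((1 - a * z) ^ 2 * (1 - a * (z + h))))%C by (field; auto).
  rewrite Cmod_div by (apply Cmult_neq_0; [apply Cpow_nz|]; assumption).
  rewrite Cmod_scal, Cmod_mult, !Cmod_pow by lra.
  assert (H3 : (1 - a) ^ 3 <= Cmod (1 - a * z) ^ 2 * Cmod (1 - a * (z + h))).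
  { replace ((1 - a) ^ 3) with ((1 - a) ^ 2 * (1 - a)) by ring.
    apply Rmult_le_compat; [apply pow2_ge_0|lra|apply pow_incr; lra|exact G2]. }
  assert (H0 : 0 < (1 - a) ^ 3) by (apply pow_lt; lra).
  apply Rinv_le_contravar in H3; [|exact H0]. pose proof (pow2_ge_0 (Cmod h)).
  unfold Rdiv. assert (0 <= a * Cmod h ^ 2) by nra. nra.
Qed.

Lemma k_fun_deriv_cdiff (a : R) (z : C) : 0 <= a < 1 -> Cmod z < 1 ->
  cdiff (fun w => / (1 - a * w) ^ 2)%C z (2 * a / (1 - a * z) ^ 3)%C.
Proof.
  intros Ha Hz. apply (cdiff_quadratic _ _ _ (6 / (1 - a) ^ 5) (1 - Cmod z)); [lra|].
  intros h Hh. assert (Hzh : Cmod (z + h) < 1) by (pose proof (Cmod_triangle z h); lra).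
  pose proof (one_minus_neq_0 a z Ha Hz) as N1. pose proof (one_minus_neq_0 a (z + h) Ha Hzh) as N2.
  pose proof (one_minus_ge a z Ha Hz) as G1. pose proof (one_minus_ge a (z + h) Ha Hzh) as G2.
  replace (/ (1 - a * (z + h)) ^ 2 - / (1 - a * z) ^ 2 - 2 * a / (1 - a * z) ^ 3 * h)%C
    with (((a ^ 2)%R * h ^ 2 * ((1 - a * z) + 2 * (1 - a * (z + h))))
           / ((1 - a * z) ^ 3 * (1 - a * (z + h)) ^ 2))%C
    by (rewrite RtoC_pow; field; auto).
  rewrite Cmod_div by (apply Cmult_neq_0; apply Cpow_nz; assumption).
  rewrite !Cmod_mult, !Cmod_pow, Cmod_R, (Rabs_pos_eq (a ^ 2)) by apply pow2_ge_0.
  assert (Hup : forall w, Cmod w < 1 -> Cmod (1 - a * w) <= 2).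
  { intros w Hw. unfold Cminus. eapply Rle_trans; [apply Cmod_triangle|].
    rewrite Cmod_1, Cmod_opp, Cmod_scal by lra. pose proof (Cmod_ge_0 w). nra. }
  assert (H6 : Cmod (1 - a * z + 2 * (1 - a * (z + h))) <= 6).
  { eapply Rle_trans; [apply Cmod_triangle|]. rewrite Cmod_scal by lra.
    pose proof (Hup z Hz). pose proof (Hup (z + h)%C Hzh). lra. }
  assert (H3 : (1 - a) ^ 5 <= Cmod (1 - a * z) ^ 3 * Cmod (1 - a * (z + h)) ^ 2).
  { replace ((1 - a) ^ 5) with ((1 - a) ^ 3 * (1 - a) ^ 2) by ring.
    apply Rmult_le_compat; [apply pow_le; lra|apply pow2_ge_0| |]; apply pow_incr; lra. }
  assert (H0 : 0 < (1 - a) ^ 5) by (apply pow_lt; lra).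
  apply Rinv_le_contravar in H3; [|exact H0].
  pose proof (pow2_ge_0 (Cmod h)) as Hh2.
  assert (Ha2 : 0 <= a ^ 2 <= 1) by nra.
  pose proof (Cmod_ge_0 (1 - a * z + 2 * (1 - a * (z + h)))) as Hm.
  unfold Rdiv.
  apply (Rle_trans _ (1 * Cmod h ^ 2 * 6 * / (1 - a) ^ 5)); [|right; ring].
  apply Rmult_le_compat; [|left; apply Rinv_0_lt_compat|  |exact H3].
  - apply Rmult_le_pos; [apply Rmult_le_pos|]; lra.
  - apply Rmult_lt_0_compat; apply pow_lt; lra.
  - apply Rmult_le_compat; [apply Rmult_le_pos; lra|lra| |exact H6].
    apply Rmult_le_compat_r; lra.
Qed.

Definition k_coef (a : R) (n : nat) : C :=
  match n with O => RtoC 0 | S m => (a ^ m)%C end.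

Lemma k_fun_power_series (a : R) : 0 <= a < 1 -> power_series_on_disk (k_coef a) (k_fun a).
Proof.
  intros Ha z Hz. unfold unit_disk in Hz. apply is_pseries_cvg.
  pose proof (one_minus_neq_0 a z Ha Hz) as N1. pose proof (Cmod_ge_0 z) as Hz0.
  assert (E : forall n, ((pssum (k_coef a) z (S n) - k_fun a z) = - (z * (a * z) ^ n) / (1 - a * z))%C).
  { intros n. unfold pssum. rewrite csum_shift.
    rewrite (csum_ext _ (fun k => z * (a * z) ^ k)%C)
      by (intros k _; unfold k_coef; simpl; rewrite Cpow_mult_l; ring).
    rewrite (csum_scal z (fun k => (a * z) ^ k)%C). pose proof (geometric_csum (a * z) n) as G.
    replace (csum (fun k => (a * z) ^ k)%C n) with (- ((a * z) ^ n - 1) / (1 - a * z))%C.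
    - unfold k_coef, k_fun. simpl. field. exact N1.
    - rewrite <- G. field. exact N1. }
  apply (is_lim_seq_incr_1 (fun n => Cmod (pssum (k_coef a) z n - k_fun a z))).
  apply (is_lim_seq_ext (fun n => Cmod z * / Cmod (1 - a * z) * (a * Cmod z) ^ n)).
  - intros n. rewrite E, Cmod_div by exact N1.
    rewrite Cmod_opp, Cmod_mult, Cmod_pow, Cmod_scal by lra. unfold Rdiv. ring.
  - replace (Finite 0) with (Finite (Cmod z * / Cmod (1 - a * z) * 0)) by (f_equal; ring).
    apply (is_lim_seq_scal_l _ (Cmod z * / Cmod (1 - a * z)) 0).
    apply is_lim_seq_geom. rewrite Rabs_pos_eq by nra. nra.
Qed.

Definition k_level (a : R) (w : C) : R := (1 - a ^ 2) * Cmod w ^ 2 - 2 * a * Re w.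

(** [k_fun a] is inverted by [w |-> w / (1 + a w)], so [w] is a value exactly when
    [|w| < |1 + a w|]. *)
Lemma k_fun_image (a : R) (w : C) : 0 <= a < 1 ->
  (image (k_fun a) unit_disk w <-> k_level a w < 1).
Proof.
  intros Ha.
  assert (Hsq : Cmod (1 + a * w) ^ 2 = 1 + 2 * a * Re w + a ^ 2 * Cmod w ^ 2)
    by (rewrite !Cmod2_alt; unfold Re, Im; simpl; ring).
  unfold k_level. split.
  - intros [z [Hz E]]. unfold unit_disk in Hz.
    pose proof (one_minus_neq_0 a z Ha Hz) as N1.
    assert (Ez : (w = z * (1 + a * w))%C) by (rewrite E; unfold k_fun; field; exact N1).
    assert (Hne : (1 + a * w)%C <> 0%C).
    { intros E0. apply N1. rewrite E0, Cmult_0_r in Ez. rewrite Ez in E0.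
      exfalso. apply C1_nz. rewrite <- E0. ring. }
    apply Cmod_gt_0 in Hne.
    assert (Hlt : Cmod w < Cmod (1 + a * w)) by (rewrite Ez at 1; rewrite Cmod_mult; nra).
    pose proof (Cmod_ge_0 w). nra.
  - intros H. assert (Hlt : Cmod w < Cmod (1 + a * w)).
    { apply Cmod_lt_sqr; [apply Cmod_ge_0|]. lra. }
    assert (Hpos : 0 < Cmod (1 + a * w)) by (pose proof (Cmod_ge_0 w); lra).
    assert (Hne : (1 + a * w)%C <> 0%C) by (apply Cmod_gt_0; exact Hpos).
    exists (w / (1 + a * w))%C. split.
    + unfold unit_disk. rewrite Cmod_div by exact Hne.
      apply (Rmult_lt_reg_r (Cmod (1 + a * w))); [exact Hpos|].
      unfold Rdiv. rewrite Rmult_assoc, Rinv_l by lra. lra.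
    + unfold k_fun. assert ((1 + a * w - a * w)%C <> 0%C).
      { replace (1 + a * w - a * w)%C with (RtoC 1) by ring. exact C1_nz. }
      field. auto.
Qed.

Lemma k_fun_convex (a : R) : 0 <= a < 1 -> convex (image (k_fun a) unit_disk).
Proof.
  intros Ha u v t Hu Hv Ht. rewrite !k_fun_image in * by exact Ha.
  assert (E : k_level a ((1 - t)%R * u + t * v)%C =
    (1 - t) * k_level a u + t * k_level a v - (1 - a ^ 2) * (t * (1 - t)) * Cmod (u - v) ^ 2).
  { unfold k_level. rewrite !Cmod2_alt. unfold Re, Im; simpl; ring. }
  rewrite E. pose proof (pow2_ge_0 (Cmod (u - v))).
  assert (0 <= (1 - a ^ 2) * (t * (1 - t)) * Cmod (u - v) ^ 2).
  { apply Rmult_le_pos; [|lra]. apply Rmult_le_pos; nra. }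
  destruct (Rle_lt_or_eq_dec 0 t) as [Ht0|Ht0]; [lra|nra|]. rewrite <- Ht0 in *. lra.
Qed.

Lemma k_fun_0 (a : R) : k_fun a 0%C = 0%C.
Proof. unfold k_fun, Cdiv. ring. Qed.

Lemma k_fun_delta (a : R) : 0 <= a < 1 -> delta (k_fun a) = / (1 + a).
Proof.
  intros Ha. assert (Hi : 0 < / (1 + a)) by (apply Rinv_0_lt_compat; lra).
  assert (Ei : / (1 + a) * (1 + a) = 1) by (field; lra).
  set (d := / (1 + a)) in *.
  assert (Hball : forall w, Cmod w < d -> image (k_fun a) unit_disk w).
  { intros w Hw. apply k_fun_image; [exact Ha|]. unfold k_level.
    pose proof (Cmod_ge_0 w). pose proof (re_le_Cmod w) as Hre. apply Rabs_le_between in Hre.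
    assert (H1 : (1 - a ^ 2) * Cmod w ^ 2 <= (1 - a ^ 2) * d ^ 2)
      by (apply Rmult_le_compat_l; [nra|apply pow_incr; lra]).
    assert (H2 : (1 - a ^ 2) * d ^ 2 + 2 * a * d = 1) by nra.
    destruct (Rle_lt_or_eq_dec 0 a) as [Ha0|Ha0]; [lra|nra|].
    rewrite <- Ha0 in *. nra. }
  assert (Eneg : Cmod (RtoC (- d)) = d) by (rewrite Cmod_R, Rabs_Ropp, Rabs_pos_eq; lra).
  unfold delta. rewrite k_fun_0, (dist_to_boundary_eq _ (RtoC (- d))); [exact Eneg| |].
  - intros eps Heps. split.
    + set (s := Rmin (eps / 2) (d / 2)).
      assert (Hs : 0 < s) by (apply Rmin_pos; lra).
      assert (Hs1 : s <= eps / 2) by apply Rmin_l. assert (Hs2 : s <= d / 2) by apply Rmin_r.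
      exists (RtoC (- d + s)). split.
      * apply Hball. rewrite Cmod_R, Rabs_left; lra.
      * rewrite <- RtoC_minus, Cmod_R. replace (- d + s - - d) with s by ring.
        rewrite Rabs_pos_eq; lra.
    + exists (RtoC (- d)). split.
      * rewrite k_fun_image by exact Ha. unfold k_level. rewrite Eneg.
        change (Re (RtoC (- d))) with (- d). nra.
      * replace (RtoC (- d) - RtoC (- d))%C with (RtoC 0) by ring. rewrite Cmod_0. exact Heps.
  - intros w Hw. rewrite Eneg. apply Rnot_lt_le. intros Hlt.
    destruct (Hw (d - Cmod w) ltac:(lra)) as [_ [v [Hv1 Hv2]]]. apply Hv1, Hball.
    pose proof (Cmod_minus_ge v w). lra.
Qed.

(** The circle [|z| = r] is mapped onto a circle of radius [r / (1 - a^2 r^2)]. *)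
Lemma k_fun_curvature (a : R) (z : C) : 0 <= a < 1 -> 0 < Cmod z < 1 ->
  1 / curvature (k_fun a) z = Cmod z / (1 - a ^ 2 * Cmod z ^ 2).
Proof.
  intros Ha Hz. pose proof (one_minus_neq_0 a z Ha (proj2 Hz)) as N1.
  rewrite (curvature_eq _ (fun w => / (1 - a * w) ^ 2)%C (fun w => 2 * a / (1 - a * w) ^ 3)%C);
    [|intros w Hw; apply k_fun_cdiff; assumption|intros w Hw; apply k_fun_deriv_cdiff; assumption|lra].
  set (P := Cmod (1 - a * z) ^ 2).
  assert (HP : 0 < P) by (apply pow_lt, Cmod_gt_0, N1).
  assert (E1 : Cmod (z * / (1 - a * z) ^ 2) = Cmod z / P).
  { rewrite Cmod_mult, Cmod_inv, Cmod_pow by (apply Cpow_nz, N1). reflexivity. }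
  assert (E2 : Re (1 + z * (2 * a / (1 - a * z) ^ 3 / / (1 - a * z) ^ 2))%C
               = (1 - a ^ 2 * Cmod z ^ 2) / P).
  { assert (NC : Cconj (1 - a * z) <> 0%C).
    { intros E. apply N1. rewrite <- (Cconj_conj (1 - a * z)), E. apply Ceq; simpl; ring. }
    replace (1 + z * (2 * a / (1 - a * z) ^ 3 / / (1 - a * z) ^ 2))%C
      with ((1 + a * z) * Cconj (1 - a * z) * (/ P)%R)%C.
    - rewrite Re_mult. change (Im (RtoC (/ P))) with 0. change (Re (RtoC (/ P))) with (/ P).
      rewrite Cmod2_alt. unfold Rdiv. rewrite Rmult_0_r, Rminus_0_r. f_equal.
      unfold Re, Im; simpl; ring.
    - rewrite RtoC_inv by lra. unfold P. rewrite Cmod2_conj. field. auto. }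
  rewrite E1, E2.
  assert (0 < 1 - a ^ 2 * Cmod z ^ 2).
  { assert (a * Cmod z < 1) by nra. assert (0 <= a * Cmod z) by nra. nra. }
  field. lra.
Qed.

Lemma k_fun_CV (a : R) : 0 <= a < 1 -> CV (/ (1 - a ^ 2)) (/ (1 - a ^ 2)) (k_fun a).
Proof.
  intros Ha. assert (Ha2 : 0 < 1 - a ^ 2) by nra.
  assert (Hcirc : forall r0, 0 <= r0 < 1 -> forall P : C -> Prop,
            (forall z, r0 < Cmod z < 1 -> P z) -> to_unit_circle P).
  { intros r0 Hr0 P HP. apply to_unit_circle_iff. exists r0. split; [lra|exact HP]. }
  repeat split.
  - eexists. apply k_fun_power_series, Ha.
  - intros z w Hz Hw E. unfold unit_disk in *.
    pose proof (one_minus_neq_0 a z Ha Hz) as N1. pose proof (one_minus_neq_0 a w Ha Hw) as N2.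
    assert (E1 : ((k_fun a z) * ((1 - a * z) * (1 - a * w)) = (k_fun a w) * ((1 - a * z) * (1 - a * w)))%C)
      by (rewrite E; reflexivity).
    unfold k_fun in E1.
    replace (z / (1 - a * z) * ((1 - a * z) * (1 - a * w)))%C with (z - a * z * w)%C in E1 by (field; auto).
    replace (w / (1 - a * w) * ((1 - a * z) * (1 - a * w)))%C with (w - a * z * w)%C in E1 by (field; auto).
    replace z with (z - a * z * w + a * z * w)%C by ring. rewrite E1. ring.
  - apply k_fun_convex, Ha.
  - apply k_fun_0.
  - rewrite (cdiff_C_derive _ _ _ (k_fun_cdiff a 0 Ha ltac:(rewrite Cmod_0; lra))).
    replace (1 - a * 0)%C with (RtoC 1) by ring. simpl. field.
  - apply Rinv_0_lt_compat, Ha2.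
  - apply Rbar_le_approx. intros m Hm.
    destruct (positive_nearby (fun u => (1 - u) / (1 - a ^ 2 * (1 - u) ^ 2) - m)) as [eta [Heta Hu]].
    { auto_derive. rewrite ?Rminus_0_r. nra. }
    { replace ((1 - 0) / (1 - a ^ 2 * (1 - 0) ^ 2)) with (/ (1 - a ^ 2)) by (field; nra). lra. }
    set (r0 := Rmax 0 (1 - eta)).
    assert (Hr0 : 0 <= r0 < 1) by (split; [apply Rmax_l|apply Rmax_lub_lt; lra]).
    assert (Hr0' : 1 - eta <= r0) by apply Rmax_r.
    apply (filter_liminf_ge _ _ (fun z => r0 < Cmod z < 1)); [apply (Hcirc r0 Hr0); auto|].
    intros z Hz. rewrite k_fun_curvature by (try exact Ha; lra).
    specialize (Hu (1 - Cmod z) ltac:(lra)). cbv beta in Hu.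
    replace (1 - (1 - Cmod z)) with (Cmod z) in Hu by ring. lra.
  - apply filter_liminf_le_limsup, to_unit_circle_meet.
  - apply (filter_limsup_le _ _ (fun z => 0 < Cmod z < 1)); [apply (Hcirc 0); [lra|auto]|].
    intros z Hz. rewrite k_fun_curvature by assumption.
    assert (Hz2 : Cmod z ^ 2 <= 1) by nra.
    assert (H1 : 1 - a ^ 2 <= 1 - a ^ 2 * Cmod z ^ 2) by (pose proof (pow2_ge_0 a); nra).
    apply Rinv_le_contravar in H1; [|exact Ha2].
    assert (0 < / (1 - a ^ 2 * Cmod z ^ 2)) by (apply Rinv_0_lt_compat; pose proof (pow2_ge_0 a); nra).
    unfold Rdiv. nra.
Qed.

Lemma Cmod_le_majorant (A : nat -> C) (f : C -> C) (r : R) :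
  power_series_on_disk A f -> 0 <= r < 1 -> Cmod (f r) <= majorant_series A r.
Proof.
  intros HA Hr. assert (Er : Cmod r = r) by (rewrite Cmod_R; apply Rabs_pos_eq; lra).
  assert (Hd : unit_disk r) by (unfold unit_disk; lra).
  apply (cvg_Cmod_le (pssum A r) _ (fun _ => majorant_series A r)); [|intros n|apply is_lim_seq_const].
  - apply is_pseries_cvg, HA, Hd.
  - apply (Rle_trans _ (rsum (fun k => Cmod (A k) * r ^ k) n)).
    + apply Cmod_csum_le. intros k _. rewrite Cmod_mult, Cmod_pow, Er. apply Rle_refl.
    + apply rsum_le_Series.
      * intros k. apply Rmult_le_pos; [apply Cmod_ge_0|apply pow_le; lra].
      * apply radius_ge_1_ex_series; [exact (power_series_radius A f HA)|exact Hr].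
Qed.

Theorem theorem7 :
  (forall (R1 R2 : R) (f : C -> C) (A : nat -> C),
     CV R1 R2 f -> power_series_on_disk A f -> R2 >= 2 * delta f ->
     forall r : R, 0 <= r -> r <= critical_radius R2 f ->
       majorant_series A r <= delta f) /\
  (forall a : R, 1 / 2 <= a -> a < 1 ->
     exists R1 R2 : R,
       CV R1 R2 (k_fun a) /\ R2 >= 2 * delta (k_fun a) /\
       forall A : nat -> C, power_series_on_disk A (k_fun a) ->
       forall r : R, critical_radius R2 (k_fun a) < r -> r < 1 ->
         ~ majorant_series A r <= delta (k_fun a)).
Proof.
  split.
  - intros R1 R2 f A HCV HA HR2 r Hr0 Hr. exact (majorant_series_bound R1 R2 f A r HCV HA HR2 Hr0 Hr).
  - intros a Ha1 Ha2. exists (/ (1 - a ^ 2)), (/ (1 - a ^ 2)).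
    assert (Ha : 0 <= a < 1) by lra.
    assert (Hpos : 0 < 1 - a ^ 2) by nra.
    split; [apply k_fun_CV, Ha|]. unfold critical_radius. rewrite k_fun_delta by exact Ha.
    assert (E : / (1 - a ^ 2) = / (1 + a) * / (1 - a)) by (field; split; [|split]; nra).
    assert (Hi : 0 < / (1 + a)) by (apply Rinv_0_lt_compat; lra).
    split.
    + rewrite E. assert (2 <= / (1 - a)); [|nra].
      rewrite <- (Rinv_inv 2). apply Rinv_le_contravar; lra.
    + intros A HA r Hr Hr1 Hle.
      replace (/ (1 - a ^ 2) / (3 * / (1 - a ^ 2) - 2 * / (1 + a))) with (/ (1 + 2 * a)) in Hr.
      2:{ rewrite E. field. repeat split; lra. }
      assert (Hr0 : 0 < r) by (apply (Rlt_trans _ (/ (1 + 2 * a))); [apply Rinv_0_lt_compat; lra|exact Hr]).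
      assert (Hbig : 1 < r * (1 + 2 * a)).
      { apply (Rmult_lt_compat_r (1 + 2 * a)) in Hr; [|lra]. rewrite Rinv_l in Hr by lra. exact Hr. }
      pose proof (Cmod_le_majorant A (k_fun a) r HA ltac:(lra)) as Hmaj.
      assert (Hval : Cmod (k_fun a r) = r / (1 - a * r)).
      { unfold k_fun. replace (1 - a * r)%C with (RtoC (1 - a * r)) by (rewrite RtoC_minus, RtoC_mult; reflexivity).
        rewrite <- RtoC_div, Cmod_R by nra. apply Rabs_pos_eq.
        apply Rmult_le_pos; [lra|left; apply Rinv_0_lt_compat; nra]. }
      rewrite Hval in Hmaj.
      assert (Hc : / (1 + a) < r / (1 - a * r)); [|lra].
      assert (H1 : 0 < 1 - a * r) by nra.
      apply (Rmult_lt_reg_r ((1 + a) * (1 - a * r))); [nra|].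
      replace (/ (1 + a) * ((1 + a) * (1 - a * r))) with (1 - a * r) by (field; lra).
      replace (r / (1 - a * r) * ((1 + a) * (1 - a * r))) with (r * (1 + a)) by (field; lra).
      lra.
Qed.
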